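(* Suppose that $\varphi$ is a non-negative, non-increasing function on $\mathbb{R}_+=(0,\infty)$. (i) $Q_\varphi$ is bounded on $L^2(\mathbb{R}_+)$ if and only if $x\varphi(x)$ is bounded on $\mathbb{R}_+$. (ii) $Q_\varphi$ is compact on $L^2(\mathbb{R}_+)$ if and only if $x\varphi(x)\to0$ as $x\to0$ and as $x\to\infty$. (iii) If $1/2<p<\infty$, then the following are equivalent: (a) $Q_\varphi\in\boldsymbol{S}_p$; (b) $\varphi\in X_p$; (c) the function $x\mapsto x\varphi(x)$ belongs to $L^p(\mathbb{R}_+,dx/x)$.
   Context: For a locally integrable complex-valued function $\varphi$ on $\mathbb{R}_+=(0,\infty)$, the operator $Q_\varphi$ is defined on bounded functions $f$ with compact support in $\mathbb{R}_+$ by $(Q_\varphi f)(x)=\int_0^\infty\varphi(\max\{x,y\})f(y)\,dy$. It is called bounded, compact, or a member of $\boldsymbol{S}_p$ if it extends to an operator on $L^2(\mathbb{R}_+)$ with that property. $\boldsymbol{S}_p$, $0<p<\infty$, is the Schatten--von Neumann class: bounded operators $T$ with $\sum_{n\ge0}s_n(T)^p<\infty$, where $s_n(T)=\inf\{\|T-R\|:\operatorname{rank}R\le n\}$. For $0<p<\infty$, $X_p$ is the space of all measurable functions $\varphi$ on $\mathbb{R}_+$ such that $$\sum_{n\in\mathbb{Z}}2^{np/2}\Bigl(\int_{2^n}^{2^{n+1}}|\varphi(x)|^2dx\Bigr)^{p/2}<\infty .$$ *)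

(* Defs.v *)
From HB Require Import structures.
From mathcomp Require Import all_boot all_order all_algebra.
From mathcomp Require Import complex.
From mathcomp Require Import all_classical all_reals all_analysis.
Import Order.TTheory GRing.Theory Num.Theory.
Import numFieldNormedType.Exports.

Set Implicit Arguments.
Unset Strict Implicit.
Unset Printing Implicit Defensive.

Local Open Scope classical_set_scope.
Local Open Scope ring_scope.
Local Open Scope complex_scope.

(* Functions on the half-line are represented by total functions on [R]; every
   notion below only looks at their values on [Rplus R]. Elements of
   L^2(Rplus) are handled through representatives, i.e. square integrable
   functions [R -> R[i]] considered up to equality almost everywhere. *)

Section HalfLine.
Variable R : realType.
Notation mu := (@lebesgue_measure R).

Definition Rplus : set R := `]0, +oo[%classic.

Definition cmeasurable (f : R -> R[i]) : Prop :=
  measurable_fun Rplus (fun x => complex.Re (f x)) /\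
  measurable_fun Rplus (fun x => complex.Im (f x)).

Definition cRintegral (D : set R) (f : R -> R[i]) : R[i] :=
  (\int[mu]_(x in D) complex.Re (f x)) +i* (\int[mu]_(x in D) complex.Im (f x)).

Definition L2norm (f : R -> R[i]) : \bar R :=
  'N[mu]_(2%:E)[(fun x => (Normc.normc (f x))%:E) \_ Rplus]%E.

Definition L2 : set (R -> R[i]) :=
  [set f | cmeasurable f /\ (L2norm f < +oo)%E].

Definition L2eq (f g : R -> R[i]) : Prop := f = g %[ae mu in Rplus].

Definition linear_operator (T : (R -> R[i]) -> (R -> R[i])) : Prop :=
  [/\ forall f, L2 f -> L2 (T f),
      forall f g, L2 f -> L2 g -> L2eq f g -> L2eq (T f) (T g) &
      forall (c : R[i]) f g, L2 f -> L2 g ->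
        L2eq (T (fun x => c * f x + g x)) (fun x => c * T f x + T g x)].

Definition opnorm (T : (R -> R[i]) -> (R -> R[i])) : \bar R :=
  ereal_sup [set L2norm (T f) | f in [set f | L2 f /\ (L2norm f <= 1)%E]].

Definition bounded_operator (T : (R -> R[i]) -> (R -> R[i])) : Prop :=
  linear_operator T /\ (opnorm T < +oo)%E.

Definition compact_operator (T : (R -> R[i]) -> (R -> R[i])) : Prop :=
  bounded_operator T /\
  forall f : nat -> R -> R[i],
    (forall n, L2 (f n) /\ (L2norm (f n) <= 1)%E) ->
    exists k : nat -> nat, exists g : R -> R[i],
      [/\ {homo k : m n / (m < n)%N}, L2 g &
          L2norm (fun x => T (f (k n)) x - g x) @[n --> \oo] --> 0%E].

Definition rank_le (n : nat) (S : (R -> R[i]) -> (R -> R[i])) : Prop :=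
  exists g : 'I_n -> R -> R[i],
    (forall i, L2 (g i)) /\
    forall f, L2 f -> exists c : 'I_n -> R[i],
      L2eq (S f) (fun x => \sum_(i < n) c i * g i x).

Definition singular_number (n : nat) (T : (R -> R[i]) -> (R -> R[i])) : \bar R :=
  ereal_inf [set opnorm (fun f x => T f x - S f x) |
             S in [set S | bounded_operator S /\ rank_le n S]].

Definition schatten (p : R) (T : (R -> R[i]) -> (R -> R[i])) : Prop :=
  bounded_operator T /\
  (\sum_(0 <= n <oo) (singular_number n T) `^ p < +oo)%E.

(* Meaningful when [phi] is locally integrable on [Rplus] and [f] is bounded
   with compact support; otherwise the integral may take a junk value. *)
Definition Qop (phi f : R -> R[i]) (x : R) : R[i] :=
  cRintegral Rplus (fun y => phi (Num.max x y) * f y).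

(* The support is contained in a compact subinterval of the open half-line, so
   it also stays away from 0. *)
Definition bounded_compact_support (f : R -> R[i]) : Prop :=
  [/\ cmeasurable f,
      exists M : R, forall x, 0 < x -> Normc.normc (f x) <= M &
      exists a b : R, 0 < a /\ forall x, 0 < x -> f x != 0 -> a <= x <= b].

Definition extends_Q (phi : R -> R[i]) (T : (R -> R[i]) -> (R -> R[i])) : Prop :=
  forall f, bounded_compact_support f -> L2eq (T f) (Qop phi f).

Definition Q_bounded (phi : R -> R[i]) : Prop :=
  exists T, bounded_operator T /\ extends_Q phi T.

Definition Q_compact (phi : R -> R[i]) : Prop :=
  exists T, compact_operator T /\ extends_Q phi T.

Definition Q_schatten (p : R) (phi : R -> R[i]) : Prop :=
  exists T, schatten p T /\ extends_Q phi T.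

Definition Xspace (p : R) : set (R -> R[i]) :=
  [set phi | cmeasurable phi /\
    (\esum_(n in [set: int])
       ((2 : R) `^ (n%:~R * p / 2))%:E *
       (\int[mu]_(x in `[(2 : R) ^ n, (2 : R) ^ (n + 1)])
          (Normc.normc (phi x) ^+ 2)%:E) `^ (p / 2) < +oo)%E].

(* L^p(Rplus, dx/x) *)
Definition Lp_dxx (p : R) : set (R -> R[i]) :=
  [set g | cmeasurable g /\
    (\int[mu]_(x in Rplus) (Normc.normc (g x) `^ p / x)%:E < +oo)%E].

End HalfLine.

(* Main.v *)
Require Import Defs.
From HB Require Import structures.
From mathcomp Require Import all_boot all_order all_algebra.
From mathcomp Require Import complex.
From mathcomp Require Import all_classical all_reals all_analysis.
From mathcomp Require Import measurable_realfun ring lra zify.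
Import Order.TTheory GRing.Theory Num.Theory.
Import numFieldNormedType.Exports.

(** The kernel is phi(max(x,y)), and everything is governed by the dyadic values
    a n = 2^n phi(2^n), which sample x phi(x) up to factors of 2.

    Boundedness. If x phi(x) <= M, the kernel is at most M / max(x,y), and the Schur
    test with the weight x^(-1/2) applies ([schur_test], [intop_bounded]). Conversely
    the image of the indicator of [x/2, x] is at least (x/2) phi(x) on that same
    interval, which bounds x phi(x) by twice the operator norm ([bounded_xphi]).

    Approximation. Let lam > 0 be such that only finitely many a n are at least lam.
    Cut each of the corresponding dyadic intervals into about sqrt(a n / lam) parts, on
    each of which both x and phi(x) vary by at most a fraction sqrt(lam / a n) of 2^n and
    phi(2^n). Off the diagonal blocks of this partition of the half-line the kernel
    depends on one variable only and has finite rank. In a diagonal block subtract the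
    infimum of phi: on a short interval the remainder has length times oscillation at
    most lam, and on the intervals left uncut x phi(x) is at most 2 lam, so by
    the Schur test the error has norm at most 8 lam ([finite_rank_approximation]).

    Compactness. If x phi(x) tends to 0 at both ends, the approximation is
    available for every lam, and norm limits of finite-rank operators are compact
    ([compact_of_finite_rank]). Conversely, if x phi(x) >= e along a sequence
    tending to 0 or to infinity, then the normalized indicators of disjoint intervals
    [x/2, x] have images with mass bounded below on disjoint sets, so no subsequence of the
    images converges ([compact_no_separated]).

    Schatten classes. The three conditions are equivalent to the convergence of the sum of
    the (a n)^p. For the two norm conditions this follows from monotonicity on dyadic
    intervals ([Xspace_summable], [Lp_dxx_summable]). If the sum converges, the
    approximation at the scales lam = 2^-l shows that the singular numbers are at most
    8 lam from a rank of order the sum of sqrt(a n / lam) over a n >= lam on; weighting with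
    lam^p and summing over l first leaves geometric series comparable to (a n)^p, exactly
    because p > 1/2 ([summable_schatten]). For the converse take the difference of the
    indicators of [2^n/2, 2^n] and [2 2^n, 2 2^n + 2^n/2]. Its image vanishes above its
    support, is constant below it, and jumps by at least half of the drop
    d n = 2^n (phi(2^n) - phi(2^(n+1))) between the two intervals. Among k + 1
    such functions with disjoint hulls an operator of rank k kills a combination,
    and the image of this combination under the given operator is locally one such
    jump plus a constant; so s_k is at least the smallest of the d n / 8
    ([singular_number_ge]). Ordering the drops in each residue class modulo 3
    bounds the sum of the (d n)^p by the sum of the s_k^p, and the recursion
    a n = d n + a (n+1) / 2 passes from the drops to the dyadic values
    ([schatten_summable]). *)

Set Implicit Arguments.
Unset Strict Implicit.
Unset Printing Implicit Defensive.

Local Open Scope classical_set_scope.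
Local Open Scope ring_scope.
Local Open Scope complex_scope.

(** * The squared L2 norm and operator norms *)

(** Lets filter lemmas be applied to statements that hold almost everywhere. *)
#[global] Instance lebesgue_ae_filter (R : realType) :
  Filter (nbhs (almost_everywhere (@lebesgue_measure R))).
Proof. exact: ae_filter_ringOfSetsType. Qed.

Section Energy.
Variable R : realType.
Local Notation mu := (@lebesgue_measure R).
Local Notation Rp := (@Rplus R).
Implicit Types (f g h : R -> R[i]) (u v : R -> R).
Implicit Types (T S : (R -> R[i]) -> R -> R[i]).

Definition renergy (u : R -> R) : \bar R := \int[mu]_(x in Rp) ((u x) ^+ 2)%:E.

(** The squared L2 norm, as an extended real integral, is handled throughout in
    place of the norm: it splits over real and imaginary parts and over disjoint
    sets. *)
Definition energy (f : R -> R[i]) : \bar R :=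
  \int[mu]_(x in Rp) ((Normc.normc (f x)) ^+ 2)%:E.

Lemma RplusE (x : R) : Rp x <-> 0 < x.
Proof. by rewrite /Rplus /= in_itv /= andbT. Qed.

Lemma measurable_Rplus : measurable Rp.
Proof. exact: measurable_itv. Qed.

Lemma sqr_normc (z : R[i]) :
  Normc.normc z ^+ 2 = complex.Re z ^+ 2 + complex.Im z ^+ 2.
Proof. by case: z => a b /=; rewrite sqr_sqrtr// addr_ge0// sqr_ge0. Qed.

Lemma measurable_sqrE (D : set R) (u : R -> R) : measurable_fun D u ->
  measurable_fun D (fun x => ((u x) ^+ 2)%:E).
Proof. by move=> mu_; apply/measurable_EFinP; exact: measurable_funX. Qed.

Lemma renergy_ge0 u : (0 <= renergy u)%E.
Proof. by apply: integral_ge0 => x _; rewrite lee_fin sqr_ge0. Qed.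

Lemma energy_ge0 f : (0 <= energy f)%E.
Proof. by apply: integral_ge0 => x _; rewrite lee_fin sqr_ge0. Qed.

Lemma energyE f : cmeasurable f ->
  energy f = (renergy (fun x => complex.Re (f x)) +
              renergy (fun x => complex.Im (f x)))%E.
Proof.
move=> [mRe mIm]; rewrite /energy /renergy -ge0_integralD//.
- by apply: eq_integral => x _; rewrite sqr_normc EFinD.
- exact: measurable_Rplus.
- by move=> x _; rewrite lee_fin sqr_ge0.
- exact: measurable_sqrE.
- by move=> x _; rewrite lee_fin sqr_ge0.
- exact: measurable_sqrE.
Qed.

Lemma measurable_sqr_normc f : cmeasurable f ->
  measurable_fun Rp (fun x => ((Normc.normc (f x)) ^+ 2)%:E).
Proof.
move=> [mRe mIm]; apply/measurable_EFinP.
under eq_fun do rewrite sqr_normc.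
by apply: measurable_funD; exact: measurable_funX.
Qed.

Lemma L2normE f : L2norm f = (energy f `^ 2^-1)%E.
Proof.
rewrite /L2norm unlock /= /energy [in RHS]integral_mkcond; congr poweR.
apply: eq_integral => x _; rewrite !patchE; case: ifP => _.
  rewrite abse_EFin /poweR; congr EFin.
  by rewrite powR_mulrn ?normr_ge0// real_normK// num_real.
by rewrite (_ : point = 0%E)// abse0 poweR0r// pnatr_eq0.
Qed.

Lemma L2P f : L2 f <-> cmeasurable f /\ (energy f < +oo)%E.
Proof.
rewrite /L2 /= L2normE; split=> -[mf].
  move=> fy; split => //; apply: lty_poweRy fy.
  by rewrite invr_eq0 pnatr_eq0.
by move=> fy; split => //; exact: poweR_lty.
Qed.

Lemma L2norm_le f (M : R) : 0 <= M ->
  (L2norm f <= M%:E)%E = (energy f <= (M ^+ 2)%:E)%E.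
Proof.
move=> M0; rewrite L2normE; have := energy_ge0 f.
case: (energy f) => [r| |]//=; last by rewrite invr_eq0 pnatr_eq0.
rewrite lee_fin => r0; rewrite !lee_fin powR12_sqrt//.
by rewrite -[in RHS](sqr_sqrtr r0) ler_sqr ?nnegrE ?sqrtr_ge0.
Qed.

Lemma cmeasurableD f g : cmeasurable f -> cmeasurable g ->
  cmeasurable (fun x => f x + g x).
Proof.
move=> [f1 f2] [g1 g2]; split.
  by under eq_fun do rewrite raddfD; exact: measurable_funD.
by under eq_fun do rewrite raddfD; exact: measurable_funD.
Qed.

Lemma cmeasurableZ (c : R[i]) f : cmeasurable f ->
  cmeasurable (fun x => c * f x).
Proof.
case: c => a b [f1 f2]; split.
  rewrite (_ : (fun _ => _) = (fun x => a * complex.Re (f x) - b * complex.Im (f x))).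
    by apply: measurable_funB; apply: measurable_funM.
  by apply/funext => x; case: (f x).
rewrite (_ : (fun _ => _) = (fun x => a * complex.Im (f x) + b * complex.Re (f x))).
  by apply: measurable_funD; apply: measurable_funM.
by apply/funext => x; case: (f x).
Qed.

Lemma cmeasurable0 : cmeasurable (fun _ : R => 0 : R[i]).
Proof. by split; exact: measurable_cst. Qed.

Lemma cmeasurable_sum n (F : 'I_n -> R -> R[i]) :
  (forall i, cmeasurable (F i)) -> cmeasurable (fun x => \sum_(i < n) F i x).
Proof.
elim: n F => [|n IH] F mF.
  under eq_fun do rewrite big_ord0; exact: cmeasurable0.
under eq_fun do rewrite big_ord_recr.
by apply: cmeasurableD => //; exact: IH.
Qed.

Lemma energyZ (c : R[i]) f : cmeasurable f ->
  energy (fun x => c * f x) = ((Normc.normc c ^+ 2)%:E * energy f)%E.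
Proof.
move=> mf; rewrite /energy -ge0_integralZl_EFin//.
- by apply: eq_integral => x _; rewrite Normc.normcM exprMn.
- exact: measurable_Rplus.
- by move=> x _; rewrite lee_fin sqr_ge0.
- exact: measurable_sqr_normc.
- exact: sqr_ge0.
Qed.

(** Comes from |a + b|^2 <= 2 |a|^2 + 2 |b|^2; the factor 2 only
    changes constants. *)
Lemma energyD f g : cmeasurable f -> cmeasurable g ->
  (energy (fun x => f x + g x)%R <= 2%:E * energy f + 2%:E * energy g)%E.
Proof.
move=> mf mg; rewrite /energy -!ge0_integralZl_EFin//; first last.
- exact: measurable_sqr_normc.
- by move=> x _; rewrite lee_fin sqr_ge0.
- exact: measurable_Rplus.
- exact: measurable_sqr_normc.
- by move=> x _; rewrite lee_fin sqr_ge0.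
- exact: measurable_Rplus.
have m2 h : cmeasurable h ->
    measurable_fun Rp (fun x => 2%:E * ((Normc.normc (h x)) ^+ 2)%:E)%E.
  by move=> mh; apply: measurable_funeM; exact: measurable_sqr_normc.
have h0 (h : R -> R[i]) x : (0 <= 2%:E * ((Normc.normc (h x)) ^+ 2)%:E)%E.
  by rewrite -EFinM lee_fin mulr_ge0// sqr_ge0.
rewrite -ge0_integralD//; [|exact: measurable_Rplus|exact: m2|exact: m2].
apply: ge0_le_integral => //.
- exact: measurable_Rplus.
- by move=> x _; rewrite lee_fin sqr_ge0.
- by apply: measurable_sqr_normc; exact: cmeasurableD.
- by apply: emeasurable_funD; exact: m2.
- move=> x _; rewrite -!EFinM -EFinD lee_fin !sqr_normc.
  case: (f x) (g x) => a b [c d] /=.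
  have := sqr_ge0 (a - c); have := sqr_ge0 (b - d); rewrite !expr2; lra.
Qed.

Lemma L2eqE (f g : R -> R[i]) : L2eq f g <-> {ae mu, forall x, 0 < x -> f x = g x}.
Proof.
rewrite /L2eq /ae_eq; split; apply: filterS => x h.
  by move=> x0; apply: h; exact/RplusE.
by move=> /RplusE; exact: h.
Qed.

Lemma L2eq_energy f g : cmeasurable f -> cmeasurable g -> L2eq f g ->
  energy f = energy g.
Proof.
move=> mf mg fg; apply: ge0_ae_eq_integral => //.
- exact: measurable_Rplus.
- exact: measurable_sqr_normc.
- exact: measurable_sqr_normc.
- by move=> x _; rewrite lee_fin sqr_ge0.
- by move=> x _; rewrite lee_fin sqr_ge0.
- by move: fg; apply: filterS => x h Dx; rewrite h.
Qed.

Lemma L2D f g : L2 f -> L2 g -> L2 (fun x => f x + g x).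
Proof.
move=> /L2P[mf fy] /L2P[mg gy]; apply/L2P; split; first exact: cmeasurableD.
apply: le_lt_trans (energyD mf mg) _.
by apply: lte_add_pinfty; apply: lte_mul_pinfty.
Qed.

Lemma L2Z c f : L2 f -> L2 (fun x => c * f x).
Proof.
move=> /L2P[mf fy]; apply/L2P; split; first exact: cmeasurableZ.
by rewrite energyZ//; apply: lte_mul_pinfty => //; rewrite lee_fin sqr_ge0.
Qed.

Lemma energy0 : energy (fun _ => 0) = 0%E.
Proof. by apply: integral0_eq => x _; rewrite Normc.normc0 expr0n. Qed.

Lemma L2_0 : L2 (fun _ : R => 0 : R[i]).
Proof. by apply/L2P; split; [exact: cmeasurable0|rewrite energy0]. Qed.

Lemma L2N f : L2 f -> L2 (fun x => - f x).
Proof. by move=> /(L2Z (-1)); under eq_fun do rewrite mulN1r. Qed.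

Lemma L2B f g : L2 f -> L2 g -> L2 (fun x => f x - g x).
Proof. by move=> f2 g2; apply: L2D => //; exact: L2N. Qed.

Lemma L2_sum n (F : 'I_n -> R -> R[i]) :
  (forall i, L2 (F i)) -> L2 (fun x => \sum_(i < n) F i x).
Proof.
elim: n F => [|n IH] F mF.
  under eq_fun do rewrite big_ord0; exact: L2_0.
by under eq_fun do rewrite big_ord_recr; apply: L2D => //; exact: IH.
Qed.

Lemma L2eq_refl (f : R -> R[i]) : L2eq f f.
Proof. by apply/L2eqE; apply: nearW. Qed.

Lemma L2eq_trans (f g h : R -> R[i]) : L2eq f g -> L2eq g h -> L2eq f h.
Proof.
move=> /L2eqE h1 /L2eqE h2; apply/L2eqE; move: h1 h2; apply: filterS2 => x.
by move=> e1 e2 x0; rewrite e1// e2.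
Qed.

Lemma L2eq_lin (c : R[i]) (f g f' g' : R -> R[i]) : L2eq f f' -> L2eq g g' ->
  L2eq (fun x => c * f x + g x) (fun x => c * f' x + g' x).
Proof.
move=> /L2eqE h1 /L2eqE h2; apply/L2eqE; move: h1 h2; apply: filterS2 => x.
by move=> e1 e2 x0; rewrite e1// e2.
Qed.

Lemma L2eqB (f g f' g' : R -> R[i]) : L2eq f f' -> L2eq g g' ->
  L2eq (fun x => f x - g x) (fun x => f' x - g' x).
Proof.
move=> /L2eqE h1 /L2eqE h2; apply/L2eqE; move: h1 h2; apply: filterS2 => x.
by move=> e1 e2 x0; rewrite e1// e2.
Qed.

Lemma linear_operatorB (T S : (R -> R[i]) -> R -> R[i]) :
  linear_operator T -> linear_operator S ->
  linear_operator (fun f x => T f x - S f x).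
Proof.
move=> [T1 T2 T3] [S1 S2 S3]; split.
- by move=> f f2; apply: L2B; [exact: T1|exact: S1].
- by move=> f g f2 g2 fg; apply: L2eqB; [exact: T2|exact: S2].
- move=> c f g f2 g2; apply: L2eq_trans (L2eqB (T3 c _ _ f2 g2) (S3 c _ _ f2 g2)) _.
  rewrite (_ : (fun _ => _) = (fun x => c * (T f x - S f x) + (T g x - S g x))).
    exact: L2eq_refl.
  by apply/funext => x; ring.
Qed.

Lemma linear_operator0 T : linear_operator T -> L2eq (T (fun _ => 0)) (fun _ => 0).
Proof.
move=> [_ _ /(_ 1 _ _ L2_0 L2_0)].
rewrite (_ : (fun x => 1 * 0 + 0) = (fun=> 0)); last first.
  by apply/funext => x; rewrite mulr0 addr0.
move=> /L2eqE h; apply/L2eqE; move: h; apply: filterS => x h x0.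
by move: (h x0) => /esym/eqP; rewrite mul1r -subr_eq0 addrK => /eqP.
Qed.

Lemma linear_operator_sum T n (c : 'I_n -> R[i]) (F : 'I_n -> R -> R[i]) :
  linear_operator T -> (forall i, L2 (F i)) ->
  L2eq (T (fun x => \sum_(i < n) c i * F i x))
       (fun x => \sum_(i < n) c i * T (F i) x).
Proof.
move=> lT; elim: n c F => [|n IH] c F F2.
  under eq_fun do rewrite big_ord0.
  under [X in L2eq _ X]eq_fun do rewrite big_ord0.
  exact: linear_operator0.
under eq_fun do rewrite big_ord_recl.
under [X in L2eq _ X]eq_fun do rewrite big_ord_recl.
have [_ _ T3] := lT.
apply: L2eq_trans (T3 _ _ _ _ _) _ => //.
  by apply: L2_sum => i; exact: L2Z.
by apply: L2eq_lin; [exact: L2eq_refl|apply: IH].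
Qed.

Lemma linear_operatorZ T (c : R[i]) f : linear_operator T -> L2 f ->
  L2eq (T (fun x => c * f x)) (fun x => c * T f x).
Proof.
move=> lT f2; have [_ _ T3] := lT.
have := T3 c _ _ f2 L2_0; under eq_fun do rewrite addr0.
move=> h; apply: L2eq_trans h _.
rewrite (_ : (fun x => c * T f x) = (fun x => c * T f x + 0)).
  by apply: L2eq_lin; [exact: L2eq_refl|exact: linear_operator0].
by apply/funext => x; rewrite addr0.
Qed.

Lemma L2norm_ge f (M : R) : 0 <= M ->
  (M%:E <= L2norm f)%E = ((M ^+ 2)%:E <= energy f)%E.
Proof.
move=> M0; rewrite L2normE; have := energy_ge0 f.
case: (energy f) => [r| |]//=; last by rewrite invr_eq0 pnatr_eq0 !leey.
rewrite lee_fin => r0; rewrite !lee_fin powR12_sqrt//.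
by rewrite -[in RHS](sqr_sqrtr r0) ler_sqr ?nnegrE ?sqrtr_ge0.
Qed.

Lemma opnorm_le T (C : R) : 0 <= C ->
  (forall f, L2 f -> (energy (T f) <= (C ^+ 2)%:E * energy f)%E) ->
  (opnorm T <= C%:E)%E.
Proof.
move=> C0 TC; apply: ge_ereal_sup => _ [f [f2 f1] <-].
rewrite L2norm_le//; apply: le_trans (TC f f2) _.
rewrite -[leRHS]mule1; apply: lee_wpmul2l; first by rewrite lee_fin sqr_ge0.
by move: f1; rewrite L2norm_le// expr1n.
Qed.

Lemma normc_real (c : R) : Normc.normc (c%:C) = `|c|.
Proof. by rewrite /Normc.normc /= expr0n /= addr0 sqrtr_sqr. Qed.

(** Division by the square root of e turns a bound e on the energy into the bound 1
    that the operator norm is defined with. *)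
Lemma energy_scale T f (e : R) : linear_operator T -> L2 f -> 0 < e ->
  let g := fun x => ((Num.sqrt e)^-1)%:C * f x in
  [/\ L2 g, energy g = ((e^-1)%:E * energy f)%E &
      energy (T g) = ((e^-1)%:E * energy (T f))%E].
Proof.
move=> lT f2 e0 g; have [T1 T2 T3] := lT.
have sq : Normc.normc (((Num.sqrt e)^-1)%:C : R[i]) ^+ 2 = e^-1.
  by rewrite normc_real real_normK ?num_real// exprVn sqr_sqrtr// ltW.
have g2 : L2 g by exact: L2Z.
have mT h : L2 h -> cmeasurable (T h) by move=> /T1 /L2P[].
split => //; first by rewrite energyZ ?sq//; case/L2P : f2.
rewrite -sq -energyZ; last exact: mT.
apply: L2eq_energy; [exact: mT|exact/cmeasurableZ/mT|].
exact: linear_operatorZ.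
Qed.

Lemma opnorm_ge T (C e : R) f : linear_operator T -> 0 <= C -> L2 f ->
  0 < e -> (energy f <= e%:E)%E -> ((C ^+ 2 * e)%:E <= energy (T f))%E ->
  (C%:E <= opnorm T)%E.
Proof.
move=> lT C0 f2 e0 fe TC.
have [g2 ge Tge] := energy_scale lT f2 e0.
set g := fun x => _ in g2 ge Tge.
apply: (@le_trans _ _ (L2norm (T g))).
  rewrite L2norm_ge// Tge; move: TC.
  case: (energy (T f)) => [r| |]; last by rewrite leeNy_eq.
    by rewrite -EFinM !lee_fin [_^-1 * _]mulrC ler_pdivlMr.
  by rewrite mulry gtr0_sg ?invr_gt0// mul1e !leey.
apply: ereal_sup_ubound; exists g => //; split => //.
rewrite L2norm_le// expr1n ge -(@mulVf _ e) ?gt_eqF// EFinM.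
by apply: lee_wpmul2l => //; rewrite lee_fin invr_ge0 ltW.
Qed.

Lemma opnorm_fin T : linear_operator T -> (opnorm T < +oo)%E ->
  exists2 C : R, 0 <= C & opnorm T = C%:E.
Proof.
move=> lT Ty; have T0 : (0 <= opnorm T)%E.
  apply: (@le_trans _ _ (L2norm (T (fun _ => 0)))).
    by rewrite L2normE poweR_ge0.
  apply: ereal_sup_ubound; exists (fun=> 0) => //; split; first exact: L2_0.
  by rewrite L2norm_le// energy0 expr1n lee_fin.
by case: (opnorm T) T0 Ty => // r r0 _; exists r.
Qed.

Lemma energy_opnorm T (C e : R) f : linear_operator T -> 0 <= C ->
  (opnorm T <= C%:E)%E -> L2 f -> 0 < e -> (energy f <= e%:E)%E ->
  (energy (T f) <= (C ^+ 2 * e)%:E)%E.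
Proof.
move=> lT C0 TC f2 e0 fe.
have [g2 ge Tge] := energy_scale lT f2 e0.
set g := fun x => _ in g2 ge Tge.
have : (L2norm (T g) <= C%:E)%E.
  apply: le_trans TC; apply: ereal_sup_ubound; exists g => //; split => //.
  rewrite L2norm_le// expr1n ge -(@mulVf _ e) ?gt_eqF// EFinM.
  by apply: lee_wpmul2l => //; rewrite lee_fin invr_ge0 ltW.
rewrite L2norm_le// Tge; have := energy_ge0 (T f).
case: (energy (T f)) => [r| |]//; last first.
  by rewrite mulry gtr0_sg ?invr_gt0// mul1e leye_eq.
by rewrite -EFinM !lee_fin => _; rewrite mulrC ler_pdivrMr.
Qed.

End Energy.

(** * Integrals of powers on the half-line *)

Section Power.
Variable R : realType.
Local Notation mu := (@lebesgue_measure R).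
Local Notation Rp := (@Rplus R).

Lemma integral_bigcup_le d (T : measurableType d) (m : {measure set T -> \bar R})
    (F : (set T)^nat) (f : T -> \bar R) (C : \bar R) :
  nondecreasing_seq F -> (forall i, measurable (F i)) ->
  (forall i, measurable_fun (F i) f) -> (forall i x, F i x -> (0 <= f x)%E) ->
  (forall i, (\int[m]_(x in F i) f x <= C)%E) ->
  (\int[m]_(x in \bigcup_i F i) f x <= C)%E.
Proof.
move=> ndF mF mf f0 fC.
have h := @ge0_nondecreasing_set_cvg_integral _ _ _ F f m ndF mF mf f0.
rewrite -(cvg_lim _ h)//; apply: lime_le; first by apply/cvg_ex; eexists; exact: h.
exact: nearW.
Qed.

Lemma integral_powR (a b q : R) : 0 < a -> a < b -> q != 0 ->
  (\int[mu]_(x in `[a, b]) (x `^ (q - 1))%:E = ((b `^ q - a `^ q) / q)%:E)%E.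
Proof.
move=> a0 ab q0.
have x0 (x : R) : x \in `[a, b] -> 0 < x.
  by rewrite in_itv /= => /andP[ax _]; exact: lt_le_trans ax.
have dF (x : R) : 0 < x -> is_derive x 1 (fun x : R => q^-1 * x `^ q : R) (x `^ (q - 1)).
  move=> x0'; have h := is_derive1_powR q x0'.
  have := @is_deriveZ _ _ _ _ q^-1 _ _ _ h.
  by rewrite /GRing.scale /= mulrA mulVf// mul1r.
have cF (x : R) : 0 < x -> {for x, continuous (fun x : R => q^-1 * x `^ q : R)}.
  move=> /dF dFx; apply: differentiable_continuous; apply/derivable1_diffP.
  exact: ex_derive.
rewrite (@continuous_FTC2 _ _ (fun x : R => q^-1 * x `^ q))//.
- by rewrite -EFinB -mulrBr mulrC.
- apply: derivable_within_continuous => x /x0 x0'.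
  by apply: ex_derive; exact: is_derive1_powR.
- split.
  + move=> x /subset_itv_oo_cc /x0 x0'; apply: ex_derive; exact: dF.
  + apply: cvg_at_right_filter.
    exact: cF.
  + apply: cvg_at_left_filter.
    by apply: cF; exact: lt_trans ab.
- move=> x /subset_itv_oo_cc /x0 x0'; rewrite derive1E.
  by have [_ ->] := dF _ x0'.
Qed.

Lemma measurable_powRE (D : set R) (q : R) :
  measurable_fun D (fun x : R => (x `^ q)%:E).
Proof.
by apply/measurable_EFinP; apply: measurable_funTS; exact: measurable_powR.
Qed.

(** Monotone convergence from intervals that stay away from 0. *)
Lemma integral_powR_near0 (b q : R) : 0 < b -> 0 < q ->
  (\int[mu]_(x in `]0%R, b]) (x `^ (q - 1)%R)%:E <= (b `^ q / q)%:E)%E.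
Proof.
move=> b0 q0.
have -> : `]0, b]%classic = \bigcup_i `[b / i.+2%:R, b]%classic.
  apply/seteqP; split=> x /=.
    rewrite in_itv /= => /andP[x0 xb].
    exists (Num.truncn (b / x)) => //=; rewrite in_itv /= xb andbT.
    rewrite ler_pdivrMr// mulrC -ler_pdivrMr//.
    have := truncnS_gt (b / x).
    by move=> /ltW /le_trans; apply; rewrite ler_nat.
  move=> [i _] /=; rewrite !in_itv /= => /andP[ix ->]; rewrite andbT.
  by apply: lt_le_trans ix; rewrite divr_gt0.
apply: integral_bigcup_le.
- move=> m n mn; rewrite subsetEset => x /=; rewrite !in_itv /= => /andP[h ->].
  rewrite andbT; apply: le_trans h; rewrite ler_pM2l// lef_pV2 ?posrE//.
  by rewrite ler_nat !ltnS.
- by move=> i; exact: measurable_itv.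
- by move=> i; exact: measurable_powRE.
- by move=> i x _; rewrite lee_fin powR_ge0.
- move=> i; rewrite integral_powR//; first last.
  + by rewrite gt_eqF.
  + by rewrite ltr_pdivrMr// ltr_pMr// ltr1n.
  + by rewrite divr_gt0.
  rewrite lee_fin ler_pM2r ?invr_gt0//.
  by rewrite lerBlDr lerDl powR_ge0.
Qed.

Lemma integral_powR_infty (a q : R) : 0 < a -> 0 < q ->
  (\int[mu]_(x in `[a, +oo[) (x `^ (- q - 1)%R)%:E <= (a `^ (- q) / q)%:E)%E.
Proof.
move=> a0 q0.
have -> : `[a, +oo[%classic = \bigcup_i `[a, a + i.+1%:R]%classic.
  apply/seteqP; split=> x /=.
    rewrite in_itv /= andbT => ax.
    exists (Num.truncn (x - a)) => //=; rewrite in_itv /= ax /=.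
    by rewrite -lerBlDl; apply/ltW/truncnS_gt.
  by move=> [i _] /=; rewrite !in_itv /= => /andP[-> _].
apply: integral_bigcup_le.
- move=> m n mn; rewrite subsetEset => x /=; rewrite !in_itv /= => /andP[-> h] /=.
  by apply: le_trans h _; rewrite lerD2l ler_nat ltnS.
- by move=> i; exact: measurable_itv.
- by move=> i; exact: measurable_powRE.
- by move=> i x _; rewrite lee_fin powR_ge0.
- move=> i; rewrite integral_powR//; first last.
  + by rewrite oppr_eq0 gt_eqF.
  + by rewrite ltrDl.
  rewrite lee_fin invrN mulrN -mulNr opprB ler_pM2r ?invr_gt0//.
  by rewrite lerBlDr lerDl powR_ge0.
Qed.

Lemma integral_Rplus_split (x : R) (f : R -> \bar R) : 0 < x ->
  measurable_fun Rp f -> (forall y, 0 < y -> (0 <= f y)%E) ->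
  (\int[mu]_(y in Rp) f y <=
   \int[mu]_(y in `]0%R, x]) f y + \int[mu]_(y in `[x, +oo[) f y)%E.
Proof.
move=> x0 mf f0.
have sub2 : `[x, +oo[%classic `<=` Rp.
  by move=> y /=; rewrite in_itv /= andbT => xy; apply/RplusE; exact: lt_le_trans xy.
have sub1 : `]x, +oo[%classic `<=` Rp.
  by move=> y /=; rewrite in_itv /= andbT => xy; apply/RplusE; exact: lt_trans xy.
have E : Rp = `]0, x]%classic `|` `]x, +oo[%classic.
  apply/seteqP; split=> y.
    move=> /RplusE y0; rewrite /= !in_itv /= y0 /= andbT.
    by have [?|?] := leP y x; [left|right].
  case=> [/=|/sub1//]; rewrite in_itv /= => /andP[y0 _]; exact/RplusE.
rewrite {1}E ge0_integral_setU//.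
- apply: leeD => //; apply: ge0_subset_integral => //=.
  + exact: (measurable_funS (@measurable_Rplus R) sub2 mf).
  + by move=> y /sub2 /RplusE; exact: f0.
  + by apply: subset_itvr; rewrite bnd_simp.
- by rewrite -E.
- by rewrite -E => y /RplusE; exact: f0.
- apply/disj_setPS => y [] /=; rewrite !in_itv /= andbT => /andP[_ yx] xy.
  by move: (le_lt_trans yx xy); rewrite ltxx.
Qed.

Lemma measurable_inv_max (x : R) : 0 < x ->
  measurable_fun Rp (fun y : R => (Num.max x y)^-1).
Proof.
move=> x0.
rewrite (_ : (fun _ => _) = (fun y : R => (Num.max x y) `^ (- 1))); last first.
  by apply/funext => y; rewrite powR_inv1// le_max ltW.
apply: (measurableT_comp (measurable_powR _)).
exact: measurable_maxr.
Qed.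

(** This makes x^(-1/2) a Schur weight for the kernel 1/max(x,y): both
    pieces, (1/x) times the integral of y^(-1/2) over ]0, x] and the integral of
    y^(-3/2) over [x, +oo[, equal 2 x^(-1/2). *)
Lemma integral_inv_max_powR (x : R) : 0 < x ->
  (\int[mu]_(y in Rp) ((Num.max x y)^-1 * y `^ (- 2^-1))%:E <=
   (4 * x `^ (- 2^-1))%:E)%E.
Proof.
move=> x0.
have mm : measurable_fun Rp (fun y : R => ((Num.max x y)^-1 * y `^ (- 2^-1))%:E).
  apply/measurable_EFinP; apply: measurable_funM; last first.
    by apply: measurable_funTS; exact: measurable_powR.
  exact: measurable_inv_max.
apply: le_trans (integral_Rplus_split x0 mm _) _.
  by move=> y y0; rewrite lee_fin mulr_ge0 ?powR_ge0// invr_ge0 le_max ltW.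
have E (p q : R) : x `^ p * x `^ q = x `^ (p + q).
  by rewrite powRD// (gt_eqF x0) implybT.
rewrite (_ : 4 * x `^ (- 2^-1) = x^-1 * (x `^ 2^-1 / 2^-1) + x `^ (- 2^-1) / 2^-1); last first.
  have e := E (-1) 2^-1; rewrite (_ : -1 + 2^-1 = - 2^-1 :> R) in e; last by lra.
  by rewrite -[in x^-1]powR_inv1 ?(ltW x0)// [X in X + _]mulrA e invrK; lra.
rewrite EFinD; apply: leeD.
  rewrite [leLHS](_ : _ = (\int[mu]_(y in `]0%R, x]) ((x^-1)%:E * (y `^ (2^-1 - 1)%R)%:E)))%E; last first.
    apply: eq_integral => y; rewrite inE /= in_itv /= => /andP[y0 yx].
    rewrite -EFinM max_l//; congr (_ * _ `^ _)%:E; lra.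
  rewrite ge0_integralZl_EFin//=.
  - rewrite EFinM; apply: lee_wpmul2l; first by rewrite lee_fin invr_ge0 ltW.
    by apply: integral_powR_near0.
  - by move=> y _; rewrite lee_fin powR_ge0.
  - exact: measurable_powRE.
  - by rewrite invr_ge0 ltW.
rewrite [leLHS](_ : _ = (\int[mu]_(y in `[x, +oo[) (y `^ (- 2^-1 - 1)%R)%:E))%E; last first.
  apply: eq_integral => y; rewrite inE /= in_itv /= andbT => xy.
  rewrite max_r// -[y^-1]powR_inv1 ?(le_trans (ltW x0))// -powRD.
    by rewrite addrC.
  by rewrite (gt_eqF (lt_le_trans x0 xy)) implybT.
exact: integral_powR_infty.
Qed.

(** The rows of the kernel 1/max(x,y) are square integrable, which makes the
    integral operator defined pointwise on all of L2. *)
Lemma integral_inv_max_sqr (x : R) : 0 < x ->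
  (\int[mu]_(y in Rp) ((Num.max x y)^-1 ^+ 2)%:E <= (2 / x)%:E)%E.
Proof.
move=> x0.
have mm : measurable_fun Rp (fun y : R => ((Num.max x y)^-1 ^+ 2)%:E).
  apply/measurable_EFinP; apply: measurable_funX.
  exact: measurable_inv_max.
apply: le_trans (integral_Rplus_split x0 mm _) _.
  by move=> y y0; rewrite lee_fin sqr_ge0.
rewrite (_ : 2 / x = x^-1 ^+ 2 * x + x `^ (-1) / 1); last first.
  by rewrite powR_inv1 ?ltW//; field; rewrite gt_eqF.
rewrite EFinD; apply: leeD.
  rewrite [leLHS](_ : _ = (\int[mu]_(y in `]0%R, x]) (x^-1 ^+ 2)%:E))%E; last first.
    apply: eq_integral => y; rewrite inE /= in_itv /= => /andP[y0 yx].
    by rewrite max_l.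
  rewrite integral_cst//= lebesgue_measure_itv /= lte_fin x0 -EFinB subr0.
  by rewrite -EFinM.
rewrite [leLHS](_ : _ = (\int[mu]_(y in `[x, +oo[) (y `^ (- 1 - 1)%R)%:E))%E; last first.
  apply: eq_integral => y; rewrite inE /= in_itv /= andbT => xy.
  have y0 : 0 < y by exact: lt_le_trans xy.
  rewrite max_r// -[y^-1]powR_inv1 ?ltW// expr2 -powRD//.
  by rewrite (gt_eqF y0) implybT.
exact: integral_powR_infty.
Qed.

End Power.

(** * Kernels and the Schur test *)

Section Kernel.
Variable R : realType.
Local Notation mu := (@lebesgue_measure R).
Local Notation Rp := (@Rplus R).
Implicit Types (k : R -> R -> R) (u v w : R -> R) (f g : R -> R[i]).

(** Optimizing over t: the choice is t = a / b. *)
Lemma sqr_le_of_amgm (a b c : R) : 0 <= a -> 0 < b -> 0 <= c ->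
  (forall t, 0 < t -> 2 * a <= t * b + t^-1 * c) -> a ^+ 2 <= b * c.
Proof.
move=> a0 b0 c0 h; have [a_eq0|a_neq0] := eqVneq a 0.
  by rewrite a_eq0 expr0n /= mulr_ge0// ltW.
have ap : 0 < a by rewrite lt_neqAle eq_sym a_neq0.
have := h (a / b) (divr_gt0 ap b0).
rewrite divfK ?gt_eqF// invf_div -subr_ge0 => h'.
have : 0 <= a * (a + b / a * c - 2 * a) by rewrite mulr_ge0.
rewrite (_ : a * _ = b * c - a ^+ 2) ?subr_ge0//.
by field.
Qed.

Lemma amgm_of_sqr_le (h p q t : R) : 0 < t -> 0 <= p -> 0 <= q ->
  h ^+ 2 <= p * q -> 2 * `|h| <= t * p + t^-1 * q.
Proof.
move=> t0 p0 q0 hpq.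
have a0 : 0 <= t * p + t^-1 * q.
  by rewrite addr_ge0// mulr_ge0// ?invr_ge0 ltW.
rewrite -ler_sqr ?nnegrE ?mulr_ge0//.
rewrite exprMn real_normK ?num_real//.
have : 0 <= (t * p - t^-1 * q) ^+ 2 by exact: sqr_ge0.
have -> : (t * p + t^-1 * q) ^+ 2 = (t * p - t^-1 * q) ^+ 2 + 4 * (p * q).
  by field; rewrite gt_eqF.
nra.
Qed.

(** With the weights hidden in the pointwise bound h^2 <= p q, the inequality serves
    the Schur test as well as plain products. It is integrated from
    2 |h| <= t p + q / t, where t is chosen only after the integration; the
    case t = 1 shows that h is integrable. *)
Lemma cauchy_schwarz d (T : measurableType d) (m : {measure set T -> \bar R})
    (D : set T) (h p q : T -> R) (a : R) :
  measurable D -> measurable_fun D h -> measurable_fun D p ->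
  measurable_fun D q -> (forall x, D x -> 0 <= p x) ->
  (forall x, D x -> 0 <= q x) -> (forall x, D x -> h x ^+ 2 <= p x * q x) ->
  0 < a -> (\int[m]_(x in D) (p x)%:E <= a%:E)%E ->
  (((\int[m]_(x in D) h x) ^+ 2)%:E <= a%:E * \int[m]_(x in D) (q x)%:E)%E.
Proof.
move=> mD mh mp mq p0 q0 hpq a0 pa.
have : (0 <= \int[m]_(x in D) (q x)%:E)%E by exact: integral_ge0.
case Eq : (\int[m]_(x in D) (q x)%:E)%E => [l| |]// l0; last first.
  by rewrite mulry gtr0_sg// mul1e leey.
have key t : 0 < t ->
    (2%:E * \int[m]_(x in D) (`|h x|)%:E <= (t * a + t^-1 * l)%:E)%E.
  move=> t0; rewrite -ge0_integralZl_EFin//; last first.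
    by apply/measurable_EFinP; exact: measurableT_comp.
  apply: (@le_trans _ _ (\int[m]_(x in D) ((t * p x)%:E + (t^-1 * q x)%:E))%E).
    apply: ge0_le_integral => //.
    - apply: measurable_funeM; apply/measurable_EFinP.
      exact: measurableT_comp.
    - apply: emeasurable_funD; apply/measurable_EFinP; exact: measurable_funM.
    - move=> x Dx; rewrite -EFinM -EFinD lee_fin.
      by apply: amgm_of_sqr_le; [|exact: p0|exact: q0|exact: hpq].
  rewrite ge0_integralD//; first last.
  - by apply/measurable_EFinP; exact: measurable_funM.
  - by move=> x Dx; rewrite lee_fin mulr_ge0 ?q0// invr_ge0 ltW.
  - by apply/measurable_EFinP; exact: measurable_funM.
  - by move=> x Dx; rewrite lee_fin mulr_ge0 ?p0// ltW.
  rewrite EFinD; under eq_integral do rewrite EFinM.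
  under [X in (_ + X <= _)%E]eq_integral do rewrite EFinM.
  rewrite !ge0_integralZl_EFin//; first last.
  - exact: ltW.
  - exact/measurable_EFinP.
  - by rewrite invr_ge0 ltW.
  - exact/measurable_EFinP.
  apply: leeD; last by rewrite Eq EFinM.
  by rewrite EFinM; apply: lee_wpmul2l => //; rewrite lee_fin ltW.
have hfin : (\int[m]_(x in D) (`|h x|)%:E < +oo)%E.
  have := key 1 ltr01.
  case: (\int[m]_(x in D) (`|h x|)%:E)%E => [r _| |_]; rewrite ?ltry ?ltNyr//.
  by rewrite mulry gtr0_sg// mul1e leye_eq.
have hi : m.-integrable D (EFin \o h).
  by apply/integrableP; split => //; exact/measurable_EFinP.
have hn : `|\int[m]_(x in D) h x| <= \int[m]_(x in D) `|h x|.
  exact: le_normr_Rintegral.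
rewrite -EFinM lee_fin -real_normK ?num_real//.
apply: (@le_trans _ _ ((\int[m]_(x in D) `|h x|) ^+ 2)).
  by rewrite lerXn2r// nnegrE Rintegral_ge0.
apply: sqr_le_of_amgm => //; first exact: Rintegral_ge0.
move=> t t0; have := key t t0.
rewrite -[X in (_ * X <= _)%E]fineK; last first.
  by rewrite ge0_fin_numE//; apply: integral_ge0.
by rewrite -EFinM lee_fin.
Qed.

Definition measurable_kernel k :=
  measurable_fun (Rp `*` Rp) (fun z : R * R => k z.1 z.2).

Lemma measurable_Rplus2 : measurable (Rp `*` Rp).
Proof. by apply: measurableX; exact: measurable_Rplus. Qed.

Lemma measurable_kernel_row k x : measurable_kernel k -> 0 < x ->
  measurable_fun Rp (k x).
Proof.
move=> mk x0.
have mp : measurable_fun Rp (fun y : R => (x, y)).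
  by apply: measurable_funTS; exact: measurable_pair1.
apply: (measurable_comp measurable_Rplus2 _ mk mp).
by move=> _ [y y0 <-]; split => //=; exact/RplusE.
Qed.

Lemma measurable_kernel_col k y : measurable_kernel k -> 0 < y ->
  measurable_fun Rp (k ^~ y).
Proof.
move=> mk y0.
have mp : measurable_fun Rp (fun x : R => (x, y)).
  by apply: measurable_funTS; exact: measurable_pair2.
apply: (measurable_comp measurable_Rplus2 _ mk mp).
by move=> _ [x x0 <-]; split => //=; exact/RplusE.
Qed.

Lemma measurable_kernel1 u : measurable_fun Rp u -> measurable_kernel (fun x _ => u x).
Proof.
move=> mu_; apply: (measurable_comp (@measurable_Rplus R) _ mu_).
  by move=> _ [[y z] [y0 z0] <-].
by apply: measurable_funTS; exact: measurable_fst.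
Qed.

Lemma measurable_kernel2 u : measurable_fun Rp u -> measurable_kernel (fun _ y => u y).
Proof.
move=> mu_; apply: (measurable_comp (@measurable_Rplus R) _ mu_).
  by move=> _ [[y z] [y0 z0] <-].
by apply: measurable_funTS; exact: measurable_snd.
Qed.

Lemma measurable_kernelM k1 k2 : measurable_kernel k1 -> measurable_kernel k2 ->
  measurable_kernel (fun x y => k1 x y * k2 x y).
Proof. by move=> m1 m2; exact: measurable_funM. Qed.

Section Tonelli.
Variable k : R -> R -> R.
Hypothesis mk : measurable_kernel k.
Hypothesis k0 : forall x y, 0 < x -> 0 < y -> 0 <= k x y.

Let F (z : R * R) : \bar R := ((fun z : R * R => (k z.1 z.2)%:E) \_ (Rp `*` Rp)) z.

Let mF : measurable_fun setT F.
Proof.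
apply/(measurable_restrictT _ measurable_Rplus2); exact/measurable_EFinP.
Qed.

Let F0 z : (0 <= F z)%E.
Proof.
rewrite /F patchE; case: ifPn => //; rewrite inE => -[/RplusE a /RplusE b].
by rewrite lee_fin k0.
Qed.

Let FE1 x : (\int[mu]_y F (x, y) =
  ((fun x => \int[mu]_(y in Rp) (k x y)%:E) \_ Rp) x)%E.
Proof.
rewrite patchE; case: ifPn => xR.
  rewrite [RHS]integral_mkcond; apply: eq_integral => y _.
  by rewrite /F !patchE /= in_setX xR.
by apply: integral0_eq => y _; rewrite /F patchE in_setX (negbTE xR).
Qed.

Let FE2 y : (\int[mu]_x F (x, y) =
  ((fun y => \int[mu]_(x in Rp) (k x y)%:E) \_ Rp) y)%E.
Proof.
rewrite patchE; case: ifPn => yR.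
  rewrite [RHS]integral_mkcond; apply: eq_integral => x _.
  by rewrite /F !patchE /= in_setX yR andbT.
by apply: integral0_eq => x _; rewrite /F patchE in_setX (negbTE yR) andbF.
Qed.

(** The Tonelli statements on the half-line are those on the whole line for the
    kernel extended by 0. *)
Lemma kernel_row_integral_measurable :
  measurable_fun Rp (fun x => \int[mu]_(y in Rp) (k x y)%:E)%E.
Proof.
apply/(measurable_restrictT _ (@measurable_Rplus R)).
have := measurable_fun_fubini_tonelli_F (m2 := mu) F mF F0.
by rewrite /fubini_F; under eq_fun do rewrite FE1.
Qed.

Lemma kernel_col_integral_measurable :
  measurable_fun Rp (fun y => \int[mu]_(x in Rp) (k x y)%:E)%E.
Proof.
apply/(measurable_restrictT _ (@measurable_Rplus R)).
have := measurable_fun_fubini_tonelli_G (m1 := mu) F mF F0.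
by rewrite /fubini_G; under eq_fun do rewrite FE2.
Qed.

Lemma kernel_tonelli :
  (\int[mu]_(x in Rp) \int[mu]_(y in Rp) (k x y)%:E =
   \int[mu]_(y in Rp) \int[mu]_(x in Rp) (k x y)%:E)%E.
Proof.
rewrite integral_mkcond [RHS]integral_mkcond.
under eq_integral do rewrite -FE1.
under [RHS]eq_integral do rewrite -FE2.
exact: fubini_tonelli.
Qed.

End Tonelli.

(** The positive and the negative part of the kernel are treated separately. *)
Lemma measurable_row_Rintegral k : measurable_kernel k ->
  measurable_fun Rp (fun x => \int[mu]_(y in Rp) (k x y)).
Proof.
move=> mk; rewrite /Rintegral.
have h (g : R -> R -> R) : measurable_kernel g ->
    measurable_fun Rp (fun x => \int[mu]_(y in Rp) (Num.max (g x y) 0)%:E)%E.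
  move=> mg; apply: kernel_row_integral_measurable.
    by apply: measurable_maxr => //; exact: measurable_cst.
  by move=> x y _ _; rewrite le_max lexx orbT.
have mNk : measurable_kernel (fun x y => - k x y) by exact: measurable_funN.
apply: (measurableT_comp (fine_measurable measurableT)).
under eq_fun do rewrite integralE.
apply: emeasurable_funB.
  apply: eq_measurable_fun (h _ mk) => x _; apply: eq_integral => y _.
  by rewrite funeposE -EFin_max.
apply: eq_measurable_fun (h _ mNk) => x _; apply: eq_integral => y _.
by rewrite funenegE -EFin_max.
Qed.

(** If w is a positive weight that the kernel and its transpose map below C w, then
    the operator has norm at most C: a weighted Cauchy-Schwarz inequality in each row, then
    Tonelli. *)
Lemma schur_test k w u (C : R) : measurable_kernel k ->
  (forall x y, 0 < x -> 0 < y -> 0 <= k x y) ->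
  measurable_fun Rp w -> (forall x, 0 < x -> 0 < w x) -> 0 < C ->
  (forall x, 0 < x ->
     (\int[mu]_(y in Rp) (k x y * w y)%:E <= (C * w x)%:E)%E) ->
  (forall y, 0 < y ->
     (\int[mu]_(x in Rp) (k x y * w x)%:E <= (C * w y)%:E)%E) ->
  measurable_fun Rp u ->
  (renergy (fun x => (\int[mu]_(y in Rp) (k x y * u y))%R) <=
    (C ^+ 2)%:E * renergy u)%E.
Proof.
move=> mk k0 mw w0 C0 row col mu_.
have mD := @measurable_Rplus R.
have mku : measurable_kernel (fun x y => k x y * u y).
  by apply: measurable_kernelM => //; exact: measurable_kernel2.
have mwV : measurable_fun Rp (fun y => (w y)^-1).
  have h : measurable_fun Rp (fun y => w y `^ (-1)).
    exact: (measurableT_comp (measurable_powR _)).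
  apply: eq_measurable_fun h => y; rewrite inE => /RplusE y0.
  by rewrite powR_inv1// ltW// w0.
(* Cauchy-Schwarz for the splitting k u = (k w)^(1/2) (k u^2 / w)^(1/2); the row
   bound takes care of the first factor, the column bound of the second. *)
pose q x y := (C * w x) * (k x y * (u y ^+ 2 * (w y)^-1)).
have mq : measurable_kernel q.
  apply: measurable_kernelM.
    by apply: measurable_kernel1; exact: measurable_funM.
  apply: measurable_kernelM => //; apply: measurable_kernel2.
  by apply: measurable_funM => //; exact: measurable_funX.
have muw : measurable_fun Rp (fun y => u y ^+ 2 * (w y)^-1).
  by apply: measurable_funM => //; exact: measurable_funX.
have q0 x y : 0 < x -> 0 < y -> 0 <= q x y.
  move=> x0 y0; apply: mulr_ge0; first by rewrite mulr_ge0 ?ltW// w0.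
  by rewrite mulr_ge0 ?k0// mulr_ge0 ?sqr_ge0// invr_ge0 ltW// w0.
have pw x : 0 < x ->
   (((\int[mu]_(y in Rp) (k x y * u y))%R ^+ 2)%:E <=
     \int[mu]_(y in Rp) (q x y)%:E)%E.
  move=> x0; have Cw0 : 0 < C * w x by rewrite mulr_gt0 ?w0.
  have mkx := measurable_kernel_row mk x0.
  under eq_integral do rewrite EFinM.
  rewrite ge0_integralZl_EFin ?(ltW Cw0)//; last 2 first.
  - move=> y /RplusE y0; rewrite lee_fin mulr_ge0 ?k0// mulr_ge0 ?sqr_ge0//.
    by rewrite invr_ge0 ltW// w0.
  - by apply/measurable_EFinP; exact: measurable_funM.
  apply: (@cauchy_schwarz _ _ mu Rp (fun y => k x y * u y) (fun y => k x y * w y)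
    (fun y => k x y * (u y ^+ 2 * (w y)^-1)) (C * w x)) => //.
  - exact: measurable_funM.
  - exact: measurable_funM.
  - exact: measurable_funM.
  - by move=> y /RplusE y0; rewrite mulr_ge0 ?k0// ltW// w0.
  - move=> y /RplusE y0; rewrite mulr_ge0 ?k0// mulr_ge0 ?sqr_ge0//.
    by rewrite invr_ge0 ltW// w0.
  - move=> y /RplusE y0; rewrite le_eqVlt; apply/orP; left; apply/eqP.
    by field; rewrite gt_eqF// w0.
  - exact: row.
apply: (@le_trans _ _ (\int[mu]_(x in Rp) \int[mu]_(y in Rp) (q x y)%:E)%E).
  apply: ge0_le_integral => //.
  - by move=> x _; rewrite lee_fin sqr_ge0.
  - apply: measurable_sqrE; exact: measurable_row_Rintegral.
  - exact: kernel_row_integral_measurable.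
  - by move=> x /RplusE; exact: pw.
rewrite kernel_tonelli// /renergy -ge0_integralZl_EFin ?sqr_ge0//; last 2 first.
- by move=> x _; rewrite lee_fin sqr_ge0.
- exact: measurable_sqrE.
apply: ge0_le_integral => //.
- move=> y /RplusE y0; apply: integral_ge0 => x /RplusE x0.
  by rewrite lee_fin q0.
- exact: kernel_col_integral_measurable.
- by apply: measurable_funeM; exact: measurable_sqrE.
move=> y /RplusE y0.
have a0 : 0 <= C * (u y ^+ 2 * (w y)^-1).
  by rewrite mulr_ge0 ?(ltW C0)// mulr_ge0 ?sqr_ge0// invr_ge0 ltW// w0.
rewrite (_ : (\int[mu]_(x in Rp) (q x y)%:E =
  \int[mu]_(x in Rp) ((C * (u y ^+ 2 * (w y)^-1))%:E * (k x y * w x)%:E))%E); last first.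
  by apply: eq_integral => x _; rewrite -EFinM; congr EFin; rewrite /q; ring.
rewrite ge0_integralZl_EFin//; last 2 first.
- by move=> x /RplusE x0; rewrite lee_fin mulr_ge0 ?k0// ltW// w0.
- apply/measurable_EFinP; apply: measurable_funM => //.
  exact: measurable_kernel_col.
apply: (@le_trans _ _ ((C * (u y ^+ 2 * (w y)^-1))%:E * (C * w y)%:E)%E).
  by apply: lee_wpmul2l; [rewrite lee_fin|exact: col].
rewrite -!EFinM lee_fin le_eqVlt; apply/orP; left; apply/eqP.
by field; rewrite gt_eqF// w0.
Qed.

End Kernel.

(** * Integral operators on complex functions *)

Section IntegralOperator.
Variable R : realType.
Local Notation mu := (@lebesgue_measure R).
Local Notation Rp := (@Rplus R).
Implicit Types (k : R -> R -> R) (u v w : R -> R) (f g : R -> R[i]) (D : set R).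

Definition cintegrable D f : Prop :=
  mu.-integrable D (fun x => (complex.Re (f x))%:E) /\
  mu.-integrable D (fun x => (complex.Im (f x))%:E).

Lemma integrable_scale D (t : R) u : measurable D ->
  mu.-integrable D (fun x => (u x)%:E) ->
  mu.-integrable D (fun x => (t * u x)%:E).
Proof.
move=> mD hi; have := @integrableZl _ _ _ mu D mD t _ hi.
by apply: eq_integrable => // x _; rewrite EFinM.
Qed.

Lemma integrable_add D u v : measurable D ->
  mu.-integrable D (fun x => (u x)%:E) -> mu.-integrable D (fun x => (v x)%:E) ->
  mu.-integrable D (fun x => (u x + v x)%:E).
Proof.
move=> mD h1i h2i; have := @integrableD _ _ _ mu D mD _ _ h1i h2i.
by apply: eq_integrable => // x _; rewrite EFinD.
Qed.

Lemma Re_lin (c z t : R[i]) : complex.Re (c * z + t) =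
  complex.Re c * complex.Re z + (- complex.Im c * complex.Im z + complex.Re t).
Proof. by case: c z t => a b [? ?] [? ?] /=; ring. Qed.

Lemma Im_lin (c z t : R[i]) : complex.Im (c * z + t) =
  complex.Re c * complex.Im z + (complex.Im c * complex.Re z + complex.Im t).
Proof. by case: c z t => a b [? ?] [? ?] /=; ring. Qed.

Lemma cintegrable_lin D (c : R[i]) f g : measurable D ->
  cintegrable D f -> cintegrable D g ->
  cintegrable D (fun x => c * f x + g x).
Proof.
move=> mD [fr fi] [gr gi]; split.
  under eq_fun do rewrite Re_lin.
  by do 2 (apply: integrable_add => //; first exact: integrable_scale).
under eq_fun do rewrite Im_lin.
by do 2 (apply: integrable_add => //; first exact: integrable_scale).
Qed.

Lemma cRintegral_lin D (c : R[i]) f g : measurable D ->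
  cintegrable D f -> cintegrable D g ->
  cRintegral D (fun x => c * f x + g x) = c * cRintegral D f + cRintegral D g.
Proof.
move=> mD [fr fi] [gr gi].
apply/eqP; rewrite eq_complex Re_lin Im_lin /=; apply/andP; split; apply/eqP.
  under eq_Rintegral do rewrite Re_lin.
  rewrite !RintegralD ?RintegralZl//; try exact: integrable_scale.
  by apply: integrable_add => //; exact: integrable_scale.
under eq_Rintegral do rewrite Im_lin.
rewrite !RintegralD ?RintegralZl//; try exact: integrable_scale.
by apply: integrable_add => //; exact: integrable_scale.
Qed.

Lemma cRintegral_eq D f g : {in D, f =1 g} -> cRintegral D f = cRintegral D g.
Proof.
by move=> fg; rewrite /cRintegral; congr (_ +i* _); apply: eq_Rintegral => x xD;
  rewrite fg.
Qed.

(** From 2 |u v| <= u^2 + v^2. *)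
Lemma integrable_mul D u v : measurable D -> measurable_fun D u ->
  measurable_fun D v ->
  (\int[mu]_(x in D) ((u x) ^+ 2)%:E < +oo)%E ->
  (\int[mu]_(x in D) ((v x) ^+ 2)%:E < +oo)%E ->
  mu.-integrable D (fun x => (u x * v x)%:E).
Proof.
move=> mD mu_ mv uy vy.
have h (a : R -> R) : measurable_fun D a ->
    (\int[mu]_(x in D) ((a x) ^+ 2)%:E < +oo)%E ->
    mu.-integrable D (fun x => ((a x) ^+ 2)%:E).
  move=> ma ay; apply/integrableP; split; first exact: measurable_sqrE.
  by under eq_integral do rewrite gee0_abs ?lee_fin ?sqr_ge0//.
have huv := @integrableD _ _ _ mu D mD _ _ (h u mu_ uy) (h v mv vy).
apply: le_integrable huv => //.
- by apply/measurable_EFinP; exact: measurable_funM.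
- move=> x _ /=; rewrite lee_fin [leRHS]ger0_norm ?addr_ge0 ?sqr_ge0//.
  have := amgm_of_sqr_le ltr01 (sqr_ge0 (u x)) (sqr_ge0 (v x)).
  move=> /(_ (u x * v x)); rewrite exprMn => /(_ (lexx _)).
  rewrite invr1 !mul1r; apply: le_trans.
  by rewrite mulr_natl mulr2n lerDl.
Qed.

Definition intop k f (x : R) : R[i] := cRintegral Rp (fun y => (k x y)%:C * f y).

Lemma Re_realM (a : R) (z : R[i]) : complex.Re (a%:C * z) = a * complex.Re z.
Proof. by case: z => b c /=; ring. Qed.

Lemma Im_realM (a : R) (z : R[i]) : complex.Im (a%:C * z) = a * complex.Im z.
Proof. by case: z => b c /=; ring. Qed.

Lemma Re_intop k f x :
  complex.Re (intop k f x) = \int[mu]_(y in Rp) (k x y * complex.Re (f y)).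
Proof. by rewrite /=; apply: eq_Rintegral => y _; rewrite Re_realM. Qed.

Lemma Im_intop k f x :
  complex.Im (intop k f x) = \int[mu]_(y in Rp) (k x y * complex.Im (f y)).
Proof. by rewrite /=; apply: eq_Rintegral => y _; rewrite Im_realM. Qed.

Lemma cmeasurable_intop k f : measurable_kernel k -> cmeasurable f ->
  cmeasurable (intop k f).
Proof.
move=> mk [fr fi]; split.
  under eq_fun do rewrite Re_intop.
  apply: (measurable_row_Rintegral (k := fun x y => k x y * complex.Re (f y))).
  by apply: measurable_kernelM => //; exact: measurable_kernel2.
under eq_fun do rewrite Im_intop.
apply: (measurable_row_Rintegral (k := fun x y => k x y * complex.Im (f y))).
by apply: measurable_kernelM => //; exact: measurable_kernel2.
Qed.

Lemma intop_energy_le k w f (C : R) : measurable_kernel k ->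
  (forall x y, 0 < x -> 0 < y -> 0 <= k x y) ->
  measurable_fun Rp w -> (forall x, 0 < x -> 0 < w x) -> 0 < C ->
  (forall x, 0 < x ->
     (\int[mu]_(y in Rp) (k x y * w y)%:E <= (C * w x)%:E)%E) ->
  (forall y, 0 < y ->
     (\int[mu]_(x in Rp) (k x y * w x)%:E <= (C * w y)%:E)%E) ->
  cmeasurable f ->
  (energy (intop k f) <= (C ^+ 2)%:E * energy f)%E.
Proof.
move=> mk k0 mw w0 C0 row col mf; rewrite !energyE//; last exact: cmeasurable_intop.
rewrite ge0_muleDr ?renergy_ge0//; apply: leeD.
  under eq_fun do rewrite Re_intop.
  by apply: (schur_test mk k0 mw w0 C0 row col); case: mf.
under eq_fun do rewrite Im_intop.
by apply: (schur_test mk k0 mw w0 C0 row col); case: mf.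
Qed.

Lemma L2_Re f : L2 f -> (renergy (fun x => complex.Re (f x)) < +oo)%E.
Proof.
move=> /L2P[mf]; rewrite energyE//; apply: le_lt_trans.
by rewrite leeDl// renergy_ge0.
Qed.

Lemma L2_Im f : L2 f -> (renergy (fun x => complex.Im (f x)) < +oo)%E.
Proof.
move=> /L2P[mf]; rewrite energyE//; apply: le_lt_trans.
by rewrite leeDr// renergy_ge0.
Qed.

(** The form in which the hypothesis x phi(x) <= M is used: domination by the
    kernel 1/max(x,y) gives square integrable rows and a Schur bound at the same
    time, and it passes to the pieces into which the kernel is cut below. *)
Definition max_dominated (M : R) k :=
  measurable_kernel k /\
  forall x y, 0 < x -> 0 < y -> 0 <= k x y <= M * (Num.max x y)^-1.

Lemma max_dominated_row M k x : max_dominated M k -> 0 < x ->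
  (\int[mu]_(y in Rp) ((k x y) ^+ 2)%:E < +oo)%E.
Proof.
move=> [mk kM] x0.
have mi : measurable_fun Rp (fun y : R => ((Num.max x y)^-1 ^+ 2)%:E).
  apply/measurable_EFinP; apply: measurable_funX.
  exact: measurable_inv_max.
apply: (@le_lt_trans _ _ ((M ^+ 2)%:E * (2 / x)%:E)%E); last exact: ltry.
apply: (@le_trans _ _ ((M ^+ 2)%:E * \int[mu]_(y in Rp) ((Num.max x y)^-1 ^+ 2)%:E)%E).
  rewrite -ge0_integralZl_EFin ?sqr_ge0//; last 2 first.
  - exact: measurable_Rplus.
  - by move=> y _; rewrite lee_fin sqr_ge0.
  apply: ge0_le_integral => //.
  - exact: measurable_Rplus.
  - by move=> y _; rewrite lee_fin sqr_ge0.
  - by apply: measurable_sqrE; exact: measurable_kernel_row.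
  - by apply: measurable_funeM.
  - move=> y /RplusE y0; rewrite -EFinM lee_fin -exprMn.
    have /andP[k0 kle] := kM x y x0 y0.
    by rewrite lerXn2r ?nnegrE// (le_trans k0).
apply: lee_wpmul2l; first by rewrite lee_fin sqr_ge0.
exact: integral_inv_max_sqr.
Qed.

Lemma max_dominated_cintegrable M k f x : max_dominated M k -> L2 f -> 0 < x ->
  cintegrable Rp (fun y => (k x y)%:C * f y).
Proof.
move=> kM f2 x0; have /L2P[[fr fi] _] := f2.
have mkx : measurable_fun Rp (k x) by case: kM => mk _; exact: measurable_kernel_row.
split.
  under eq_fun do rewrite Re_realM.
  apply: integrable_mul => //; first exact: measurable_Rplus.
    exact: max_dominated_row kM x0.
  exact: L2_Re.
under eq_fun do rewrite Im_realM.
apply: integrable_mul => //; first exact: measurable_Rplus.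
  exact: max_dominated_row kM x0.
exact: L2_Im.
Qed.

Lemma intop_lin M k (c : R[i]) f g x : max_dominated M k -> L2 f -> L2 g ->
  0 < x -> intop k (fun y => c * f y + g y) x = c * intop k f x + intop k g x.
Proof.
move=> kM f2 g2 x0; rewrite /intop -cRintegral_lin.
- by apply: cRintegral_eq => y _; ring.
- exact: measurable_Rplus.
- exact: max_dominated_cintegrable kM f2 x0.
- exact: max_dominated_cintegrable kM g2 x0.
Qed.

Lemma intopB M k1 k2 f x : max_dominated M k1 -> max_dominated M k2 ->
  L2 f -> 0 < x ->
  intop (fun x y => k1 x y - k2 x y) f x = intop k1 f x - intop k2 f x.
Proof.
move=> k1M k2M f2 x0; rewrite addrC -mulN1r /intop -cRintegral_lin.
- by apply: cRintegral_eq => y _; rewrite rmorphB /=; ring.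
- exact: measurable_Rplus.
- exact: max_dominated_cintegrable k2M f2 x0.
- exact: max_dominated_cintegrable k1M f2 x0.
Qed.

Lemma intop_ae M k f g x : max_dominated M k -> L2 f -> L2 g -> L2eq f g ->
  0 < x -> intop k f x = intop k g x.
Proof.
move=> kM f2 g2 /L2eqE fg x0.
have [/measurable_int fr /measurable_int fi] := max_dominated_cintegrable kM f2 x0.
have [/measurable_int gr /measurable_int gi] := max_dominated_cintegrable kM g2 x0.
rewrite /intop /cRintegral /Rintegral; congr (_ +i* _); congr fine.
  apply: ae_eq_integral => //; first exact: measurable_Rplus.
  by move: fg; apply: filterS => y h /RplusE /h ->.
apply: ae_eq_integral => //; first exact: measurable_Rplus.
by move: fg; apply: filterS => y h /RplusE /h ->.
Qed.

Definition schur_weight (x : R) : R := x `^ (- 2^-1).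

Lemma schur_weight_gt0 x : 0 < x -> 0 < schur_weight x.
Proof. by move=> x0; rewrite powR_gt0. Qed.

Lemma measurable_schur_weight : measurable_fun Rp schur_weight.
Proof. by apply: measurable_funTS; exact: measurable_powR. Qed.

Lemma measurable_max_weight (x : R) : 0 < x ->
  measurable_fun Rp (fun y : R => ((Num.max x y)^-1 * schur_weight y)%:E).
Proof.
move=> x0; apply/measurable_EFinP; apply: measurable_funM; last first.
  exact: measurable_schur_weight.
exact: measurable_inv_max.
Qed.

Lemma schur_row (M x : R) u : 0 <= M -> 0 < x -> measurable_fun Rp u ->
  (forall y, 0 < y -> 0 <= u y <= M * (Num.max x y)^-1) ->
  (\int[mu]_(y in Rp) (u y * schur_weight y)%:E <=
   (4 * M * schur_weight x)%:E)%E.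
Proof.
move=> M0 x0 mu_ uM.
apply: (@le_trans _ _ (M%:E * \int[mu]_(y in Rp) ((Num.max x y)^-1 * schur_weight y)%:E)%E).
  rewrite -ge0_integralZl_EFin//; last 3 first.
  - exact: measurable_Rplus.
  - move=> y /RplusE y0; rewrite lee_fin mulr_ge0 ?invr_ge0 ?le_max ?(ltW x0)//.
    exact/ltW/schur_weight_gt0.
  - exact: measurable_max_weight.
  apply: ge0_le_integral => //.
  - exact: measurable_Rplus.
  - move=> y /RplusE y0; rewrite lee_fin mulr_ge0 ?(ltW (schur_weight_gt0 _))//.
    by have /andP[] := uM y y0.
  - apply/measurable_EFinP; apply: measurable_funM => //.
    exact: measurable_schur_weight.
  - by apply: measurable_funeM; exact: measurable_max_weight.
  - move=> y /RplusE y0; rewrite -EFinM lee_fin mulrA ler_wpM2r//.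
      exact/ltW/schur_weight_gt0.
    by have /andP[] := uM y y0.
rewrite (mulrC 4) -mulrA EFinM; apply: lee_wpmul2l => //.
exact: integral_inv_max_powR.
Qed.

(** Schur test with the weight x^(-1/2), for which the kernel 1/max(x,y) has
    row sums 4 x^(-1/2). *)
Lemma intop_bounded M k : 0 < M -> max_dominated M k ->
  bounded_operator (intop k).
Proof.
move=> M0 kM; have [mk kle] := kM.
have eb f : L2 f -> (energy (intop k f) <= ((4 * M) ^+ 2)%:E * energy f)%E.
  move=> /L2P[mf _]; apply: (@intop_energy_le k schur_weight) => //.
  - by move=> x y x0 y0; have /andP[] := kle x y x0 y0.
  - exact: measurable_schur_weight.
  - exact: schur_weight_gt0.
  - by rewrite mulr_gt0.
  - move=> x x0; apply: schur_row => //; first exact: ltW.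
      exact: measurable_kernel_row.
    by move=> y y0; exact: kle.
  - move=> y y0; apply: schur_row => //; first exact: ltW.
      exact: measurable_kernel_col.
    by move=> x x0; rewrite maxC; exact: kle.
split; last first.
  apply: le_lt_trans (opnorm_le _ eb) _; last exact: ltry.
  by rewrite mulr_ge0// ltW.
split.
- move=> f f2; have /L2P[mf fy] := f2; apply/L2P; split.
    exact: cmeasurable_intop.
  apply: le_lt_trans (eb f f2) _; apply: lte_mul_pinfty => //.
  by rewrite lee_fin sqr_ge0.
- move=> f g f2 g2 fg; apply/L2eqE; apply: nearW => x x0.
  exact: intop_ae kM f2 g2 fg x0.
- move=> c f g f2 g2; apply/L2eqE; apply: nearW => x x0.
  exact: intop_lin kM f2 g2 x0.
Qed.

End IntegralOperator.

(** * Cutting the kernel into blocks *)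

Section RealL2.
Variable R : realType.
Local Notation mu := (@lebesgue_measure R).
Local Notation Rp := (@Rplus R).
Implicit Types u v : R -> R.

Lemma cmeasurable_real u : measurable_fun Rp u -> cmeasurable (fun x => (u x)%:C).
Proof. by move=> mu_; split => //=; exact: measurable_cst. Qed.

Lemma energy_real u : energy (fun x => (u x)%:C) = renergy u.
Proof.
by apply: eq_integral => x _; rewrite sqr_normc /= expr0n addr0.
Qed.

Lemma L2_real u (B : R) : measurable_fun Rp u ->
  (forall x, 0 < x -> `|u x| <= B * (Num.max 1 x)^-1) ->
  L2 (fun x => (u x)%:C).
Proof.
move=> mu_ uB; apply/L2P; split; first exact: cmeasurable_real.
rewrite energy_real.
have mi : measurable_fun Rp (fun y : R => ((Num.max 1 y)^-1 ^+ 2)%:E).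
  apply/measurable_EFinP; apply: measurable_funX.
  exact: (measurable_inv_max ltr01).
apply: (@le_lt_trans _ _ ((B ^+ 2)%:E * (2 / 1)%:E)%E); last exact: ltry.
apply: (@le_trans _ _ ((B ^+ 2)%:E * \int[mu]_(y in Rp) ((Num.max 1 y)^-1 ^+ 2)%:E)%E).
  rewrite -ge0_integralZl_EFin ?sqr_ge0//; last 2 first.
  - exact: measurable_Rplus.
  - by move=> y _; rewrite lee_fin sqr_ge0.
  apply: ge0_le_integral => //.
  - exact: measurable_Rplus.
  - by move=> y _; rewrite lee_fin sqr_ge0.
  - exact: measurable_sqrE.
  - by apply: measurable_funeM.
  - move=> y /RplusE y0; rewrite -EFinM lee_fin -exprMn -real_normK ?num_real//.
    have h := uB y y0.
    by rewrite lerXn2r ?nnegrE// (le_trans _ h).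
apply: lee_wpmul2l; first by rewrite lee_fin sqr_ge0.
exact: integral_inv_max_sqr.
Qed.

(** Monotonicity is only available on the half-line, where superlevel sets are
    intervals. *)
Lemma nonincreasing_measurable_Rplus u :
  (forall x y, 0 < x -> x <= y -> u y <= u x) -> measurable_fun Rp u.
Proof.
move=> u_ni; apply: (measurability (@RGenCInfty.G R)) => [|/= _ [_] [r] -> <-].
  exact: RGenCInfty.measurableE.
apply: is_interval_measurable => s t /= [/RplusE s0 rs] [/RplusE t0 rt] x /andP[sx xt].
have x0 : 0 < x by exact: lt_le_trans sx.
split; first exact/RplusE.
move: rt; rewrite /= !in_itv /= !andbT => rt; apply: le_trans rt _.
exact: u_ni.
Qed.

End RealL2.

Section Levels.
Variable R : realType.
Local Notation mu := (@lebesgue_measure R).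
Local Notation Rp := (@Rplus R).
Variable phi : R -> R.
Hypothesis phi_ge0 : forall x, 0 < x -> 0 <= phi x.
Hypothesis phi_ni : forall x y, 0 < x -> x <= y -> phi y <= phi x.

Lemma measurable_phi : measurable_fun Rp phi.
Proof. exact: nonincreasing_measurable_Rplus. Qed.

Definition qker (x y : R) := phi (Num.max x y).

(** For a nonincreasing phi the kernel is the minimum of the values of phi, which gives
    its joint measurability. *)
Lemma qkerE x y : 0 < x -> 0 < y -> qker x y = Num.min (phi x) (phi y).
Proof.
move=> x0 y0; rewrite /qker; case: (leP x y) => xy.
  by rewrite min_r// phi_ni.
by rewrite min_l// phi_ni// ltW.
Qed.

Lemma measurable_qker : measurable_kernel qker.
Proof.
have : measurable_kernel (fun x y => Num.min (phi x) (phi y)).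
  apply: measurable_minr; [apply: measurable_kernel1|apply: measurable_kernel2];
  exact: measurable_phi.
apply: eq_measurable_fun => -[x y]; rewrite inE => -[/RplusE x0 /RplusE y0] /=.
by rewrite qkerE.
Qed.

Lemma max_gt0 (x y : R) : 0 < x -> 0 < Num.max x y.
Proof. by move=> x0; rewrite lt_max x0. Qed.

Lemma qker_dominated (M : R) : (forall x, 0 < x -> x * phi x <= M) ->
  max_dominated M qker.
Proof.
move=> xM; split; first exact: measurable_qker.
move=> x y x0 y0; have m0 := max_gt0 y x0.
by rewrite phi_ge0// ler_pdivlMr// mulrC xM.
Qed.

(** A nondecreasing integer function G cuts the half-line into finitely many
    intervals. Outside the diagonal blocks the kernel depends on one variable
    only, so it has finite rank there; in the blocks one subtracts the infimum
    of phi over the interval. *)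
Section Cut.
Variables (M : R) (G : R -> nat) (m : nat) (al be : R).
Hypothesis xM : forall x, 0 < x -> x * phi x <= M.
Hypothesis M_gt0 : 0 < M.
Hypothesis G_nd : forall x y, 0 < x -> x <= y -> (G x <= G y)%N.
Hypothesis al_gt0 : 0 < al.
Hypothesis be_gt0 : 0 < be.
Hypothesis G0 : forall x, 0 < x -> x < al -> G x = 0%N.
Hypothesis Gm : forall x, be <= x -> G x = m.

Definition level_inf (j : nat) : R :=
  inf [set phi y | y in [set y | 0 < y /\ G y = j]].

Lemma level_inf_le x : 0 < x -> level_inf (G x) <= phi x.
Proof.
move=> x0; apply: ge_inf; last by exists x.
by exists 0 => _ [y [y0 _] <-]; exact: phi_ge0.
Qed.

Lemma level_inf_ge x (r : R) : 0 < x ->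
  (forall y, 0 < y -> G y = G x -> r <= phi y) -> r <= level_inf (G x).
Proof.
move=> x0 h; apply: lb_le_inf; first by exists (phi x), x.
by move=> _ [y [y0 Gy] <-]; exact: h.
Qed.

Lemma level_inf_ge0 x : 0 < x -> 0 <= level_inf (G x).
Proof. by move=> x0; apply: level_inf_ge => // y y0 _; exact: phi_ge0. Qed.

Lemma G_lt x y : 0 < y -> (G x < G y)%N -> x < y.
Proof. by move=> y0; apply: contraTlt => yx; rewrite -leqNgt G_nd. Qed.

(** The last interval is unbounded and phi tends to 0 at infinity, so nothing is
    subtracted there. *)
Lemma level_inf_last : level_inf m = 0.
Proof.
have Gb : G be = m by exact: Gm.
apply/eqP; rewrite eq_le -{2}Gb level_inf_ge0// andbT.
apply/ler_addgt0Pr => e e0; rewrite add0r.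
(* From this point on phi(y) <= M / y is at most e. *)
pose y := Num.max be (M / e).
have y0 : 0 < y by exact: max_gt0.
have Gy : G y = m by apply: Gm; rewrite le_max lexx.
apply: (@le_trans _ _ (phi y)); first by rewrite -Gy level_inf_le.
have : y * phi y <= y * e.
  apply: le_trans (xM y0) _.
  by rewrite -ler_pdivrMr// le_max lexx orbT.
by rewrite ler_pM2l.
Qed.

Lemma level_inf_ni x y : 0 < x -> x <= y -> level_inf (G y) <= level_inf (G x).
Proof.
move=> x0 xy; have y0 : 0 < y by exact: lt_le_trans xy.
have := G_nd x0 xy; rewrite leq_eqVlt => /predU1P[-> //|Gxy].
apply: level_inf_ge => // z z0 Gz.
apply: le_trans (level_inf_le y0) _; apply: phi_ni => //.
by apply/ltW/G_lt => //; rewrite Gz.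
Qed.

Lemma measurable_G : measurable_fun Rp (fun x => (G x)%:R : R).
Proof.
rewrite (_ : (fun x => (G x)%:R) = (fun x => - (- (G x)%:R : R))); last first.
  by apply/funext => x; rewrite opprK.
apply: measurable_funN; apply: nonincreasing_measurable_Rplus => x y x0 xy.
by rewrite lerN2 ler_nat G_nd.
Qed.

Definition block_kernel (x y : R) : R :=
  if G x == G y then qker x y - level_inf (G x) else 0.

Lemma G_max x y : G x = G y -> G (Num.max x y) = G x.
Proof. by case: (leP x y) => _ ->. Qed.

Lemma block_kernel_ge0 x y : 0 < x -> 0 < y -> 0 <= block_kernel x y.
Proof.
move=> x0 y0; rewrite /block_kernel; case: eqP => // /G_max <-.
by rewrite subr_ge0 level_inf_le// max_gt0.
Qed.

Lemma block_kernel_le x y : 0 < x -> 0 < y -> block_kernel x y <= qker x y.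
Proof.
move=> x0 y0; rewrite /block_kernel; case: eqP => _.
  by rewrite lerBlDr lerDl level_inf_ge0.
by rewrite phi_ge0// max_gt0.
Qed.

Lemma block_kernelC x y : block_kernel x y = block_kernel y x.
Proof. by rewrite /block_kernel /qker maxC; case: eqVneq => // ->. Qed.

Lemma measurable_block_kernel : measurable_kernel block_kernel.
Proof.
have mi : measurable_fun Rp (fun x => level_inf (G x)).
  by apply: nonincreasing_measurable_Rplus => x y; exact: level_inf_ni.
have : measurable_kernel (fun x y => if (G x)%:R == (G y)%:R :> R
    then qker x y - level_inf (G x) else 0).
  apply: measurable_fun_if; first exact: measurable_Rplus2.
  - apply: (@measurable_fun_eqr _ _ _ _ (fun z : R * R => (G z.1)%:R)
      (fun z : R * R => (G z.2)%:R)).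
      exact: measurable_kernel1 measurable_G.
    exact: measurable_kernel2 measurable_G.
  - apply: (measurable_funS (@measurable_Rplus2 R)); first exact: subIsetl.
    apply: measurable_funB; first exact: measurable_qker.
    exact: measurable_kernel1 mi.
  - exact: measurable_cst.
by apply: eq_measurable_fun => -[x y] _ /=; rewrite eqr_nat.
Qed.

Lemma block_kernel_dominated : max_dominated M block_kernel.
Proof.
split; first exact: measurable_block_kernel.
move=> x y x0 y0; rewrite block_kernel_ge0//=.
apply: le_trans (block_kernel_le x0 y0) _.
by have [_ /(_ x y x0 y0)/andP[]] := qker_dominated xM.
Qed.

Definition off_kernel (x y : R) : R := qker x y - block_kernel x y.

Lemma off_kernel_dominated : max_dominated M off_kernel.
Proof.
split.
  by apply: measurable_funB; [exact: measurable_qker|exact: measurable_block_kernel].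
move=> x y x0 y0; rewrite subr_ge0 block_kernel_le//=.
have [_ /(_ x y x0 y0)/andP[_]] := qker_dominated xM; apply: le_trans.
by rewrite lerBlDr lerDl block_kernel_ge0.
Qed.

Lemma measurable_level_le i : measurable_fun Rp (fun x => (G x <= i)%N%:R : R).
Proof.
apply: nonincreasing_measurable_Rplus => x y x0 xy; rewrite ler_nat.
by case: (leqP (G y) i) => // /(leq_trans (G_nd x0 xy)) ->.
Qed.

Lemma measurable_level_eq i : measurable_fun Rp (fun x => (G x == i)%:R : R).
Proof.
case: i => [|i].
  by under eq_fun do rewrite -leqn0; exact: measurable_level_le.
rewrite (_ : (fun _ => _) = (fun x => (G x <= i.+1)%N%:R - (G x <= i)%N%:R)).
  by apply: measurable_funB; exact: measurable_level_le.
apply/funext => x; rewrite leq_eqVlt ltnS.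
by case: eqP => [->|_] /=; rewrite ?ltnn ?subr0// subrr.
Qed.

Lemma L2_decay (u : R -> R) : measurable_fun Rp u ->
  (forall x, 0 < x -> `|u x| <= M * x^-1) ->
  (forall x, 0 < x -> x < al -> u x = 0) -> L2 (fun x => (u x)%:C).
Proof.
move=> mu_ uM u0; apply: (L2_real (B := M * Num.max 1 al^-1)) => // x x0.
have [xal|alx] := ltP x al.
  rewrite u0// normr0 !mulr_ge0// ?(ltW M_gt0) ?le_max ?ler01//.
  by rewrite invr_ge0 le_max ler01.
apply: le_trans (uM x x0) _; rewrite -mulrA ler_pM2l//.
rewrite ler_pdivlMr ?lt_max ?ltr01// ler_pdivrMl//.
rewrite ge_max; apply/andP; split.
  apply: (@le_trans _ _ (x * al^-1)); first by rewrite ler_pdivlMr// mul1r.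
  by rewrite ler_pM2l// le_max lexx orbT.
by rewrite ler_peMr ?(ltW x0)// le_max lexx.
Qed.

Lemma L2_compact (u : R -> R) (c : R) : measurable_fun Rp u -> 0 <= c ->
  (forall x, 0 < x -> `|u x| <= c) ->
  (forall x, be <= x -> u x = 0) -> L2 (fun x => (u x)%:C).
Proof.
move=> mu_ c0 uc u0; apply: (L2_real (B := c * Num.max 1 be)) => // x x0.
have [xbe|bex] := ltP x be; last first.
  rewrite u0// normr0 !mulr_ge0// ?le_max ?ler01//.
  by rewrite invr_ge0 le_max ler01.
apply: le_trans (uc x x0) _; rewrite -mulrA ler_peMr//.
rewrite ler_pdivlMr ?lt_max ?ltr01// mul1r.
by rewrite ge_max !le_max lexx /= (ltW xbe) orbT.
Qed.

(** The two halves of the index range correspond to the part below the diagonal,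
    where the kernel is phi(x), and to the part above it, where the kernel is
    phi(y), together with the constants on the diagonal blocks. In the first half the
    index is shifted by one because G(x) > G(y) excludes G(x) = 0; in the
    second half the last interval needs no term by [level_inf_last]. *)
Definition lfactor (j : 'I_(m + m)) (x : R) : R :=
  match fintype.split j with
  | inl i => phi x * (G x == i.+1)%:R
  | inr i => (G x == i)%:R
  end.

Definition rfactor (j : 'I_(m + m)) (y : R) : R :=
  match fintype.split j with
  | inl i => (G y <= i)%N%:R
  | inr i => phi y * (i < G y)%N%:R + level_inf i * (G y == i)%:R
  end.

Lemma off_kernelE x y : 0 < x -> 0 < y ->
  off_kernel x y = \sum_(j < m + m) lfactor j x * rfactor j y.
Proof.
move=> x0 y0; rewrite big_split_ord /= /lfactor /rfactor.
under eq_bigr do rewrite (unsplitK (inl _)).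
under [X in _ = _ + X]eq_bigr do rewrite (unsplitK (inr _)).
have Gle z : 0 < z -> (G z <= m)%N.
  move=> z0; have <- : G (Num.max z be) = m by apply: Gm; rewrite le_max lexx orbT.
  by apply: G_nd => //; rewrite le_max lexx.
have -> : \sum_(i < m) phi x * (G x == i.+1)%:R * (G y <= i)%N%:R =
    phi x * (G y < G x)%N%:R.
  have := Gle x x0; case: (G x) => [|n] nm.
    by rewrite big1 => [|i _]; [rewrite ltn0 mulr0|rewrite /= mulr0 mul0r].
  rewrite (bigD1 (Ordinal nm))//= eqxx mulr1 big1 ?addr0// => i.
  by rewrite eqSS eq_sym -val_eqE /= => /negbTE ->; rewrite mulr0 mul0r.
have -> : \sum_(i < m) (G x == i)%:R * (phi y * (i < G y)%N%:R + level_inf i * (G y == i)%:R) =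
    phi y * (G x < G y)%N%:R + level_inf (G x) * (G y == G x)%:R.
  have := Gle x x0; rewrite leq_eqVlt => /predU1P[Gx|nm].
    rewrite Gx big1; last by move=> i _; rewrite gtn_eqF// mul0r.
    by rewrite level_inf_last mul0r ltnNge Gle// mulr0 addr0.
  rewrite (bigD1 (Ordinal nm))//= eqxx mul1r big1 ?addr0// => i.
  by rewrite eq_sym -val_eqE /= => /negbTE ->; rewrite mul0r.
rewrite /off_kernel /block_kernel eq_sym; case: (ltngtP (G y) (G x)) => h.
- by rewrite subr0 mulr1 !mulr0 !addr0 /qker max_l// ltW// G_lt.
- by rewrite subr0 !mulr0 mulr1 add0r addr0 /qker max_r// ltW// G_lt.
- by rewrite subKr !mulr0 !add0r mulr1.
Qed.

Lemma phi_le_inv x : 0 < x -> `|phi x| <= M * x^-1.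
Proof. by move=> x0; rewrite ger0_norm ?phi_ge0// ler_pdivlMr// mulrC xM. Qed.

Lemma mulr_bool_le (a : R) (b : bool) : `|a * b%:R| <= `|a|.
Proof. by case: b; rewrite ?mulr1// mulr0 normr0. Qed.

(** Each factor either is bounded and vanishes from be on, or is phi cut off below al,
    where phi(x) <= M / x is square integrable. *)
Lemma lfactor_L2 j : L2 (fun x => (lfactor j x)%:C).
Proof.
rewrite /lfactor; case: (fintype.split j) => i.
  apply: L2_decay.
  - apply: measurable_funM; [exact: measurable_phi|exact: measurable_level_eq].
  - move=> x x0; apply: le_trans (phi_le_inv x0); exact: mulr_bool_le.
  - by move=> x x0 /(G0 x0) ->; rewrite mulr0.
apply: (L2_compact (c := 1)) => //.
- exact: measurable_level_eq.
- by move=> x x0; rewrite -[X in `|X|]mul1r (le_trans (mulr_bool_le _ _))// normr1.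
- by move=> x /Gm ->; rewrite gtn_eqF.
Qed.

Lemma rfactor_L2 j : L2 (fun x => (rfactor j x)%:C).
Proof.
rewrite /rfactor; case: (fintype.split j) => i.
  apply: (L2_compact (c := 1)) => //.
  - exact: measurable_level_le.
  - by move=> x x0; rewrite -[X in `|X|]mul1r (le_trans (mulr_bool_le _ _))// normr1.
  - by move=> x /Gm ->; rewrite leqNgt ltn_ord.
under eq_fun do rewrite rmorphD /=.
apply: L2D.
  apply: L2_decay.
  - apply: measurable_funM; first exact: measurable_phi.
    rewrite (_ : (fun _ => _) = (fun x => 1 - (G x <= i)%N%:R)).
      by apply: measurable_funB => //; exact: measurable_level_le.
    by apply/funext => x; case: ltnP => _; rewrite ?subr0 ?subrr.
  - move=> x x0; apply: le_trans (phi_le_inv x0); exact: mulr_bool_le.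
  - by move=> x x0 /(G0 x0) ->; rewrite ltn0 mulr0.
apply: (L2_compact (c := `|level_inf i|)) => //.
- by apply: measurable_funM => //; exact: measurable_level_eq.
- by move=> x x0; exact: mulr_bool_le.
- by move=> x /Gm ->; rewrite gtn_eqF// mulr0.
Qed.

(** There are two ways in which an interval of the partition can be harmless. Either
    x phi(x) is small on it, and the block is dominated by a small multiple of
    1/max(x,y); or it is short and phi oscillates little on it, and then the
    integral is at most length times oscillation times the weight, which is
    nearly constant on the interval. *)
Lemma block_kernel_row (lam x : R) : 0 < lam -> 0 < x ->
  (forall y, 0 < y -> G y = G x -> y * phi y <= 2 * lam) \/
  (exists c del h : R, [/\ 0 < c, x <= 4 * c, 0 < h, 0 < del & h * del <= lam] /\
    forall y, 0 < y -> G y = G x ->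
      [/\ c <= y, `|x - y| <= del & forall z, 0 < z -> G z = G x -> `|phi y - phi z| <= h]) ->
  (\int[mu]_(y in Rp) (block_kernel x y * schur_weight y)%:E <=
     (8 * lam * schur_weight x)%:E)%E.
Proof.
move=> lam0 x0.
have mrow : measurable_fun Rp (block_kernel x).
  by apply: measurable_kernel_row => //; exact: measurable_block_kernel.
case=> [small|[c [del [h [[c0 xc h0 del0 hdel] short]]]]].
  rewrite (_ : 8 * lam = 4 * (2 * lam)); last by ring.
  apply: schur_row => //; first by rewrite mulr_ge0// ltW.
  move=> y y0; rewrite block_kernel_ge0//=.
  have [Gxy|Gxy] := eqVneq (G x) (G y); last first.
    rewrite /block_kernel (negbTE Gxy) mulr_ge0 ?mulr_ge0 ?(ltW lam0)//.
    by rewrite invr_ge0 ltW// max_gt0.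
  apply: le_trans (block_kernel_le x0 y0) _.
  rewrite ler_pdivlMr ?max_gt0// mulrC; apply: small; first exact: max_gt0.
  exact: G_max.
have c4 : schur_weight c <= 2 * schur_weight x.
  have A0 : 0 < c `^ 2^-1 by exact: powR_gt0.
  have B0 : 0 < x `^ 2^-1 by exact: powR_gt0.
  have AB : x `^ 2^-1 <= 2 * c `^ 2^-1.
    rewrite [X in X * _](_ : 2 = 4 `^ 2^-1); last first.
      rewrite powR12_sqrt// (_ : 4 = 2 ^+ 2); last by ring.
      by rewrite sqrtr_sqr ger0_norm.
    rewrite -powRM ?(ltW c0)//.
    by apply: ge0_ler_powR; rewrite ?nnegrE ?(ltW x0) ?mulr_ge0 ?(ltW c0).
  rewrite /schur_weight !powRN -[X in X <= _]mul1r ler_pdivrMr// mulrAC.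
  by rewrite ler_pdivlMr// mul1r.
pose J := `[x - del, x + del]%classic.
have mJ : measurable (J : set R) by exact: measurable_itv.
apply: (@le_trans _ _ (\int[mu]_(y in J) (h * schur_weight c)%:E)%E).
  rewrite [leRHS](_ : _ = \int[mu]_(y in setT) ((fun=> (h * schur_weight c)%:E) \_ J) y)%E; last first.
    by rewrite integral_mkcond.
  rewrite integral_mkcond; apply: ge0_le_integral => //.
  - move=> y _; rewrite patchE; case: ifPn => //; rewrite inE => /RplusE y0.
    by rewrite lee_fin mulr_ge0 ?block_kernel_ge0// ltW// schur_weight_gt0.
  - apply/(measurable_restrictT _ (@measurable_Rplus R)).
    apply/measurable_EFinP; apply: measurable_funM => //.
    exact: measurable_schur_weight.
  - by apply/(measurable_restrictT _ mJ); exact: measurable_cst.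
  - move=> y _; rewrite !patchE; case: ifPn; last first.
      move=> _; case: ifPn => // _; rewrite lee_fin mulr_ge0 ?(ltW h0)//.
      exact/ltW/schur_weight_gt0.
    rewrite inE => /RplusE y0; have [Gxy|Gxy] := eqVneq (G x) (G y); last first.
      rewrite {1}/block_kernel (negbTE Gxy) mul0r.
      case: ifPn => // _; rewrite lee_fin mulr_ge0 ?(ltW h0)//.
      exact/ltW/schur_weight_gt0.
    have [cy xy osc] := short y y0 (esym Gxy).
    rewrite mem_set; last first.
      by rewrite /J /= in_itv /=; move: xy; rewrite ler_distlC.
    rewrite lee_fin; apply: ler_pM.
    + exact: block_kernel_ge0.
    + exact/ltW/schur_weight_gt0.
    + rewrite /block_kernel Gxy eqxx lerBlDl -lerBlDr -Gxy; apply: level_inf_ge => // z z0 Gz.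
      have mx : G (Num.max x y) = G x by exact: G_max.
      have m0 : 0 < Num.max x y by exact: max_gt0.
      have [_ _ /(_ z z0 Gz)] := short _ m0 mx.
      by rewrite ler_norml => /andP[_]; rewrite lerBlDl -lerBlDr.
    + rewrite /schur_weight !powRN lef_pV2 ?posrE ?powR_gt0//.
      by apply: ge0_ler_powR; rewrite ?nnegrE ?(ltW c0) ?(ltW y0).
rewrite integral_cst//= lebesgue_measure_itv /= lte_fin.
rewrite ltrD2l gtrN// -EFinB -EFinM lee_fin.
rewrite (_ : x + del - (x - del) = 2 * del); last by ring.
have := schur_weight_gt0 c0; have := schur_weight_gt0 x0.
set wx := schur_weight x in c4 *; set wc := schur_weight c in c4 * => wx0 wc0.
have : h * del * wc <= lam * (2 * wx).
  by apply: ler_pM => //; [rewrite mulr_ge0// ltW|exact: ltW].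
have : 0 <= lam * wx by rewrite mulr_ge0// ltW.
by nra.
Qed.

End Cut.
End Levels.

(** * Subdividing a dyadic interval *)

Section Cells.
Variable R : realType.
Local Notation mu := (@lebesgue_measure R).
Local Notation Rp := (@Rplus R).
Variable phi : R -> R.
Hypothesis phi_ge0 : forall x, 0 < x -> 0 <= phi x.
Hypothesis phi_ni : forall x y, 0 < x -> x <= y -> phi y <= phi x.

Definition clip (c x : R) := Num.min (Num.max x c) (2 * c).

Lemma clip_bounds c x : 0 < c -> c <= clip c x <= 2 * c.
Proof.
move=> c0; rewrite /clip le_min ge_min lexx orbT andbT le_max lexx orbT /=.
by rewrite ler_peMl ?(ltW c0)// ler1n.
Qed.

Lemma clip_id c x : c <= x -> x <= 2 * c -> clip c x = x.
Proof. by move=> cx xc; rewrite /clip max_l// min_l. Qed.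

Lemma clip_small c x : 0 < c -> x <= c -> clip c x = c.
Proof.
by move=> c0 xc; rewrite /clip max_r// min_l// ler_peMl ?(ltW c0)// ler1n.
Qed.

Lemma clip_big c x : 0 < c -> 2 * c <= x -> clip c x = 2 * c.
Proof. by move=> c0 xc; rewrite /clip min_r// le_max xc. Qed.

Lemma clip_nd c x y : x <= y -> clip c x <= clip c y.
Proof.
move=> xy; rewrite /clip le_min !ge_min lexx orbT andbT.
by rewrite ge_max !le_max xy lexx orbT.
Qed.

(** A function on [c, 2c] that grows with the point and with the decrease of phi:
    cutting its range, contained in [0, 2], into equal parts yields intervals on which
    both vary little. *)
Definition ramp (c x : R) :=
  (clip c x - c) / c + (phi c - phi (clip c x)) / phi c.

(** The two indicators separate the points outside [c, 2c[ from those inside, so that a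
    level set of this function never crosses c or 2c. *)
Definition cell (c : R) (kap : nat) (x : R) : nat :=
  ((c <= x)%R + (2 * c <= x)%R + Num.truncn (kap%:R * ramp c x))%N.

Section OneCell.
Variables (c : R) (kap : nat).
Hypothesis c0 : 0 < c.
Hypothesis phic : 0 < phi c.
Hypothesis kap0 : (0 < kap)%N.

Lemma ramp_parts x y : x <= y ->
  (clip c x - c) / c <= (clip c y - c) / c /\
  (phi c - phi (clip c x)) / phi c <= (phi c - phi (clip c y)) / phi c.
Proof.
move=> xy; have h := clip_nd c xy; split.
  by rewrite ler_pM2r ?invr_gt0// lerD2r.
rewrite ler_pM2r ?invr_gt0// lerD2l lerN2; apply: phi_ni => //.
by apply: lt_le_trans c0 _; have /andP[] := clip_bounds x c0.
Qed.

Lemma ramp_nd x y : x <= y -> ramp c x <= ramp c y.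
Proof. by move=> /ramp_parts[h1 h2]; exact: lerD. Qed.

Lemma trunc_ramp_nd x y : x <= y ->
  (Num.truncn (kap%:R * ramp c x) <= Num.truncn (kap%:R * ramp c y))%N.
Proof. by move=> xy; apply: le_truncn; rewrite ler_pM2l ?ltr0n// ramp_nd. Qed.

Lemma cell_nd x y : x <= y -> (cell c kap x <= cell c kap y)%N.
Proof.
move=> xy; apply: leq_add; last exact: trunc_ramp_nd.
apply: leq_add.
  by case: (leP c x) => // /le_trans/(_ xy) ->.
by case: (leP (2 * c) x) => // /le_trans/(_ xy) ->.
Qed.

Lemma cell_small x : x < c -> cell c kap x = 0%N.
Proof.
move=> xc; rewrite /cell /ramp clip_small ?(ltW xc)// !subrr !mul0r addr0 mulr0.
rewrite truncn0 leNgt xc /= leNgt.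
by rewrite (lt_le_trans xc)// ler_peMl ?(ltW c0)// ler1n.
Qed.

Lemma cell_big x : 2 * c <= x -> cell c kap x = cell c kap (2 * c).
Proof.
move=> xc; have c2 : c <= 2 * c by rewrite ler_peMl ?(ltW c0)// ler1n.
by rewrite /cell /ramp !clip_big// xc lexx c2 (le_trans c2 xc).
Qed.

Lemma cell_top : (cell c kap (2 * c) <= 2 * kap + 2)%N.
Proof.
rewrite /cell addnC; apply: leq_add; last by do 2 case: (_ <= _).
have c20 : 0 < 2 * c by rewrite mulr_gt0.
rewrite truncn_le_nat -(natr1 (2 * kap)%N) natrM; apply: (@le_lt_trans _ _ (2 * kap%:R)).
  rewrite [leLHS]mulrC ler_pM2r ?ltr0n// /ramp clip_big//.
  rewrite (_ : (2 * c - c) / c = 1); last by field; rewrite gt_eqF.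
  rewrite (_ : 2 = 1 + 1)// lerD2l ler_pdivrMr// mul1r.
  by rewrite lerBlDr lerDl phi_ge0.
by rewrite ltrDl.
Qed.

Lemma ramp_ge0 x : 0 <= ramp c x.
Proof.
have /andP[h _] := clip_bounds x c0.
rewrite addr_ge0// mulr_ge0 ?invr_ge0 ?(ltW c0) ?(ltW phic) ?subr_ge0//.
exact: phi_ni.
Qed.

(** Both summands of the ramp are nondecreasing, so if their sum grows by at most
    1 / kap between two points then so does each of them. *)
Lemma cell_same_le x y : x <= y -> cell c kap x = cell c kap y ->
  (c <= x < 2 * c)%R || (c <= y < 2 * c)%R ->
  [/\ c <= x < 2 * c, c <= y < 2 * c, y - x <= c / kap%:R &
      phi x - phi y <= phi c / kap%:R].
Proof.
move=> xy; rewrite /cell.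
have h1 : ((c <= x)%R <= (c <= y)%R)%N.
  by case: (leP c x) => // /le_trans/(_ xy) ->.
have h2 : ((2 * c <= x)%R <= (2 * c <= y)%R)%N.
  by case: (leP (2 * c) x) => // /le_trans/(_ xy) ->.
have h3 := trunc_ramp_nd xy.
move=> e.
have e3 : Num.truncn (kap%:R * ramp c x) = Num.truncn (kap%:R * ramp c y) by lia.
have natb (b1 b2 : bool) : (b1 = b2 :> nat) -> b1 = b2 by case: b1; case: b2.
have e1 : (c <= x) = (c <= y) by apply: natb; lia.
have e2 : (2 * c <= x) = (2 * c <= y) by apply: natb; lia.
rewrite !ltNge e1 e2 orbb => /andP[cy yc].
have cx : c <= x by rewrite e1.
have xc : x <= 2 * c by move: yc; rewrite -e2 -ltNge => /ltW.
have yc' : y <= 2 * c by move: yc; rewrite -ltNge => /ltW.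
have kr0 : 0 < kap%:R :> R by rewrite ltr0n.
have /truncn_itv/andP[_ Y1] : 0 <= kap%:R * ramp c y.
  by rewrite mulr_ge0 ?ramp_ge0// ltW.
have /truncn_itv/andP[X1 _] : 0 <= kap%:R * ramp c x.
  by rewrite mulr_ge0 ?ramp_ge0// ltW.
have : kap%:R * ramp c y - kap%:R * ramp c x <= 1.
  by rewrite lerBlDl; apply: le_trans (ltW Y1) _; rewrite -e3 -natr1 lerD2r.
rewrite /ramp !clip_id//.
rewrite (_ : _ - _ = (y - x) * kap%:R / c + (phi x - phi y) * kap%:R / phi c); last first.
  by field; rewrite !gt_eqF.
have p1 : 0 <= (y - x) * kap%:R / c.
  by rewrite !mulr_ge0 ?invr_ge0 ?(ltW c0) ?(ltW kr0)// subr_ge0.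
have p2 : 0 <= (phi x - phi y) * kap%:R / phi c.
  rewrite !mulr_ge0 ?invr_ge0 ?(ltW phic) ?(ltW kr0)// subr_ge0 phi_ni//.
  exact: lt_le_trans cx.
move=> h; rewrite cy yc; split => //.
- by rewrite ler_pdivlMr// -[leRHS]mul1r -ler_pdivrMr//; lra.
- by rewrite ler_pdivlMr// -[leRHS]mul1r -ler_pdivrMr//; lra.
Qed.

Lemma cell_same x y : cell c kap x = cell c kap y -> c <= x < 2 * c ->
  [/\ c <= y < 2 * c, `|x - y| <= c / kap%:R &
      `|phi x - phi y| <= phi c / kap%:R].
Proof.
move=> e cx; have [xy|/ltW yx] := leP x y.
  have := cell_same_le xy e; rewrite cx => /(_ isT)[_ cy dxy dphi].
  split => //; first by rewrite ler0_norm ?subr_le0// opprB.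
  rewrite ger0_norm// subr_ge0 phi_ni//.
  by case/andP: cx => cx _; exact: lt_le_trans cx.
have := cell_same_le yx (esym e); rewrite cx orbT => /(_ isT)[cy _ dxy dphi].
split => //; first by rewrite ger0_norm// subr_ge0.
rewrite ler0_norm ?opprB// subr_le0 phi_ni//.
by case/andP: cy => cy _; exact: lt_le_trans cy.
Qed.

End OneCell.

Lemma dyadic_floor (x : R) : 0 < x -> exists n : int, 2 ^ n <= x < 2 * 2 ^ n.
Proof.
move=> x0; pose y := ln x / ln 2.
have l2 : 0 < ln (2 : R) by rewrite ln_gt0// ltr1n.
have xE : 2 `^ y = x.
  by rewrite /powR pnatr_eq0 /= /y divfK ?gt_eqF// lnK.
exists (Num.floor y); rewrite -!powR_intmul//.
have -> : 2 * 2 `^ (Num.floor y)%:~R = 2 `^ ((Num.floor y)%:~R + 1) :> R.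
  by rewrite powRD ?pnatr_eq0 ?implybT// powRr1// mulrC.
have fle : (Num.floor y)%:~R <= y by exact: floor_le.
have flt : y < (Num.floor y)%:~R + 1.
  by have /andP[_] := floor_itv y; rewrite intrD.
rewrite -xE; apply/andP; split; first by apply: ler_powR => //; rewrite ler1n.
by rewrite /powR pnatr_eq0 /= ltr_expR ltr_pM2r.
Qed.

End Cells.

(** * Approximation by finite-rank operators *)

Section Functionals.
Variable R : realType.
Local Notation mu := (@lebesgue_measure R).
Local Notation Rp := (@Rplus R).

Lemma linear_L2 (T : (R -> R[i]) -> R -> R[i]) (f : R -> R[i]) :
  bounded_operator T -> L2 f -> L2 (T f).
Proof. by move=> [[T1 _ _] _]; exact: T1. Qed.

Lemma L2_mul_cintegrable (u : R -> R) (f : R -> R[i]) :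
  L2 (fun x => (u x)%:C) -> L2 f -> cintegrable Rp (fun y => (u y)%:C * f y).
Proof.
move=> u2 f2; have /L2P[[fr fi] _] := f2.
have mu_ : measurable_fun Rp u by case/L2P : u2 => -[].
have uy := L2_Re u2.
split.
  under eq_fun do rewrite Re_realM.
  apply: integrable_mul => //; first exact: measurable_Rplus.
  exact: L2_Re.
under eq_fun do rewrite Im_realM.
apply: integrable_mul => //; first exact: measurable_Rplus.
exact: L2_Im.
Qed.

Lemma cintegrable_sum (D : set R) n (c : 'I_n -> R[i]) (F : 'I_n -> R -> R[i]) :
  measurable D -> (forall j, cintegrable D (F j)) ->
  cintegrable D (fun x => \sum_(j < n) c j * F j x).
Proof.
move=> mD; elim: n c F => [|n IH] c F iF.
  under eq_fun do rewrite big_ord0.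
  by split; exact: integrable0.
under eq_fun do rewrite big_ord_recl.
by apply: cintegrable_lin => //; exact: IH.
Qed.

Lemma cRintegral_sum (D : set R) n (c : 'I_n -> R[i]) (F : 'I_n -> R -> R[i]) :
  measurable D -> (forall j, cintegrable D (F j)) ->
  cRintegral D (fun x => \sum_(j < n) c j * F j x) =
  \sum_(j < n) c j * cRintegral D (F j).
Proof.
move=> mD; elim: n c F => [|n IH] c F iF.
  rewrite big_ord0; under cRintegral_eq do rewrite big_ord0.
  by rewrite /cRintegral /Rintegral !integral0.
rewrite big_ord_recl -IH// -cRintegral_lin//; last exact: cintegrable_sum.
by apply: cRintegral_eq => x _; rewrite big_ord_recl.
Qed.

End Functionals.

Section Approximation.
Variable R : realType.
Local Notation mu := (@lebesgue_measure R).
Local Notation Rp := (@Rplus R).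
Variable phi : R -> R.
Hypothesis phi_ge0 : forall x, 0 < x -> 0 <= phi x.
Hypothesis phi_ni : forall x y, 0 < x -> x <= y -> phi y <= phi x.

(** All parts of the theorem are read off this sequence: up to factors of 2 it
    samples x phi(x) on dyadic intervals. *)
Definition dyadic_val (n : int) : R := 2 ^ n * phi (2 ^ n).

Lemma dyadic_gt0 (n : int) : 0 < (2 : R) ^ n.
Proof. by rewrite exprz_gt0. Qed.

Lemma dyadic_val_ge0 n : 0 <= dyadic_val n.
Proof. by rewrite mulr_ge0 ?phi_ge0 ?(ltW (dyadic_gt0 _))// dyadic_gt0. Qed.

(** Equality of sums of termwise ordered sequences forces termwise equality; it
    transfers membership in one level set of [grid] to each of the functions [cell]
    it is made of. *)
Lemma eq_sum_le (I : eqType) (s : seq I) (F H : I -> nat) :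
  (forall i, i \in s -> (F i <= H i)%N) ->
  (\sum_(i <- s) F i = \sum_(i <- s) H i)%N -> forall i, i \in s -> F i = H i.
Proof.
elim: s => [//|j s IH] FH; rewrite !big_cons => e i.
have h1 : (F j <= H j)%N by apply: FH; rewrite mem_head.
have FHs k : k \in s -> (F k <= H k)%N.
  by move=> ks; apply: FH; rewrite in_cons ks orbT.
have h2 : (\sum_(k <- s) F k <= \sum_(k <- s) H k)%N.
  by rewrite big_seq [leqRHS]big_seq; exact: leq_sum.
rewrite in_cons => /predU1P[->|]; first by lia.
by apply: IH => //; lia.
Qed.

Lemma seq_lower_bound (s : seq int) :
  exists2 a : R, 0 < a & forall n, n \in s -> a <= 2 ^ n.
Proof.
elim: s => [|n s [a a0 ha]]; first by exists 1.
exists (Num.min a (2 ^ n)); first by rewrite lt_min a0 dyadic_gt0.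
move=> k; rewrite in_cons => /predU1P[->|/ha ak]; rewrite ge_min ?lexx ?orbT//.
by rewrite ak.
Qed.

Lemma seq_upper_bound (s : seq int) :
  exists2 b : R, 0 < b & forall n, n \in s -> 2 * 2 ^ n <= b.
Proof.
elim: s => [|n s [a a0 ha]]; first by exists 1.
exists (Num.max a (2 * 2 ^ n)); first by rewrite lt_max a0.
move=> k; rewrite in_cons => /predU1P[->|/ha ak]; rewrite le_max ?lexx ?orbT//.
by rewrite ak.
Qed.

Section Grid.
Variables (lam : R) (s : seq int).
Hypothesis lam0 : 0 < lam.
Hypothesis s_big : forall n, n \in s -> lam <= dyadic_val n.
Hypothesis s_small : forall n, n \notin s -> dyadic_val n < lam.

(** The dyadic interval is cut into m parts with m^2 of the order of
    dyadic_val n / lam: length times oscillation on a part is dyadic_val n / m^2,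
    and this has to be at most lam. *)
Definition parts (n : int) : nat := (Num.truncn (Num.sqrt (dyadic_val n / lam))).+1.

Definition grid (x : R) : nat := \sum_(n <- s) cell phi (2 ^ n) (parts n) x.

Definition grid_top : nat := \sum_(n <- s) cell phi (2 ^ n) (parts n) (2 * 2 ^ n).

Lemma phi_dyadic_gt0 n : n \in s -> 0 < phi (2 ^ n).
Proof.
by move=> /s_big /(lt_le_trans lam0); rewrite pmulr_rgt0 ?dyadic_gt0.
Qed.

Lemma grid_nd x y : 0 < x -> x <= y -> (grid x <= grid y)%N.
Proof.
move=> x0 xy; rewrite /grid big_seq [leqRHS]big_seq; apply: leq_sum => n ns.
by apply: cell_nd => //; [exact: dyadic_gt0|exact: phi_dyadic_gt0].
Qed.

Lemma grid_cell x y n : grid x = grid y -> n \in s ->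
  cell phi (2 ^ n) (parts n) x = cell phi (2 ^ n) (parts n) y.
Proof.
wlog xy : x y / x <= y => [th|].
  by have [/th//|/ltW/th h e ns] := leP x y; apply/esym/h.
move=> e; apply: eq_sum_le e n => n ns.
by apply: cell_nd => //; [exact: dyadic_gt0|exact: phi_dyadic_gt0].
Qed.

Lemma grid_same x y n : grid y = grid x -> n \in s -> 2 ^ n <= x < 2 * 2 ^ n ->
  [/\ 2 ^ n <= y < 2 * 2 ^ n, `|x - y| <= 2 ^ n / (parts n)%:R &
      `|phi x - phi y| <= phi (2 ^ n) / (parts n)%:R].
Proof.
move=> e ns xn; apply: cell_same => //; first exact: dyadic_gt0.
- exact: phi_dyadic_gt0.
- exact/esym/grid_cell.
Qed.

Lemma parts_sqr n : dyadic_val n / (parts n)%:R ^+ 2 <= lam.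
Proof.
rewrite ler_pdivrMr ?exprn_gt0 ?ltr0n// mulrC -ler_pdivrMr//.
rewrite -[leLHS]sqr_sqrtr; last by rewrite divr_ge0 ?(ltW lam0)// dyadic_val_ge0.
rewrite lerXn2r ?nnegrE ?sqrtr_ge0//.
by apply/ltW/truncnS_gt.
Qed.

Lemma grid_top_le :
  grid_top%:R <= \sum_(n <- s) 6 * Num.sqrt (dyadic_val n / lam).
Proof.
rewrite /grid_top natr_sum big_seq [leRHS]big_seq; apply: ler_sum => n ns.
have h : (cell phi (2 ^ n) (parts n) (2 * 2 ^ n) <= 2 * parts n + 2)%N.
  by apply: cell_top => //; [exact: dyadic_gt0|exact: phi_dyadic_gt0].
set t := Num.sqrt _.
have t1 : 1 <= t.
  rewrite /t -[leLHS]sqrtr1 ler_wsqrtr// ler_pdivlMr// mul1r; exact: s_big.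
apply: (@le_trans _ _ (2 * parts n + 2)%:R); first by rewrite ler_nat h.
have : (Num.truncn t)%:R <= t by rewrite truncn_le (le_trans _ t1).
rewrite /parts -/t natrD natrM -natr1; lra.
Qed.

(** The alternative of [block_kernel_row]: the points of the large dyadic intervals lie
    in short cells, and elsewhere x phi(x) is at most 2 dyadic_val n < 2 lam. *)
Lemma grid_row_hyp x : 0 < x ->
  (forall y, 0 < y -> grid y = grid x -> y * phi y <= 2 * lam) \/
  (exists c del h : R, [/\ 0 < c, x <= 4 * c, 0 < h, 0 < del & h * del <= lam] /\
    forall y, 0 < y -> grid y = grid x ->
      [/\ c <= y, `|x - y| <= del &
          forall z, 0 < z -> grid z = grid x -> `|phi y - phi z| <= h]).
Proof.
move=> x0.
have [/hasP[n ns xn]|/hasPn xs] := boolP (has (fun n : int => 2 ^ n <= x < 2 * 2 ^ n) s).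
  right; exists (2 ^ n), (2 ^ n / (parts n)%:R), (phi (2 ^ n) / (parts n)%:R).
  have pn0 : 0 < (parts n)%:R :> R by rewrite ltr0n.
  split.
    split.
    - exact: dyadic_gt0.
    - have := dyadic_gt0 n; case/andP: xn => _; lra.
    - by rewrite divr_gt0// phi_dyadic_gt0.
    - by rewrite divr_gt0// dyadic_gt0.
    - apply: le_trans (parts_sqr n); rewrite /dyadic_val le_eqVlt; apply/orP; left; apply/eqP.
      by field; rewrite gt_eqF.
  move=> y y0 yx; have [yn dxy _] := grid_same yx ns xn.
  split => //; first by case/andP: yn.
  move=> z z0 zx; have zy : grid z = grid y by rewrite zx.
  by have [] := grid_same zy ns yn.
left => y y0 yx; have [n yn] := dyadic_floor y0.
have ns : n \notin s.
  apply/negP => ns; have [xn _ _] := grid_same (esym yx) ns yn.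
  by move: (xs n ns); rewrite xn.
have := s_small ns; case/andP: yn => yn1 yn2; rewrite /dyadic_val => an.
have : phi y <= phi (2 ^ n) by apply: phi_ni => //; exact: dyadic_gt0.
have := phi_ge0 y0; have := phi_ge0 (dyadic_gt0 n).
nra.
Qed.

End Grid.

(** The quantitative core of both compactness and the upper bounds for singular
    numbers: an error of order lam costs a rank of order sqrt(a n / lam) for each
    dyadic interval with a n >= lam, and nothing for the others. *)
Lemma finite_rank_approximation (M lam : R) (s : seq int) :
  0 < M -> (forall x, 0 < x -> x * phi x <= M) -> 0 < lam ->
  (forall n, n \in s -> lam <= dyadic_val n) ->
  (forall n, n \notin s -> dyadic_val n < lam) ->
  exists (m : nat) (S : (R -> R[i]) -> R -> R[i]) (g psi : 'I_(m + m) -> R -> R),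
    [/\ m%:R <= \sum_(n <- s) 6 * Num.sqrt (dyadic_val n / lam),
        bounded_operator S,
        forall f, L2 f -> (energy (fun x => (intop (qker phi) f x - S f x)%R) <=
           ((8 * lam) ^+ 2)%:E * energy f)%E,
        forall j, L2 (fun x => (g j x)%:C) /\ L2 (fun x => (psi j x)%:C) &
        forall f x, L2 f -> 0 < x ->
          S f x = \sum_j cRintegral Rp (fun y => (psi j y)%:C * f y) * (g j x)%:C].
Proof.
move=> M0 xM lam0 s_big s_small.
have [al al0 hal] := seq_lower_bound s.
have [be be0 hbe] := seq_upper_bound s.
pose G := grid lam s; pose m := grid_top lam s.
have G_nd x y : 0 < x -> x <= y -> (G x <= G y)%N by exact: grid_nd lam0 s_big _ _.
have G0 x : 0 < x -> x < al -> G x = 0%N.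
  move=> x0 xal; rewrite /G /grid big_seq big1// => n ns.
  by apply: cell_small; [exact: dyadic_gt0|apply: lt_le_trans xal (hal n ns)].
have Gm x : be <= x -> G x = m.
  move=> bex; rewrite /G /grid /m /grid_top big_seq [RHS]big_seq.
  apply: eq_bigr => n ns; apply: cell_big; first exact: dyadic_gt0.
  exact: le_trans (hbe n ns) bex.
have bM := block_kernel_dominated phi_ge0 phi_ni xM G_nd.
have oM := off_kernel_dominated phi_ge0 phi_ni xM G_nd.
have qM := qker_dominated phi_ge0 phi_ni xM.
exists m, (intop (off_kernel phi G)),
  (fun j => lfactor phi G j), (fun j => rfactor phi G j).
split.
- exact: grid_top_le.
- exact: intop_bounded M0 oM.
- move=> f f2; have /L2P[mf _] := f2.
  have -> : energy (fun x => intop (qker phi) f x - intop (off_kernel phi G) f x) =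
            energy (intop (block_kernel phi G) f).
    apply: L2eq_energy.
    + have := L2B (linear_L2 (intop_bounded M0 qM) f2) (linear_L2 (intop_bounded M0 oM) f2).
      by case/L2P.
    + by apply: cmeasurable_intop => //; case: bM.
    + apply/L2eqE; apply: nearW => x x0.
      by rewrite (intopB qM bM f2 x0) subKr.
  have row x : 0 < x ->
      (\int[mu]_(y in Rp) (block_kernel phi G x y * schur_weight y)%:E <=
        (8 * lam * schur_weight x)%:E)%E.
    move=> x0; apply: (block_kernel_row phi_ge0 phi_ni G_nd) => //.
    exact: grid_row_hyp.
  apply: (@intop_energy_le _ _ (@schur_weight R)) => //.
  + by case: bM.
  + by move=> x y x0 y0; case: bM => _ /(_ x y x0 y0)/andP[].
  + exact: measurable_schur_weight.
  + exact: schur_weight_gt0.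
  + by rewrite mulr_gt0.
  + move=> y y0; under eq_integral do rewrite block_kernelC.
    exact: row.
- move=> j; split; first exact: (lfactor_L2 phi_ge0 phi_ni xM M0 G_nd al0 G0 Gm).
  exact: (rfactor_L2 phi_ge0 phi_ni xM M0 G_nd al0 G0 Gm).
- move=> f x f2 x0; rewrite /intop.
  transitivity (cRintegral Rp (fun y => \sum_(j < m + m)
      (lfactor phi G j x)%:C * ((rfactor phi G j y)%:C * f y))).
    apply: cRintegral_eq => y; rewrite inE => /RplusE y0.
    rewrite (off_kernelE phi_ge0 xM G_nd be0 Gm x0 y0) rmorph_sum mulr_suml.
    by apply: eq_bigr => j _; rewrite rmorphM mulrA.
  rewrite cRintegral_sum; first by apply: eq_bigr => j _; rewrite mulrC.
    exact: measurable_Rplus.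
  move=> j; apply: L2_mul_cintegrable => //.
  exact: (rfactor_L2 phi_ge0 phi_ni xM M0 G_nd al0 G0 Gm).
Qed.

End Approximation.

(** * Completeness of L2 *)

Section Completeness.
Variable R : realType.
Local Notation mu := (@lebesgue_measure R).
Local Notation Rp := (@Rplus R).

Lemma limn_einf_le_bound (u : nat -> \bar R) (C : \bar R) :
  (forall n, (u n <= C)%E) -> (limn_einf u <= C)%E.
Proof.
move=> uC; rewrite limn_einf_lim; apply: lime_le; first exact: is_cvg_einfs.
apply: nearW => n; apply: le_trans (uC n).
by apply: ereal_inf_lbound; exists n => //=.
Qed.

Lemma half_geometric_sum_le (n : nat) :
  \sum_(0 <= j < n) (2^-1 : R) ^+ j <= 2.
Proof.
suff : \sum_(0 <= j < n) (2^-1 : R) ^+ j = 2 - 2 * 2^-1 ^+ n.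
  by move=> ->; rewrite lerBlDr lerDl mulr_ge0// exprn_ge0.
elim: n => [|n IH]; first by rewrite big_geq// expr0; ring.
by rewrite big_nat_recr//= IH exprS; field.
Qed.

Section FastCauchy.
Variable v : nat -> R -> R.
Hypothesis mv : forall n, measurable_fun Rp (v n).
Hypothesis v_cauchy : forall i j, (i <= j)%N ->
  (renergy (fun x => (v j x - v i x)%R) <= (8^-1 ^+ i)%:E)%E.

Let E j x : \bar R := (4 ^+ j * (v j.+1 x - v j x) ^+ 2)%:E.

Let E0 j x : (0 <= E j x)%E.
Proof. by rewrite lee_fin mulr_ge0 ?sqr_ge0// exprn_ge0. Qed.

Let mE j : measurable_fun Rp (E j).
Proof.
apply/measurable_EFinP; apply: measurable_funM; first exact: measurable_cst.
by apply: measurable_funX; apply: measurable_funB.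
Qed.

Let A x : \bar R := (\sum_(0 <= j <oo) E j x)%E.

Let A_int : (\int[mu]_(x in Rp) A x <= 2%:E)%E.
Proof.
rewrite integral_nneseries//; last exact: measurable_Rplus.
apply: lime_le.
  by apply: is_cvg_nneseries => n _ _; apply: integral_ge0.
apply: nearW => n; apply: (@le_trans _ _ (\sum_(0 <= j < n) (2^-1 ^+ j)%:E)%E).
  apply: lee_sum => j _.
  rewrite /E; under eq_integral do rewrite EFinM.
  rewrite ge0_integralZl_EFin ?exprn_ge0//; last 3 first.
  - exact: measurable_Rplus.
  - by move=> x _; rewrite lee_fin sqr_ge0.
  - by apply: measurable_sqrE; apply: measurable_funB.
  apply: (@le_trans _ _ ((4 ^+ j)%:E * (8^-1 ^+ j)%:E)%E).
    apply: lee_wpmul2l; first by rewrite lee_fin exprn_ge0.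
    by apply: v_cauchy.
  by rewrite -EFinM -exprMn (_ : 4 * 8^-1 = 2^-1)//; field.
by rewrite sumEFin lee_fin half_geometric_sum_le.
Qed.

Let mA : measurable_fun Rp A.
Proof.
have := @ge0_emeasurable_sum _ _ R Rp E xpredT (fun k x _ _ => E0 k x) (fun k _ => mE k).
by apply.
Qed.

Let A_fin : {ae mu, forall x, Rp x -> A x \is a fin_num}.
Proof.
apply: integrable_ae; first exact: measurable_Rplus.
apply/integrableP; split=> //.
rewrite (_ : (\int[mu]_(x in Rp) `|A x|)%E = (\int[mu]_(x in Rp) A x)%E).
  by apply: le_lt_trans A_int _; exact: ltry.
by apply: eq_integral => x _; rewrite gee0_abs//; apply: nneseries_ge0.
Qed.

Let v_cvg x : A x \is a fin_num -> cvgn (v ^~ x).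
Proof.
move=> Ax.
have dle j : `|v j.+1 x - v j x| <= geometric (Num.sqrt (fine (A x))) 2^-1 j.
  have EA : (E j x <= A x)%E.
    apply: (@le_trans _ _ (\sum_(0 <= i < j.+1) E i x)%E).
      by rewrite big_nat_recr//= leeDr// sume_ge0.
    by apply: nneseries_lim_ge => *; exact: E0.
  move: EA; rewrite -(fineK Ax) lee_fin => EA.
  have a0 : 0 <= fine (A x).
    by apply: le_trans EA; rewrite mulr_ge0 ?sqr_ge0// exprn_ge0.
  rewrite /= -ler_sqr ?nnegrE ?mulr_ge0 ?sqrtr_ge0 ?exprn_ge0//.
  rewrite real_normK ?num_real// exprMn sqr_sqrtr// exprAC.
  rewrite (_ : 2^-1 ^+ 2 = 4^-1 :> R); last by field.
  by rewrite exprVn ler_pdivlMr ?exprn_gt0// mulrC.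
have c1 : cvgn (series (telescope (v ^~ x))).
  apply: normed_cvg.
  apply: (@series_le_cvg _ _ (geometric (Num.sqrt (fine (A x))) 2^-1)).
  - by move=> n /=; exact: normr_ge0.
  - by move=> n; apply: geometric_ge0; rewrite ?sqrtr_ge0.
  - by move=> n /=; exact: dle.
  - apply: is_cvg_geometric_series; rewrite ger0_norm// invf_lt1//; lra.
have -> : v ^~ x = (fun n => v 0%N x + series (telescope (v ^~ x)) n).
  by apply/funext => n; exact: (eq_sum_telescope (v ^~ x) n).
by apply: is_cvgD => //; exact: is_cvg_cst.
Qed.

(** Completeness of L2 for rapidly converging sequences. The sum of
    4^j (v_(j+1) - v_j)^2 has finite integral, hence is finite almost everywhere, which
    bounds the increments by a geometric sequence; the pointwise limit inherits the
    energy bounds by the lemma of Fatou. *)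
Lemma fast_cauchy_limit : exists2 w : R -> R, measurable_fun Rp w &
  forall i, (renergy (fun x => (w x - v i x)%R) <= (8^-1 ^+ i)%:E)%E.
Proof.
pose w x := fine (limn_esup (fun n => (v n x)%:E)).
have mw : measurable_fun Rp w.
  apply: (measurableT_comp (fine_measurable measurableT)).
  by apply: measurable_fun_limn_esup => n; exact/measurable_EFinP.
exists w => // i.
have wE x : A x \is a fin_num -> v n x @[n --> \oo] --> w x.
  move=> /v_cvg /cvg_ex[l vl]; suff -> : w x = l by [].
  have : (v n x)%:E @[n --> \oo] --> l%:E.
    by apply: cvg_EFin => //; exact: nearW.
  by move=> /cvg_limn_einf_sup[_]; rewrite /w => ->.
rewrite /renergy.
rewrite (@ae_eq_integral _ _ _ mu Rp (fun x => limn_einf (fun j => ((v (j + i)%N x - v i x) ^+ 2)%:E))).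
- apply: le_trans (fatou _ _ _ _) _ => //=.
  + exact: measurable_Rplus.
  + by move=> n; apply: measurable_sqrE; exact: measurable_funB.
  + by move=> n x _; rewrite lee_fin sqr_ge0.
  + by apply: limn_einf_le_bound => n; apply: v_cauchy; rewrite leq_addl.
- exact: measurable_Rplus.
- by apply: measurable_sqrE; exact: measurable_funB.
- rewrite (_ : (fun _ => _) = (fun x => - limn_esup (fun j =>
      - ((v (j + i)%N x - v i x) ^+ 2)%:E))%E); last first.
    by apply/funext => x; rewrite -limn_einfN; congr limn_einf; apply/funext => j;
      rewrite /= opprK.
  apply: (measurableT_comp (@oppe_measurable _ _)).
  apply: measurable_fun_limn_esup => n; apply: (measurableT_comp (@oppe_measurable _ _)).
  by apply: measurable_sqrE; exact: measurable_funB.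
- move: A_fin; apply: filterS => x h /h /wE wx.
  have : ((v (j + i)%N x - v i x) ^+ 2)%:E @[j --> \oo] --> ((w x - v i x) ^+ 2)%:E.
    apply: cvg_EFin; first exact: nearW.
    have wxi : v (j + i)%N x @[j --> \oo] --> w x by rewrite (cvg_shiftn i (v ^~ x)).
    have hx : v (j + i)%N x - v i x @[j --> \oo] --> w x - v i x.
      by apply: cvgB => //; exact: cvg_cst.
    exact: (cvgM hx hx).
  by move=> /cvg_limn_einf_sup[->].
Qed.

End FastCauchy.
End Completeness.

(** * Compactness of limits of finite-rank operators *)

Section Compactness.
Variable R : realType.
Local Notation mu := (@lebesgue_measure R).
Local Notation Rp := (@Rplus R).
Implicit Types (f g h : R -> R[i]) (T S : (R -> R[i]) -> R -> R[i]).

(** An ultrafilter on the indices makes every bounded sequence converge at once and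
    so replaces the extraction of diagonal subsequences. *)
Lemma ultra_limit (U : set_system nat) (a : nat -> R) (B : R) :
  UltraFilter U -> (forall n, `|a n| <= B) ->
  exists l : R, forall d, 0 < d -> U [set n | `|a n - l| < d].
Proof.
move=> UU aB; have PU : ProperFilter U by exact: ultra_proper.
have FB : (a @ U) `[- B, B]%classic.
  apply: (@filterS _ U _ setT); last exact: filterT.
  by move=> n _ /=; rewrite in_itv /= -ler_norml.
have [l [_ cl]] := @segment_compact R (- B) B (a @ U) _ FB.
exists l => d d0.
have [//|Uc] := in_ultra_setVsetC [set n | `|a n - l| < d] UU.
have Fc : (a @ U) [set x | d <= `|x - l|].
  by apply: (@filterS nat U _ _ _ _ Uc) => n /= /negP; rewrite -leNgt.
have nl : nbhs l (ball l d) by exact: nbhsx_ballx.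
have [x [/=]] := cl _ _ Fc nl.
by rewrite /ball /= distrC => h1 h2; move: (le_lt_trans h1 h2); rewrite ltxx.
Qed.

Lemma functional_bound (u : R -> R) : L2 (fun x => (u x)%:C) ->
  exists B : R, forall f, L2 f -> (energy f <= 1)%E ->
   `|complex.Re (cRintegral Rp (fun y => (u y)%:C * f y))| <= B /\
   `|complex.Im (cRintegral Rp (fun y => (u y)%:C * f y))| <= B.
Proof.
move=> u2; have mu_ : measurable_fun Rp u by case/L2P : u2 => -[].
have uy := L2_Re u2.
have [a a0 ua] : exists2 a : R, 0 < a & (renergy u <= a%:E)%E.
  have := renergy_ge0 u; move: uy; rewrite /=.
  case: (renergy u) => // r _; rewrite lee_fin => r0.
  by exists (r + 1); [exact: ltr_wpDl|rewrite lee_fin lerDl].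
have key (v : R -> R) : measurable_fun Rp v -> (renergy v <= 1)%E ->
    `|\int[mu]_(y in Rp) (u y * v y)| <= Num.sqrt a.
  move=> mv v1; rewrite -sqrtr_sqr ler_wsqrtr// -lee_fin.
  apply: (@le_trans _ _ (a%:E * renergy v)%E).
    apply: (@cauchy_schwarz _ _ _ mu Rp _ (fun y => u y ^+ 2)) => //.
    - exact: measurable_Rplus.
    - exact: measurable_funM.
    - exact: measurable_funX.
    - exact: measurable_funX.
    - by move=> y _; exact: sqr_ge0.
    - by move=> y _; exact: sqr_ge0.
    - by move=> y _; rewrite exprMn.
  by rewrite -[leRHS]mule1; apply: lee_wpmul2l => //; rewrite lee_fin ltW.
exists (Num.sqrt a) => f /L2P[mf fy] f1; have [fr fi] := mf.
move: f1; rewrite energyE// => f1; split.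
  rewrite /=; under eq_Rintegral do rewrite Re_realM.
  by apply: key => //; apply: le_trans f1; rewrite leeDl// renergy_ge0.
rewrite /=; under eq_Rintegral do rewrite Im_realM.
by apply: key => //; apply: le_trans f1; rewrite leeDr// renergy_ge0.
Qed.

(** Convergence of the coefficients on finitely many fixed functions is convergence
    in L2. *)
Lemma energy_sum_bound n (g : 'I_n -> R -> R[i]) : (forall j, L2 (g j)) ->
  exists2 B : R, 0 <= B & forall (c : 'I_n -> R[i]) (d : R), 0 <= d ->
    (forall j, Normc.normc (c j) ^+ 2 <= d) ->
    (energy (fun x => (\sum_(j < n) c j * g j x)%R) <= (B * d)%:E)%E.
Proof.
elim: n g => [|n IH] g g2.
  exists 0 => // c d d0 _; under [X in energy X]eq_fun do rewrite big_ord0.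
  by rewrite energy0 mul0r.
have [B B0 hB] := IH (fun j => g (lift ord0 j)) (fun j => g2 _).
have [e e0 ge] : exists2 e : R, 0 <= e & energy (g ord0) = e%:E.
  have /L2P[_] := g2 ord0; have := energy_ge0 (g ord0).
  by case: (energy (g ord0)) => // r r0 _; exists r.
exists (2 * e + 2 * B); first by rewrite addr_ge0// mulr_ge0.
move=> c d d0 cd; under [X in energy X]eq_fun do rewrite big_ord_recl.
have m0 : cmeasurable (g ord0) by case/L2P: (g2 ord0).
apply: le_trans (energyD _ _) _.
- exact: cmeasurableZ.
- apply: cmeasurable_sum => j; apply: cmeasurableZ.
  by case/L2P : (g2 (lift ord0 j)).
rewrite mulrDl [leRHS]EFinD; apply: leeD.
  rewrite energyZ// ge -!EFinM lee_fin -mulrA ler_pM2l// mulrC.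
  by apply: ler_wpM2l.
rewrite -mulrA EFinM; apply: lee_wpmul2l => //.
by apply: hB => // j; exact: cd.
Qed.

Definition finite_rank_form T := exists (n : nat) (g psi : 'I_n -> R -> R),
  (forall j, L2 (fun x => (g j x)%:C) /\ L2 (fun x => (psi j x)%:C)) /\
  forall f x, L2 f -> 0 < x ->
    T f x = \sum_j cRintegral Rp (fun y => (psi j y)%:C * f y) * (g j x)%:C.

Section Diagonal.
Variable T : (R -> R[i]) -> R -> R[i].
Hypothesis bT : bounded_operator T.
Hypothesis T_approx : forall e : R, 0 < e -> exists S,
  [/\ bounded_operator S, finite_rank_form S & forall f, L2 f ->
    (energy (fun x => (T f x - S f x)%R) <= e%:E * energy f)%E].
Variable f : nat -> R -> R[i].
Hypothesis f2 : forall n, L2 (f n).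
Hypothesis f1 : forall n, (energy (f n) <= 1)%E.
Variable U : set_system nat.
Hypothesis UU : UltraFilter U.

(** A finite-rank S reduces the claim to finitely many bounded coefficient sequences,
    which converge along the ultrafilter; T - S contributes at most e / 16 times the
    energy of a difference of two functions in the unit ball, which is at most 4. *)
Lemma ultra_cauchy (e : R) : 0 < e -> exists2 A : set nat, U A &
  forall n m, A n -> A m -> (energy (fun x => (T (f n) x - T (f m) x)%R) <= e%:E)%E.
Proof.
move=> e0; have PU : ProperFilter U by exact: ultra_proper.
have e16 : 0 < e / 16 by rewrite divr_gt0.
have [S [bS [N [g [psi [gp2 SE]]]] TS]] := T_approx e16.
have [B B0 hB] := energy_sum_bound (fun j => proj1 (gp2 j)).
pose c j n := cRintegral Rp (fun y => (psi j y)%:C * f n y).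
pose d := e / (4 * (B + 1)).
have d0 : 0 < d by rewrite divr_gt0// mulr_gt0// ltr_wpDl.
pose r := Num.sqrt (d / 8).
have r0 : 0 < r by rewrite sqrtr_gt0 divr_gt0.
have lims j : exists l : R * R, U [set n |
    `|complex.Re (c j n) - l.1| < r /\ `|complex.Im (c j n) - l.2| < r].
  have [b hb] := functional_bound (proj2 (gp2 j)).
  have [l1 h1] := @ultra_limit U (fun n => complex.Re (c j n)) b UU
    (fun n => proj1 (hb _ (f2 n) (f1 n))).
  have [l2 h2] := @ultra_limit U (fun n => complex.Im (c j n)) b UU
    (fun n => proj2 (hb _ (f2 n) (f1 n))).
  exists (l1, l2); exact: filterI (h1 r r0) (h2 r r0).
have [l hl] := choice lims.
exists [set n | forall j, `|complex.Re (c j n) - (l j).1| < r /\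
                         `|complex.Im (c j n) - (l j).2| < r].
  have FU : Filter U by exact: filter_filter.
  exact: (@filter_forall nat 'I_N (fun j => [set n | `|complex.Re (c j n) - (l j).1| < r /\
    `|complex.Im (c j n) - (l j).2| < r]) U FU hl).
move=> n m An Am.
pose h x := 1 * f n x + - f m x.
have h2 : L2 h by apply: L2D; [exact: L2Z|exact: L2N].
have hE : h = fun x => f n x - f m x by apply/funext => x; rewrite /h mul1r.
have mf k : cmeasurable (f k) by case/L2P : (f2 k).
have h4 : (energy h <= 4%:E)%E.
  rewrite hE; apply: le_trans (energyD (mf n) _) _.
    by have := cmeasurableZ (-1) (mf m); under eq_fun do rewrite mulN1r.
  rewrite (_ : 4 = 2 * 1 + 2 * 1); last by ring.
  rewrite [leRHS]EFinD; apply: leeD; rewrite [leRHS]EFinM; apply: lee_wpmul2l => //.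
  rewrite (_ : (fun x => - f m x) = (fun x => -1 * f m x)); last first.
    by apply/funext => x; rewrite mulN1r.
  by rewrite energyZ// sqr_normc /= oppr0 expr0n addr0 sqrrN expr1n mul1e.
have [lT _] := bT; have [T1 T2 T3] := lT.
have mT k : L2 k -> cmeasurable (T k) by move=> /T1 /L2P[].
have [[S1 _ _] _] := bS.
have mS k : L2 k -> cmeasurable (S k) by move=> /S1 /L2P[].
have Th : L2eq (T h) (fun x => T (f n) x - T (f m) x).
  have hm : L2eq (T (fun x => - f m x)) (fun x => - T (f m) x).
    have neg (k : R -> R[i]) : (fun x => - k x) = (fun x => -1 * k x).
      by apply/funext => x; rewrite mulN1r.
    by rewrite !neg; exact: linear_operatorZ.
  apply: L2eq_trans (T3 1 _ _ (f2 n) (L2N (f2 m))) _.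
  apply: L2eq_trans (L2eq_lin 1 (L2eq_refl (T (f n))) hm) _.
  rewrite (_ : (fun x => 1 * _ + _) = (fun x => T (f n) x - T (f m) x)).
    exact: L2eq_refl.
  by apply/funext => x; rewrite mul1r.
have mTB : cmeasurable (fun x => T (f n) x - T (f m) x).
  by case/L2P : (L2B (T1 _ (f2 n)) (T1 _ (f2 m))).
rewrite -(L2eq_energy (mT _ h2) mTB Th).
have tri : (energy (T h) <=
    2%:E * energy (fun x => (T h x - S h x)%R) + 2%:E * energy (S h))%E.
  rewrite {1}(_ : T h = (fun x => (T h x - S h x) + S h x)).
    apply: energyD; last exact: mS.
    by case/L2P : (L2B (T1 _ h2) (S1 _ h2)).
  by apply/funext => x; rewrite subrK.
apply: le_trans tri _.
have Sh : (energy (S h) <= (B * d)%:E)%E.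
  have -> : energy (S h) = energy (fun x => \sum_j (c j n - c j m) * (g j x)%:C).
    apply: L2eq_energy; first exact: mS.
      apply: cmeasurable_sum => j; apply: cmeasurableZ.
      by case/L2P : (proj1 (gp2 j)).
    apply/L2eqE; apply: nearW => x x0; rewrite SE//; apply: eq_bigr => j _.
    congr (_ * _); rewrite /c.
    have mD := @measurable_Rplus R.
    rewrite [LHS](_ : _ = cRintegral Rp (fun y => -1 * ((psi j y)%:C * f m y) +
        (psi j y)%:C * f n y)).
      rewrite cRintegral_lin//; first by rewrite mulN1r addrC.
        exact: L2_mul_cintegrable (proj2 (gp2 j)) (f2 m).
      exact: L2_mul_cintegrable (proj2 (gp2 j)) (f2 n).
    by apply: cRintegral_eq => y _; rewrite hE; ring.
  apply: hB; first exact: ltW.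
  move=> j; have [n1 n2] := An j; have [m1 m2] := Am j.
  have sq (a b t : R) : `|a - t| < r -> `|b - t| < r -> (a - b) ^+ 2 <= d / 2.
    move=> ar br; have ab : `|a - b| <= 2 * r.
      rewrite (_ : a - b = (a - t) - (b - t)); last by ring.
      by apply: le_trans (ler_normB _ _) _; lra.
    rewrite -real_normK ?num_real//; apply: (@le_trans _ _ ((2 * r) ^+ 2)).
      by rewrite lerXn2r ?nnegrE// mulr_ge0// ltW.
    have r2 : r ^+ 2 = d / 8 by rewrite /r sqr_sqrtr// divr_ge0// ltW.
    by rewrite exprMn r2 expr2; lra.
  rewrite sqr_normc !raddfB (splitr d).
  by apply: lerD; [exact: sq n1 m1|exact: sq n2 m2].
apply: (@le_trans _ _ (2%:E * (e / 16 * 4)%:E + 2%:E * (B * d)%:E)%E).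
  apply: leeD; apply: lee_wpmul2l => //.
  apply: le_trans (TS h h2) _; rewrite [leRHS]EFinM; apply: lee_wpmul2l => //.
  by rewrite lee_fin ltW.
rewrite -!EFinM -EFinD lee_fin.
have : B * d <= e / 4.
  rewrite /d mulrA ler_pdivrMr ?mulr_gt0 ?ltr_wpDl//.
  rewrite (_ : e / 4 * (4 * (B + 1)) = B * e + e); last by field.
  by rewrite lerDl ltW.
by lra.
Qed.

End Diagonal.
End Compactness.

Section CompactOperator.
Variable R : realType.
Local Notation mu := (@lebesgue_measure R).
Local Notation Rp := (@Rplus R).
Implicit Types (T S : (R -> R[i]) -> R -> R[i]).

(** The factor 2 collects the real and the imaginary part. *)
Lemma L2_fast_limit (u : nat -> R -> R[i]) : (forall n, L2 (u n)) ->
  (forall i j, (i <= j)%N ->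
    (energy (fun x => (u j x - u i x)%R) <= (8^-1 ^+ i)%:E)%E) ->
  exists2 g : R -> R[i], L2 g &
    forall i, (energy (fun x => (u i x - g x)%R) <= (2 * 8^-1 ^+ i)%:E)%E.
Proof.
move=> u2 uc.
have mu_ n : cmeasurable (u n) by case/L2P : (u2 n).
have uB i j : cmeasurable (fun x => u j x - u i x) by case/L2P : (L2B (u2 j) (u2 i)).
have split i j : (energy (fun x => (u j x - u i x)%R) =
    renergy (fun x => (complex.Re (u j x) - complex.Re (u i x))%R) +
    renergy (fun x => (complex.Im (u j x) - complex.Im (u i x))%R))%E.
  rewrite energyE//; congr (_ + _)%E; apply: eq_integral => x _.
    by rewrite raddfB.
  by rewrite raddfB.
have [wr mwr wrE] : exists2 w : R -> R, measurable_fun Rp w &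
    forall i, (renergy (fun x => (w x - complex.Re (u i x))%R) <= (8^-1 ^+ i)%:E)%E.
  apply: fast_cauchy_limit => [n|i j /uc]; first by case: (mu_ n).
  by apply: le_trans; rewrite split leeDl// renergy_ge0.
have [wi mwi wiE] : exists2 w : R -> R, measurable_fun Rp w &
    forall i, (renergy (fun x => (w x - complex.Im (u i x))%R) <= (8^-1 ^+ i)%:E)%E.
  apply: fast_cauchy_limit => [n|i j /uc]; first by case: (mu_ n).
  by apply: le_trans; rewrite split leeDr// renergy_ge0.
pose g x := wr x +i* wi x.
have mg : cmeasurable g by split.
have gE i : (energy (fun x => (u i x - g x)%R) <= (2 * 8^-1 ^+ i)%:E)%E.
  have mB : cmeasurable (fun x => u i x - g x).
    apply: cmeasurableD => //.
    by have := cmeasurableZ (-1) mg; under eq_fun do rewrite mulN1r.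
  rewrite energyE// mulr_natl mulr2n EFinD; apply: leeD.
    apply: le_trans (wrE i); rewrite le_eqVlt; apply/orP; left; apply/eqP.
    apply: eq_integral => x _; congr EFin.
    by case: (u i x) => a b /=; rewrite -[in LHS]sqrrN opprB.
  apply: le_trans (wiE i); rewrite le_eqVlt; apply/orP; left; apply/eqP.
  apply: eq_integral => x _; congr EFin.
  by case: (u i x) => a b /=; rewrite -[in LHS]sqrrN opprB.
exists g => //; apply/L2P; split => //.
have -> : g = (fun x => u 0%N x + -1 * (u 0%N x - g x)).
  by apply/funext => x; ring.
have mB : cmeasurable (fun x => u 0%N x - g x).
  apply: cmeasurableD => //.
  by have := cmeasurableZ (-1) mg; under eq_fun do rewrite mulN1r.
have : L2 (fun x => u 0%N x + -1 * (u 0%N x - g x)).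
  apply: L2D => //; apply: L2Z; apply/L2P; split => //.
  by apply: le_lt_trans (gE 0%N) _; exact: ltry.
by case/L2P.
Qed.

(** Norm limits of finite-rank operators are compact. Along an ultrafilter the images are
    Cauchy, and from its members a subsequence is picked that converges fast. *)
Lemma compact_of_finite_rank T : bounded_operator T ->
  (forall e : R, 0 < e -> exists S,
    [/\ bounded_operator S, finite_rank_form S & forall f, L2 f ->
      (energy (fun x => (T f x - S f x)%R) <= e%:E * energy f)%E]) ->
  compact_operator T.
Proof.
move=> bT Tap; split => // f hf.
have f2 n : L2 (f n) by have [] := hf n.
have f1 n : (energy (f n) <= 1)%E.
  by have [_] := hf n; rewrite L2norm_le// expr1n.
have [U [UU evU]] := @ultraFilterLemma nat \oo _.
have PU : ProperFilter U by exact: ultra_proper.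
have e8 i : 0 < (8^-1 : R) ^+ i by rewrite exprn_gt0// invr_gt0.
have /choice[A hA] : forall i, exists A : set nat, U A /\ forall n m, A n -> A m ->
    (energy (fun x => (T (f n) x - T (f m) x)%R) <= (8^-1 ^+ i)%:E)%E.
  move=> i; have [A UA hA] := ultra_cauchy bT Tap f2 f1 UU (e8 i).
  by exists A.
have UC i : U [set n | forall j, (j <= i)%N -> A j n].
  elim: i => [|i IH].
    apply: (@filterS nat U _ _ _ _ (proj1 (hA 0%N))) => n An j.
    by rewrite leqn0 => /eqP ->.
  apply: (@filterS nat U _ _ _ _ (filterI IH (proj1 (hA i.+1)))) => n [h An] j.
  by rewrite leq_eqVlt => /predU1P[->//|]; rewrite ltnS; exact: h.
(* The index chosen at stage i lies in the first i + 1 sets and beyond the index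
   chosen before it, which makes the chosen indices increase. *)
have /choice[pick hpick] : forall p : nat * nat, exists n,
    (p.2 < n)%N /\ forall j, (j <= p.1)%N -> A j n.
  move=> [i b] /=.
  have Ub : U [set n | (b < n)%N].
    by apply: evU; exists b.+1.
  by have [n [bn Cn]] := filter_ex (filterI Ub (UC i)); exists n.
pose k := fix k i := if i is i'.+1 then pick (i, k i') else pick (0%N, 0%N).
have kS i : (k i < k i.+1)%N by have [] := hpick (i.+1, k i).
have kA i j : (j <= i)%N -> A j (k i).
  case: i => [|i] ji; first exact: (proj2 (hpick (0%N, 0%N)) _ ji).
  exact: (proj2 (hpick (i.+1, k i)) _ ji).
have [[T1 _ _] _] := bT.
have [g g2 gE] := @L2_fast_limit (fun i => T (f (k i))) (fun i => T1 _ (f2 _))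
  (fun i j ij => proj2 (hA i) _ _ (kA j i ij) (kA i i (leqnn i))).
exists k, g; split => //.
  by move=> m n; exact: (homo_ltn ltn_trans kS).
apply: (@squeeze_cvge _ _ _ _ (fun=> 0%E) _ (fun i => (geometric 2 2^-1 i)%:E)).
- apply: nearW => i; rewrite L2normE poweR_ge0/= -L2normE.
  have p0 : 0 <= 2 * (2^-1 : R) ^+ i by rewrite mulr_ge0// exprn_ge0// invr_ge0.
  rewrite L2norm_le//; apply: le_trans (gE i) _.
  rewrite lee_fin exprMn exprAC (_ : 2^-1 ^+ 2 = 4^-1 :> R); last by field.
  apply: ler_pM; rewrite ?exprn_ge0 ?invr_ge0//; first by rewrite expr2; lra.
  by rewrite lerXn2r ?nnegrE ?invr_ge0// lef_pV2 ?posrE//; lra.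
- exact: cvg_cst.
- apply: cvg_EFin; first exact: nearW.
  by apply: cvg_geometric; rewrite ger0_norm ?invr_ge0// invf_lt1//; lra.
Qed.

End CompactOperator.

(** * Indicators of intervals as test functions *)

Section Intervals.
Variable R : realType.
Local Notation mu := (@lebesgue_measure R).
Local Notation Rp := (@Rplus R).
Implicit Types (u v : R -> R) (f g : R -> R[i]).

Lemma itv_sub_Rplus (a b : R) : 0 < a -> `[a, b]%classic `<=` Rp.
Proof.
move=> a0 x /=; rewrite in_itv /= => /andP[ax _].
by apply/RplusE; exact: lt_le_trans ax.
Qed.

Lemma itv_measurable (a b : R) u : 0 < a -> measurable_fun Rp u ->
  measurable_fun `[a, b] u.
Proof.
move=> a0 mu_; exact: (measurable_funS (@measurable_Rplus R) (itv_sub_Rplus a0)).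
Qed.

Lemma measure_itv (a b : R) : a < b -> mu `[a, b] = (b - a)%:E.
Proof. by move=> ab; rewrite lebesgue_measure_itv /= lte_fin ab EFinB. Qed.

Lemma itv_integrable (a b c : R) u : 0 < a -> a < b -> measurable_fun Rp u ->
  (forall y, a <= y <= b -> `|u y| <= c) ->
  mu.-integrable `[a, b] (fun y => (u y)%:E).
Proof.
move=> a0 ab mu_ uc; apply: measurable_bounded_integrable.
- exact: measurable_itv.
- by rewrite /= measure_itv// ltry.
- exact: itv_measurable.
- exists c; split; first exact: num_real.
  move=> d cd y /=; rewrite in_itv /= => yab.
  by apply: le_trans (uc y yab) _; exact: ltW.
Qed.

(** Masses on disjoint sets add up; this turns local lower bounds into global ones. *)
Lemma sum_local_le (I : eqType) (s : seq I) (F : I -> set R) (h : R -> \bar R) :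
  uniq s -> (forall i, measurable (F i)) -> (forall i, F i `<=` Rp) ->
  trivIset [set` s] F -> measurable_fun Rp h ->
  (forall x, 0 < x -> (0 <= h x)%E) ->
  (\sum_(i <- s) \int[mu]_(x in F i) h x <= \int[mu]_(x in Rp) h x)%E.
Proof.
move=> us mF FR tF mh h0.
have sub : \big[setU/set0]_(i <- s) F i `<=` Rp.
  elim/big_rec: _ => [x //|i X _ XR x []]; [exact: FR|exact: XR].
have mU : measurable (\big[setU/set0]_(i <- s) F i) by exact: bigsetU_measurable.
rewrite -ge0_integral_bigsetU//.
- apply: ge0_subset_integral => //; first exact: measurable_Rplus.
  by move=> x /RplusE; exact: h0.
- exact: (measurable_funS (@measurable_Rplus R) sub).
- by move=> x /sub /RplusE; exact: h0.
Qed.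

Definition step (A : set R) (y : R) : R[i] := (\1_A y)%:C.

Lemma cmeasurable_step (A : set R) : measurable A -> cmeasurable (step A).
Proof. by move=> mA; apply: cmeasurable_real; exact: measurable_indic. Qed.

Lemma energy_step (a b : R) : 0 < a -> a < b ->
  energy (step `[a, b]) = (b - a)%:E.
Proof.
move=> a0 ab; rewrite energy_real /renergy.
rewrite (_ : (\int[mu]_(x in Rp) (\1_`[a, b] x ^+ 2)%:E)%E =
             (\int[mu]_(x in Rp) (\1_`[a, b] x)%:E)%E).
  rewrite integral_indic//; last exact: measurable_Rplus.
  rewrite setIidl; first by rewrite /= measure_itv.
  exact: itv_sub_Rplus.
by apply: eq_integral => x _; rewrite indicE; case: (_ \in _); rewrite ?expr1n ?expr0n.
Qed.

Lemma L2_step (a b : R) : 0 < a -> a < b -> L2 (step `[a, b]).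
Proof.
move=> a0 ab; apply/L2P; split; first exact: cmeasurable_step.
by rewrite energy_step// ltry.
Qed.

Lemma intop_real k u x :
  intop k (fun y => (u y)%:C) x = (\int[mu]_(y in Rp) (k x y * u y))%:C.
Proof.
apply/eqP; rewrite eq_complex Re_intop Im_intop /= eqxx /=; apply/eqP.
by rewrite /Rintegral integral0_eq// => y _; rewrite mulr0.
Qed.

Lemma Rintegral_indic (A : set R) u : A `<=` Rp ->
  \int[mu]_(y in Rp) (u y * \1_A y) = \int[mu]_(y in A) u y.
Proof.
move=> AR; rewrite Rintegral_mkcond [RHS]Rintegral_mkcond.
apply: eq_Rintegral => y _; rewrite !patchE indicE.
have [yA|yA] := boolP (y \in A); last by rewrite mulr0; case: ifP.
by rewrite mulr1 mem_set//; apply: AR; exact/set_mem.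
Qed.

Lemma intop_step k (A : set R) x : A `<=` Rp ->
  intop k (step A) x = (\int[mu]_(y in A) k x y)%:C.
Proof. by move=> AR; rewrite intop_real Rintegral_indic. Qed.

Lemma local_energy_ge (a b r : R) f : 0 < a -> a < b -> 0 <= r -> cmeasurable f ->
  {ae mu, forall x, a <= x <= b -> r <= complex.Re (f x)} ->
  ((r ^+ 2 * (b - a))%:E <=
    \int[mu]_(x in `[a, b]) (Normc.normc (f x) ^+ 2)%:E)%E.
Proof.
move=> a0 ab r0 mf rf.
have -> : (r ^+ 2 * (b - a))%:E = (\int[mu]_(x in `[a, b]) (r ^+ 2)%:E)%E.
  by rewrite integral_cst//= measure_itv// EFinM.
apply: ae_ge0_le_integral => //.
- by move=> x _; rewrite lee_fin sqr_ge0.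
- by move=> x _; rewrite lee_fin sqr_ge0.
- exact: (measurable_funS (@measurable_Rplus R) (itv_sub_Rplus a0) (measurable_sqr_normc mf)).
- move: rf; apply: filterS => x h /=; rewrite in_itv /= => /h rfx.
  rewrite lee_fin sqr_normc; apply: (@le_trans _ _ (complex.Re (f x) ^+ 2)).
    by rewrite lerXn2r ?nnegrE// (le_trans r0).
  by rewrite lerDl sqr_ge0.
Qed.

End Intervals.

(** * Necessity for boundedness and compactness *)

Section BoundedCompact.
Variable R : realType.
Local Notation mu := (@lebesgue_measure R).
Local Notation Rp := (@Rplus R).
Implicit Types (T S : (R -> R[i]) -> R -> R[i]) (f g : R -> R[i]).
Variable phi : R -> R.
Hypothesis phi_ge0 : forall x, 0 < x -> 0 <= phi x.
Hypothesis phi_ni : forall x y, 0 < x -> x <= y -> phi y <= phi x.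
Local Notation phiC := (fun x => (phi x)%:C).

Lemma Qop_intop f : Qop phiC f = intop (qker phi) f.
Proof. by []. Qed.

Lemma extends_intop : extends_Q phiC (intop (qker phi)).
Proof. by move=> f _; exact: L2eq_refl. Qed.

Lemma measurable_qker_row x : 0 < x -> measurable_fun Rp (qker phi x).
Proof. by move=> x0; apply: measurable_kernel_row => //; exact: measurable_qker. Qed.

Lemma qker_bounds x y : 0 < x -> 0 < y -> 0 <= qker phi x y <= phi y.
Proof.
move=> x0 y0; rewrite /qker phi_ge0 ?max_gt0//= phi_ni// le_max lexx orbT.
by [].
Qed.

Lemma qker_integrable x (a b : R) : 0 < x -> 0 < a -> a < b ->
  mu.-integrable `[a, b] (fun y => (qker phi x y)%:E).
Proof.
move=> x0 a0 ab; apply: (itv_integrable (c := phi a)) => //.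
  exact: measurable_qker_row.
move=> y /andP[ay yb]; have y0 : 0 < y by exact: lt_le_trans ay.
have /andP[h1 h2] := qker_bounds x0 y0.
by rewrite ger0_norm// (le_trans h2)// phi_ni.
Qed.

Lemma Rintegral_itv_ge (a b c : R) (u : R -> R) : 0 < a -> a < b ->
  mu.-integrable `[a, b] (fun y => (u y)%:E) ->
  (forall y, a <= y <= b -> c <= u y) ->
  c * (b - a) <= \int[mu]_(y in `[a, b]) u y.
Proof.
move=> a0 ab ui cu.
have <- : \int[mu]_(y in `[a, b]) c = c * (b - a).
  by rewrite Rintegral_cst//= measure_itv.
apply: le_Rintegral => //.
  by apply: (itv_integrable (c := `|c|)) => //; exact: measurable_cst.
Qed.

Lemma bcs_step (a b : R) : 0 < a -> bounded_compact_support (step `[a, b]).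
Proof.
move=> a0; split; first exact: cmeasurable_step.
  exists 1 => x _; rewrite normc_real indicE.
  by case: (_ \in _); rewrite ?normr1// normr0.
exists a, b; split => // x _; rewrite /step indicE.
have [xab _|_] := boolP (x \in _); last by rewrite eqxx.
by move: xab; rewrite inE /= in_itv.
Qed.

Definition half_itv (x : R) : set R := `[x / 2, x]%classic.

Lemma half_lt (x : R) : 0 < x -> 0 < x / 2 /\ x / 2 < x.
Proof. by move=> x0; split; lra. Qed.

Lemma energy_half x : 0 < x -> energy (step (half_itv x)) = (x / 2)%:E.
Proof.
by move=> x0; have [h1 h2] := half_lt x0; rewrite energy_step//; congr EFin; lra.
Qed.

(** On [x/2, x] the kernel is at least phi(x), so the image of the indicator of this
    interval is at least (x/2) phi(x) there. *)
Lemma half_local_energy T x : linear_operator T -> extends_Q phiC T -> 0 < x ->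
  ((((x / 2) * phi x) ^+ 2 * (x / 2))%:E <=
   \int[mu]_(t in half_itv x) (Normc.normc (T (step (half_itv x)) t) ^+ 2)%:E)%E.
Proof.
move=> [T1 _ _] TQ x0; have [h1 h2] := half_lt x0.
have xx : x - x / 2 = x / 2 by lra.
have := @local_energy_ge R (x / 2) x ((x / 2) * phi x) (T (step (half_itv x))) h1 h2.
rewrite xx; apply.
- by rewrite mulr_ge0 ?(ltW h1)// phi_ge0.
- by have /T1/L2P[] := L2_step h1 h2.
- have := TQ _ (@bcs_step (x / 2) x h1) => /L2eqE; apply: filterS => t Tt /andP[ht tx].
  have t0 : 0 < t by exact: lt_le_trans ht.
  rewrite Tt// Qop_intop intop_step; last exact: itv_sub_Rplus.
  rewrite /= mulrC -[X in _ * X]xx.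
  apply: (Rintegral_itv_ge h1 h2 (qker_integrable t0 h1 h2)).
  move=> y /andP[hy yx]; apply: phi_ni; last by rewrite ge_max tx.
  exact: max_gt0.
Qed.

Lemma half_sub_energy x f : 0 < x -> cmeasurable f ->
  (\int[mu]_(t in half_itv x) (Normc.normc (f t) ^+ 2)%:E <= energy f)%E.
Proof.
move=> x0 mf; have [h1 _] := half_lt x0; apply: ge0_subset_integral => //.
- exact: measurable_itv.
- exact: measurable_Rplus.
- exact: measurable_sqr_normc.
- by move=> t _; rewrite lee_fin sqr_ge0.
- exact: itv_sub_Rplus.
Qed.

Lemma bounded_xphi T : bounded_operator T -> extends_Q phiC T ->
  exists2 C : R, 0 <= C & forall x, 0 < x -> x * phi x <= C.
Proof.
move=> [lT Ty] TQ; have [C C0 TC] := opnorm_fin lT Ty.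
exists (2 * C); first by rewrite mulr_ge0.
move=> x x0; have [h1 h2] := half_lt x0.
have f2 := L2_step h1 h2.
have eT : (energy (T (step (half_itv x))) <= (C ^+ 2 * (x / 2))%:E)%E.
  by apply: energy_opnorm => //; rewrite ?TC ?energy_half.
have := le_trans (half_local_energy lT TQ x0) (le_trans (half_sub_energy x0 _) eT).
have [T1 _ _] := lT.
have mT : cmeasurable (T (step (half_itv x))) by case/L2P : (T1 _ f2).
move=> /(_ mT); rewrite lee_fin ler_pM2r// ler_sqr ?nnegrE//; first by lra.
by rewrite mulr_ge0 ?(ltW h1)// phi_ge0.
Qed.

Lemma Q_bounded_xphi (M : R) : (forall x, 0 < x -> x * phi x <= M) -> Q_bounded phiC.
Proof.
move=> xM; exists (intop (qker phi)); split; last exact: extends_intop.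
apply: (@intop_bounded _ (`|M| + 1)); first by rewrite ltr_wpDl.
apply: qker_dominated => // x x0; apply: le_trans (xM x x0) _.
by apply: le_trans (ler_norm M) _; rewrite lerDl.
Qed.

Lemma sqr_normc_le2 (a b : R[i]) :
  Normc.normc a ^+ 2 <= 2 * Normc.normc (a - b) ^+ 2 + 2 * Normc.normc b ^+ 2.
Proof.
rewrite !sqr_normc; case: a b => a1 a2 [b1 b2] /=.
have := sqr_ge0 (a1 - 2 * b1); have := sqr_ge0 (a2 - 2 * b2); nra.
Qed.

(** The normalized indicators of disjoint intervals [x/2, x] have images with mass at
    least e^2 / 4 on these intervals; the limit of a convergent subsequence would
    keep a fixed mass on infinitely many disjoint intervals. *)
Lemma compact_no_separated T (e : R) (x : nat -> R) : compact_operator T ->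
  extends_Q phiC T -> 0 < e -> (forall n, 0 < x n) ->
  (forall n, e <= x n * phi (x n)) ->
  ~ trivIset setT (fun n => half_itv (x n)).
Proof.
move=> [bT cT] TQ e0 x0 ex tx.
have [lT _] := bT; have [T1 T2 T3] := lT.
pose c n := (Num.sqrt (x n / 2))^-1.
have hx n := half_lt (x0 n).
have c2 n : c n ^+ 2 = (x n / 2)^-1.
  by have [h _] := hx n; rewrite /c exprVn sqr_sqrtr// ltW.
pose f n y := (c n)%:C * step (half_itv (x n)) y.
have s2 n : L2 (step (half_itv (x n))) by have [h1 h2] := hx n; exact: L2_step.
have f2 n : L2 (f n) by exact: L2Z.
have fT n : energy (f n) = 1%E.
  have [h1 _] := hx n.
  rewrite /f energyZ; last by case/L2P : (s2 n).
  by rewrite energy_half// normc_real real_normK ?num_real// c2 -EFinM mulVf// gt_eqF.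
have [k [g [k_inc g2 kg]]] : exists k : nat -> nat, exists g : R -> R[i],
    [/\ {homo k : m n / (m < n)%N}, L2 g &
       L2norm (fun y => T (f (k n)) y - g y) @[n --> \oo] --> 0%E].
  by apply: cT => n; split => //; rewrite L2norm_le// expr1n fT.
have mg : cmeasurable g by case/L2P : g2.
have Tf2 n : L2 (T (f n)) by exact: T1.
have mT n : cmeasurable (T (f n)) by case/L2P : (Tf2 n).
pose loc h n := (\int[mu]_(t in half_itv (x n)) (Normc.normc (h t) ^+ 2)%:E)%E.
have sub n : half_itv (x n) `<=` Rp by have [h1 _] := hx n; exact: itv_sub_Rplus.
have mloc h n : cmeasurable h ->
    measurable_fun (half_itv (x n)) (fun t => (Normc.normc (h t) ^+ 2)%:E).
  move=> mh; exact: (measurable_funS (@measurable_Rplus R) (sub n) (measurable_sqr_normc mh)).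
have mitv n : measurable (half_itv (x n)) by exact: measurable_itv.
have Tloc n : ((e ^+ 2 / 4)%:E <= loc (T (f n)) n)%E.
  have [h1 _] := hx n.
  have -> : loc (T (f n)) n =
      (((x n / 2)^-1)%:E * loc (T (step (half_itv (x n)))) n)%E.
    rewrite /loc -ge0_integralZl_EFin//; last 4 first.
    - exact: mitv.
    - by move=> t _; rewrite lee_fin sqr_ge0.
    - by apply: mloc; case/L2P : (T1 _ (s2 n)).
    - by rewrite invr_ge0 ltW.
    apply: ge0_ae_eq_integral => //.
    - exact: mitv.
    - exact: mloc.
    - by apply: measurable_funeM; apply: mloc; case/L2P : (T1 _ (s2 n)).
    - by move=> t _; rewrite lee_fin sqr_ge0.
    - by move=> t _; rewrite -EFinM lee_fin mulr_ge0 ?sqr_ge0// invr_ge0 ltW.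
    - have /L2eqE := linear_operatorZ (c n)%:C lT (s2 n); apply: filterS => t h ht.
      rewrite h; last by apply/RplusE; exact: sub ht.
      by rewrite Normc.normcM exprMn normc_real real_normK ?num_real// c2 EFinM.
  apply: (@le_trans _ _ (((x n / 2)^-1)%:E * (((x n / 2) * phi (x n)) ^+ 2 * (x n / 2))%:E)%E).
    rewrite -EFinM lee_fin mulrCA mulVf ?gt_eqF// mulr1.
    rewrite (_ : e ^+ 2 / 4 = (e / 2) ^+ 2); last by field.
    rewrite lerXn2r ?nnegrE ?divr_ge0 ?(ltW e0)//.
      by rewrite mulr_ge0 ?(ltW h1)// phi_ge0.
    by have := ex n; lra.
  by apply: lee_wpmul2l; [rewrite lee_fin invr_ge0 ltW|exact: half_local_energy].
have near_g : \forall n \near \oo,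
    (energy (fun y => (T (f (k n)) y - g y)%R) <= (e ^+ 2 / 16)%:E)%E.
  have e4 : 0 < e / 4 by rewrite divr_gt0.
  have : \forall n \near \oo, (L2norm (fun y => (T (f (k n)) y - g y)%R) < (e / 4)%:E)%E.
    by apply: (kg (fun z => (z < (e / 4)%:E)%E)); apply: open_ereal_lt'; rewrite lte_fin.
  apply: filterS => n /ltW; rewrite L2norm_le ?(ltW e4)// => h.
  by apply: le_trans h _; rewrite lee_fin exprMn exprVn; lra.
(* 2 loc g >= loc T f - 2 (error) >= e^2/4 - 2 e^2/16. *)
have gloc : \forall n \near \oo, ((e ^+ 2 / 16)%:E <= loc g (k n))%E.
  near=> n.
  have h1 : (loc (T (f (k n))) (k n) <=
     2%:E * energy (fun y => (T (f (k n)) y - g y)%R) + 2%:E * loc g (k n))%E.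
    have mB : cmeasurable (fun y => T (f (k n)) y - g y).
      by case/L2P : (L2B (Tf2 (k n)) g2).
    apply: (@le_trans _ _ (2%:E * loc (fun y => (T (f (k n)) y - g y)%R) (k n) +
        2%:E * loc g (k n))%E).
      have Z h m : cmeasurable h -> (2%:E * loc h m =
          \int[mu]_(t in half_itv (x m)) (2%:E * (Normc.normc (h t) ^+ 2)%:E))%E.
        move=> mh; rewrite ge0_integralZl_EFin.
        - by [].
        - exact: mitv.
        - by move=> t _; rewrite lee_fin sqr_ge0.
        - exact: mloc.
        - by [].
      rewrite !Z// -ge0_integralD; first last.
      - by apply: measurable_funeM; exact: mloc.
      - by move=> t _; rewrite -EFinM lee_fin mulr_ge0// sqr_ge0.
      - by apply: measurable_funeM; exact: mloc.
      - by move=> t _; rewrite -EFinM lee_fin mulr_ge0// sqr_ge0.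
      - exact: mitv.
      apply: ge0_le_integral.
      - exact: mitv.
      - by move=> t _; rewrite lee_fin sqr_ge0.
      - exact: mloc.
      - by apply: emeasurable_funD; apply: measurable_funeM; exact: mloc.
      - by move=> t _; rewrite -!EFinM -EFinD lee_fin sqr_normc_le2.
    apply: leeD => //; apply: lee_wpmul2l => //.
    exact: half_sub_energy.
  have h2 : (energy (fun y => (T (f (k n)) y - g y)%R) <= (e ^+ 2 / 16)%:E)%E.
    by near: n.
  have := le_trans (Tloc (k n)) h1.
  have : (0 <= loc g (k n))%E by apply: integral_ge0 => t _; rewrite lee_fin sqr_ge0.
  case: (loc g (k n)) => [r| |]//; last by move=> _ _; exact: leey.
  move: h2 (energy_ge0 (fun y => T (f (k n)) y - g y)).
  case: (energy _) => // q; rewrite -!EFinM -EFinD !lee_fin; lra.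
have [N _ hN] := gloc.
have gfin := L2P g; have [+ _] := gfin => /(_ g2)[_ gy].
have sumle m : ((e ^+ 2 / 16 *+ m)%:E <= energy g)%E.
  pose s := [seq k i | i <- iota N m].
  have us : uniq s.
    rewrite map_inj_uniq ?iota_uniq// => i j kij; apply/eqP.
    by case: (ltngtP i j) => // /k_inc; rewrite kij ltnn.
  apply: le_trans (@sum_local_le _ _ s (fun n => half_itv (x n)) _ us mitv sub _ (measurable_sqr_normc mg) _).
  - rewrite big_map.
    apply: (@le_trans _ _ (\sum_(i <- iota N m) (e ^+ 2 / 16)%:E)%E).
      rewrite sumEFin lee_fin.
      by rewrite big_const_seq count_predT size_iota iter_addr_0.
    rewrite big_seq [leRHS]big_seq; apply: lee_sum => i; rewrite mem_iota => /andP[Ni _].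
    exact: hN.
  - exact: sub_trivIset tx.
  - by move=> y _; rewrite lee_fin sqr_ge0.
have [G G0 gG] : exists2 G : R, 0 <= G & energy g = G%:E.
  have := energy_ge0 g; move: gy.
  by case: (energy g) => // r _ r0; exists r.
have d0 : 0 < e ^+ 2 / 16 by rewrite divr_gt0// exprn_gt0.
have := sumle (Num.truncn (G / (e ^+ 2 / 16))).+1.
rewrite gG lee_fin -mulr_natr mulrC -ler_pdivlMr// leNgt truncnS_gt//.
Unshelve. all: by end_near. Qed.

End BoundedCompact.

(** * Compactness and the limits of x phi(x) *)

Section CompactLimits.
Variable R : realType.
Local Notation mu := (@lebesgue_measure R).
Local Notation Rp := (@Rplus R).
Implicit Types (T S : (R -> R[i]) -> R -> R[i]).

Lemma separated_trivIset (x : nat -> R) :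
  (forall m n, (m < n)%N -> x n < x m / 2 \/ x m < x n / 2) ->
  trivIset setT (fun n => half_itv (x n)).
Proof.
have key (a b : R) : a < b / 2 -> half_itv a `&` half_itv b = set0.
  move=> ab; apply/seteqP; split=> // t []; rewrite /half_itv /= !in_itv /=.
  by move=> /andP[_ ta] /andP[bt _]; lra.
move=> sep; apply/trivIsetP => i j _ _ ij.
move: ij; rewrite neq_ltn => /orP[] /sep[] h.
- by rewrite setIC key.
- by rewrite key.
- by rewrite key.
- by rewrite setIC key.
Qed.

Definition zrange (N : nat) : seq int :=
  [seq Posz i | i <- iota 0 N] ++ [seq Negz i | i <- iota 0 N].

Lemma zrange_out (N : nat) (n : int) : n \notin zrange N ->
  (2 : R) ^+ N <= 2 ^ n \/ 2 ^ n <= ((2 : R) ^+ N)^-1.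
Proof.
rewrite mem_cat negb_or => /andP[h1 h2].
case: n h1 h2 => i h1 h2.
  left; rewrite -exprnP ler_eXn2l ?ltr1n//.
  by rewrite leqNgt; apply: contra h1 => iN; rewrite map_f// mem_iota.
right; rewrite NegzE -exprnN lef_pV2 ?posrE ?exprn_gt0// ler_eXn2l ?ltr1n//.
rewrite ltnW// ltnS leqNgt; apply: contra h2 => iN.
by rewrite map_f// mem_iota.
Qed.

Variable phi : R -> R.
Hypothesis phi_ge0 : forall x, 0 < x -> 0 <= phi x.
Hypothesis phi_ni : forall x y, 0 < x -> x <= y -> phi y <= phi x.
Local Notation phiC := (fun x => (phi x)%:C).

Lemma xphi_near0 : x * phi x @[x --> 0^'+] --> 0 <->
  forall e : R, 0 < e -> exists2 d : R, 0 < d & forall x, 0 < x -> x < d -> x * phi x < e.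
Proof.
split=> [h e e0|h].
  have /cvgr0Pnorm_lt/(_ e e0) := h.
  rewrite near_withinE => -[d /= d0 hd]; exists d => // x x0 xd.
  have hx : ball (0 : R) d x by rewrite /ball /= sub0r normrN gtr0_norm.
  exact: le_lt_trans (ler_norm _) (hd x hx x0).
apply/cvgr0Pnorm_lt => e e0; have [d d0 hd] := h e e0.
rewrite near_withinE; exists d => //= x; rewrite /= sub0r normrN => xd x0.
rewrite ger0_norm ?mulr_ge0 ?phi_ge0 ?(ltW x0)//; apply: hd => //.
exact: le_lt_trans (ler_norm _) xd.
Qed.

Lemma xphi_nearoo : x * phi x @[x --> +oo] --> 0 <->
  forall e : R, 0 < e -> exists2 b : R, 0 < b & forall x, b < x -> x * phi x < e.
Proof.
split=> [h e e0|h].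
  have /cvgr0Pnorm_lt/(_ e e0) := h.
  move=> [b [br hb]]; exists (Num.max b 1); first by rewrite lt_max ltr01 orbT.
  move=> x; rewrite gt_max => /andP[bx _].
  by apply: le_lt_trans (ler_norm _) _; exact: hb.
apply/cvgr0Pnorm_lt => e e0; have [b b0 hb] := h e e0.
exists b; split; first exact: num_real.
move=> x bx; have x0 : 0 < x by exact: lt_trans bx.
by rewrite ger0_norm ?mulr_ge0 ?phi_ge0 ?(ltW x0)//; exact: hb.
Qed.

Lemma compact_limits T : compact_operator T -> extends_Q phiC T ->
  x * phi x @[x --> 0^'+] --> 0 /\ x * phi x @[x --> +oo] --> 0.
Proof.
move=> cT TQ; split.
  apply/xphi_near0 => e e0; apply: contrapT => no.
  have /choice[pick hpick] : forall d : R, exists x : R, 0 < d -> [/\ 0 < x, x < d & e <= x * phi x].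
    move=> d; have [d0|d0] := ltP 0 d; last by exists 0.
    apply: contrapT => nox; apply: no; exists d => // x x0 xd; rewrite ltNge.
    by apply/negP => ex; apply: nox; exists x.
  pose x := fix x n := if n is n'.+1 then pick (x n' / 2) else pick 1.
  have x0 n : 0 < x n.
    elim: n => [|n IH]; first by have [] := hpick 1 ltr01.
    by have [] := hpick _ (divr_gt0 IH (ltr0n _ 2)).
  have xS n : x n.+1 < x n / 2 by have [] := hpick _ (divr_gt0 (x0 n) (ltr0n _ 2)).
  have xe n : e <= x n * phi (x n).
    case: n => [|n]; first by have [] := hpick 1 ltr01.
    by have [] := hpick _ (divr_gt0 (x0 n) (ltr0n _ 2)).
  apply: (compact_no_separated phi_ge0 phi_ni cT TQ e0 x0 xe).
  apply: separated_trivIset => m n mn; left.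
  elim: n mn => // n IH; rewrite ltnS leq_eqVlt => /predU1P[->//|/IH h].
  by have := xS n; have := x0 n; lra.
apply/xphi_nearoo => e e0; apply: contrapT => no.
have /choice[pick hpick] : forall d : R, exists x : R, 0 < d -> [/\ 0 < x, d < x & e <= x * phi x].
  move=> d; have [d0|d0] := ltP 0 d; last by exists 0.
  apply: contrapT => nox; apply: no; exists d => // x xd; rewrite ltNge.
  by apply/negP => ex; apply: nox; exists x => _; split => //; exact: lt_trans xd.
pose x := fix x n := if n is n'.+1 then pick (2 * x n') else pick 1.
have x0 n : 0 < x n.
  elim: n => [|n IH]; first by have [] := hpick 1 ltr01.
  by have [] := hpick _ (mulr_gt0 (ltr0n _ 2) IH).
have xS n : 2 * x n < x n.+1 by have [] := hpick _ (mulr_gt0 (ltr0n _ 2) (x0 n)).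
have xe n : e <= x n * phi (x n).
  case: n => [|n]; first by have [] := hpick 1 ltr01.
  by have [] := hpick _ (mulr_gt0 (ltr0n _ 2) (x0 n)).
apply: (compact_no_separated phi_ge0 phi_ni cT TQ e0 x0 xe).
apply: separated_trivIset => m n mn; right.
elim: n mn => // n IH; rewrite ltnS leq_eqVlt => /predU1P[->|/IH h].
  by have := xS n; lra.
by have := xS n; have := x0 n; lra.
Qed.

Lemma limits_bound : x * phi x @[x --> 0^'+] --> 0 -> x * phi x @[x --> +oo] --> 0 ->
  exists2 M : R, 0 < M & forall x, 0 < x -> x * phi x <= M.
Proof.
move=> /xphi_near0/(_ 1 ltr01)[d d0 hd] /xphi_nearoo/(_ 1 ltr01)[b b0 hb].
exists (1 + b * phi d).
  by rewrite ltr_pwDl// mulr_ge0 ?phi_ge0// ltW.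
have bp : 0 <= b * phi d by rewrite mulr_ge0 ?phi_ge0// ltW.
move=> x x0; have [xd|dx] := ltP x d.
  by apply: ltW; apply: lt_le_trans (hd x x0 xd) _; rewrite lerDl.
have [bx|xb] := ltP b x.
  by apply: ltW; apply: lt_le_trans (hb x bx) _; rewrite lerDl.
apply: (@le_trans _ _ (b * phi d)); last by rewrite lerDr.
by apply: ler_pM => //; [exact: ltW|exact: phi_ge0|exact: phi_ni].
Qed.

Lemma threshold_seq (lam : R) (N : nat) :
  (forall n, n \notin zrange N -> dyadic_val phi n < lam) ->
  let s := [seq n <- zrange N | lam <= dyadic_val phi n] in
  (forall n, n \in s -> lam <= dyadic_val phi n) /\
  (forall n, n \notin s -> dyadic_val phi n < lam).
Proof.
move=> hN s; split=> n; rewrite mem_filter; first by case/andP.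
by rewrite negb_and => /orP[|/hN//]; rewrite -ltNge.
Qed.

Lemma limits_threshold : x * phi x @[x --> 0^'+] --> 0 ->
  x * phi x @[x --> +oo] --> 0 -> forall lam : R, 0 < lam ->
  exists N, forall n, n \notin zrange N -> dyadic_val phi n < lam.
Proof.
move=> /xphi_near0 h0 /xphi_nearoo hoo lam lam0.
have [d d0 hd] := h0 lam lam0; have [b b0 hb] := hoo lam lam0.
pose c := Num.max b d^-1.
exists (Num.truncn c).+1 => n /zrange_out.
have c2 : c < (2 : R) ^+ (Num.truncn c).+1.
  apply: lt_trans (truncnS_gt c) _; rewrite -natrX ltr_nat; exact: ltn_expl.
move: c2; rewrite gt_max => /andP[b2 d2] [h|h].
  by apply: hb; exact: lt_le_trans h.
apply: hd; first exact: dyadic_gt0.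
by apply: le_lt_trans h _; rewrite invf_plt ?posrE ?exprn_gt0.
Qed.

(** Only finitely many dyadic values exceed a given positive level, so the
    finite-rank approximation applies at every scale. *)
Lemma limits_compact : x * phi x @[x --> 0^'+] --> 0 ->
  x * phi x @[x --> +oo] --> 0 -> Q_compact phiC.
Proof.
move=> h0 hoo; have [M M0 xM] := limits_bound h0 hoo.
exists (intop (qker phi)); split; last exact: extends_intop.
apply: compact_of_finite_rank.
  exact: intop_bounded M0 (qker_dominated phi_ge0 phi_ni xM).
move=> e e0; pose lam := Num.sqrt e / 8.
have lam0 : 0 < lam by rewrite divr_gt0// sqrtr_gt0.
have [N hN] := limits_threshold h0 hoo lam0.
have [s1 s2] := threshold_seq hN.
have [m [S [g [psi [_ bS TS gp SE]]]]] :=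
  finite_rank_approximation phi_ge0 phi_ni M0 xM lam0 s1 s2.
exists S; split => //; first by exists (m + m)%N, g, psi.
move=> f /TS; congr (_ <= _ * _)%E; congr EFin.
by rewrite /lam mulrC divfK// sqr_sqrtr// ltW.
Qed.

End CompactLimits.

(** * Singular numbers and layered sums *)

Section SingularNumbers.
Variable R : realType.
Implicit Types (T S : (R -> R[i]) -> R -> R[i]).

Lemma rank_le_widen (n m : nat) S : (n <= m)%N -> rank_le n S -> rank_le m S.
Proof.
move=> nm [g [g2 gS]]; rewrite -(subnKC nm); set d := (m - n)%N.
exists (fun j => match fintype.split j with inl i => g i | inr _ => fun=> 0 end).
split; first by move=> j; case: (fintype.split j) => i; [exact: g2|exact: L2_0].
move=> f f2; have [c cE] := gS f f2.
exists (fun j => match fintype.split j with inl i => c i | inr _ => 0 end).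
rewrite (_ : (fun x => _) = (fun x => \sum_(i < n) c i * g i x)) => //.
apply/funext => x; rewrite big_split_ord /=.
under eq_bigr do rewrite (unsplitK (inl _)).
by rewrite [X in _ + X]big1 ?addr0// => i _; rewrite (unsplitK (inr _)) mulr0.
Qed.

Lemma singular_number_le T S (n : nat) (c : R) : 0 <= c -> bounded_operator S ->
  rank_le n S ->
  (forall f, L2 f -> (energy (fun x => (T f x - S f x)%R) <= (c ^+ 2)%:E * energy f)%E) ->
  (singular_number n T <= c%:E)%E.
Proof.
move=> c0 bS rS TS; apply: (@le_trans _ _ (opnorm (fun f x => T f x - S f x))).
  by apply: ereal_inf_lbound; exists S.
exact: opnorm_le.
Qed.

Lemma singular_number_ge0 T n : linear_operator T -> (0 <= singular_number n T)%E.
Proof.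
move=> lT; apply: le_ereal_inf_tmp => _ [S [[lS _] _] <-].
have lB := linear_operatorB lT lS.
apply: (@le_trans _ _ (L2norm (fun x => T (fun=> 0) x - S (fun=> 0) x))).
  by rewrite L2normE poweR_ge0.
apply: ereal_sup_ubound; exists (fun=> 0) => //; split; first exact: L2_0.
by rewrite L2norm_le// energy0 lee_fin sqr_ge0.
Qed.

Lemma singular_number_ni T m n : (m <= n)%N ->
  (singular_number n T <= singular_number m T)%E.
Proof.
move=> mn; apply: le_ereal_inf => _ [S [bS rS] <-].
by exists S => //; split => //; exact: rank_le_widen rS.
Qed.

Lemma bounded_operator0 : bounded_operator (fun _ _ => 0 : R[i]).
Proof.
split; last first.
  apply: le_lt_trans (opnorm_le (C := 0) _ _) _ => //; last exact: ltry.
  by move=> f _; rewrite energy0 expr0n mul0e.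
split => [f _|f g _ _ _|c f g _ _]; first exact: L2_0.
  exact: L2eq_refl.
rewrite (_ : (fun x => c * 0 + 0) = (fun=> 0)); first exact: L2eq_refl.
by apply/funext => x; rewrite mulr0 addr0.
Qed.

Lemma singular_number_fin T n : bounded_operator T ->
  singular_number n T \is a fin_num.
Proof.
move=> [lT Ty]; rewrite ge0_fin_numE ?singular_number_ge0//.
apply: le_lt_trans Ty; apply: (@le_trans _ _ (opnorm (fun f x => T f x - 0))).
  apply: ereal_inf_lbound; exists (fun _ _ => 0) => //; split.
    exact: bounded_operator0.
  apply: (@rank_le_widen 0) => //; exists (fun _ _ => 0); split => [[]//|f _].
  exists (fun _ => 0); apply/L2eqE; apply: nearW => x _; rewrite big_ord0 //.
by rewrite (_ : (fun f x => T f x - 0) = T)//; apply/funext => f; apply/funext => x; rewrite subr0.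
Qed.

End SingularNumbers.

Section Summation.
Variable R : realType.

Lemma zrange_sumS (F : int -> R) N :
  \sum_(n <- zrange N.+1) F n = \sum_(n <- zrange N) F n + (F (Posz N) + F (Negz N)).
Proof.
rewrite /zrange -addn1 iotaD add0n !map_cat !big_cat /= !big_cons !big_nil.
by rewrite !addr0 addrACA.
Qed.

Lemma zrange_subset_sum (F : int -> R) (P : pred int) M N : (M <= N)%N ->
  (forall n, 0 <= F n) ->
  \sum_(n <- zrange M | P n) F n <= \sum_(n <- zrange N | P n) F n.
Proof.
move=> MN F0; rewrite big_mkcond [leRHS]big_mkcond /=.
have F0' n : 0 <= (if P n then F n else 0) by case: ifP.
elim: N MN => [|N IH]; first by rewrite leqn0 => /eqP ->.
rewrite leq_eqVlt => /predU1P[->//|/IH h].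
by apply: le_trans h _; rewrite zrange_sumS lerDl addr_ge0.
Qed.

Lemma powRX (x q : R) n : 0 <= x -> (x ^+ n) `^ q = (x `^ q) ^+ n.
Proof.
move=> x0; rewrite -powR_mulrn// -powR_mulrn ?powR_ge0//.
by rewrite -!powRrM mulrC.
Qed.

(** A geometric sum is comparable to its largest term; this is where the exponent
    1/2 is excluded. *)
Lemma geometric_cut (rho y : R) L : 0 < rho < 1 -> 0 <= y ->
  \sum_(l < L | rho ^+ l <= y) rho ^+ l <= y / (1 - rho).
Proof.
move=> /andP[r0 r1] y0; have r1' : 0 < 1 - rho by rewrite subr_gt0.
suff : \sum_(l < L | rho ^+ l <= y) rho ^+ l <= Num.max 0 ((y - rho ^+ L) / (1 - rho)).
  move=> /le_trans; apply; rewrite ge_max divr_ge0 ?(ltW r1')//=.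
  by rewrite ler_pM2r ?invr_gt0// lerBlDr lerDl exprn_ge0// ltW.
elim: L => [|L IH]; first by rewrite big_ord0 le_max lexx.
rewrite big_mkcond big_ord_recr /= -big_mkcond /=; case: ifPn => h; last first.
  rewrite addr0; apply: le_trans IH _; rewrite ge_max le_max lexx /=.
  rewrite le_max; apply/orP; left; rewrite ler_pdivrMr// mul0r subr_le0 ltW//.
  by rewrite ltNge.
rewrite le_max; apply/orP; right.
apply: (@le_trans _ _ ((y - rho ^+ L) / (1 - rho) + rho ^+ L)).
  rewrite lerD2r; apply: le_trans IH _; rewrite ge_max lexx andbT.
  by rewrite divr_ge0 ?(ltW r1')// subr_ge0.
rewrite exprS le_eqVlt; apply/orP; left; apply/eqP; field.
by rewrite gt_eqF.
Qed.

Lemma count_below (K n : nat) : (\sum_(k < K) (k < n)%N <= n)%N.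
Proof.
apply: (@leq_trans (minn K n)); last exact: geq_minr.
elim: K => [|j IH]; first by rewrite big_ord0.
rewrite big_ord_recr /=; apply: (leq_trans (leq_add IH (leqnn _))).
by case: (ltnP j n) => /= h; lia.
Qed.

(** If sg is at most c 2^-l from the index r l on, then the terms with indices between
    r l and r (l + 1) are at most c 2^-l. Cutting after L layers leaves a
    remainder of at most K (c 2^-L)^p, which is at most 1 for large L; this is the summand
    1 of the bound. *)
Lemma layer_sum_le (sg : nat -> R) (r : nat -> nat) (c p C : R) :
  0 < c -> 0 < p -> (forall k, 0 <= sg k) ->
  (forall k l, (k <= l)%N -> sg l <= sg k) ->
  (forall l, sg (r l) <= c * 2^-1 ^+ l) ->
  (forall L, \sum_(l < L) (r l.+1)%:R * (c * 2^-1 ^+ l) `^ p <= C) ->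
  forall K, \sum_(k < K) (sg k) `^ p <= (r 0%N)%:R * (sg 0%N) `^ p + C + 1.
Proof.
move=> c0 p0 sg0 sgni sgr hC K.
have t0 l : 0 <= c * 2^-1 ^+ l by rewrite mulr_ge0 ?(ltW c0)// exprn_ge0.
have mono (x y : R) : 0 <= x -> x <= y -> x `^ p <= y `^ p.
  by move=> x0 xy; apply: ge0_ler_powR => //; rewrite ?nnegrE ?(ltW p0)// (le_trans x0).
have pt L k : (sg k) `^ p <= (k < r 0)%N%:R * (sg 0%N) `^ p +
   \sum_(l < L) (k < r l.+1)%N%:R * (c * 2^-1 ^+ l) `^ p + (c * 2^-1 ^+ L) `^ p.
  elim: L => [|L IH].
    rewrite big_ord0 addr0; case: ltnP => h.
      rewrite mul1r; apply: le_trans (mono _ _ _ (sgni 0%N k _)) _ => //.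
      by rewrite lerDl powR_ge0.
    rewrite mul0r add0r; apply: mono => //; apply: le_trans (sgni _ _ h) _.
    exact: sgr.
  rewrite big_ord_recr /=; case: (ltnP k (r L.+1)) => h.
    rewrite mul1r; apply: le_trans IH _; rewrite -!addrA lerD2l lerD2l.
    by rewrite lerDl powR_ge0.
  apply: le_trans (mono _ _ _ (le_trans (sgni _ _ h) (sgr L.+1))) _ => //.
  rewrite lerDr !addr_ge0 ?mulr_ge0 ?powR_ge0// sumr_ge0// => l _.
  by rewrite mulr_ge0 ?powR_ge0.
have cnt n : \sum_(k < K) (k < n)%N%:R <= n%:R :> R.
  by rewrite -natr_sum ler_nat count_below.
have tot L : \sum_(k < K) (sg k) `^ p <= (r 0%N)%:R * (sg 0%N) `^ p + C +
    K%:R * (c * 2^-1 ^+ L) `^ p.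
  apply: le_trans (@ler_sum R _ (index_enum _) xpredT _ _ (fun (k : 'I_K) _ => pt L k)) _.
  rewrite !big_split /=; apply: lerD; last by rewrite sumr_const card_ord mulr_natl.
  apply: lerD.
    by rewrite -mulr_suml ler_wpM2r ?powR_ge0// cnt.
  rewrite exchange_big /=; apply: le_trans (hC L); apply: ler_sum => l _.
  by rewrite -mulr_suml ler_wpM2r ?powR_ge0// cnt.
have [L hL] : exists L, K%:R * (c * 2^-1 ^+ L) `^ p <= 1.
  have z1 : `|2^-1 `^ p| < 1 :> R.
    rewrite ger0_norm ?powR_ge0// /powR invr_eq0 pnatr_eq0 /= expR_lt1.
    by rewrite pmulr_rlt0// ln_lt0// invr_gt0 ltr0n /= invf_lt1// ltr1n.
  have /cvgr0Pnorm_lt/(_ 1 ltr01)[L _ hL] := cvg_geometric (K%:R * c `^ p) z1.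
  exists L; rewrite powRM ?(ltW c0) ?exprn_ge0// powRX ?invr_ge0// mulrA.
  apply: ltW; apply: le_lt_trans (ler_norm _) _; exact: (hL L (leqnn L)).
by apply: le_trans (tot L) _; rewrite lerD2l.
Qed.

End Summation.

(** * Summable dyadic values give Schatten class operators *)

Section DyadicSchatten.
Variable R : realType.
Variable phi : R -> R.
Hypothesis phi_ge0 : forall x, 0 < x -> 0 <= phi x.
Hypothesis phi_ni : forall x y, 0 < x -> x <= y -> phi y <= phi x.
Local Notation phiC := (fun x => (phi x)%:C).
Local Notation a := (dyadic_val phi).

(** The three conditions of the Schatten class part are all shown to be equivalent to this
    one: the sequence dyadic_val phi is in l^p over the integers. *)
Definition dyadic_summable (p : R) : Prop :=
  exists C : R, forall N, \sum_(n <- zrange N) a n `^ p <= C.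

Variable p : R.
Hypothesis p_gt : 1 / 2 < p.
Hypothesis a_sum : dyadic_summable p.

Let p0 : 0 < p. Proof. by move: p_gt; lra. Qed.

Let a_ge0 n : 0 <= a n. Proof. exact: dyadic_val_ge0. Qed.

Lemma summable_threshold (lam : R) : 0 < lam ->
  exists N, forall n, n \notin zrange N -> a n < lam.
Proof.
move=> lam0; have [C hC] := a_sum.
pose b i := a (Posz i) `^ p + a (Negz i) `^ p.
have bE N : series b N = \sum_(n <- zrange N) a n `^ p.
  elim: N => [|N IH]; first by rewrite /series /= big_geq// /zrange /= big_nil.
  by rewrite zrange_sumS -IH /series /= big_nat_recr.
have cb : cvgn (series b).
  apply: nondecreasing_is_cvgn.
    apply/nondecreasing_seqP => N; rewrite !bE zrange_sumS lerDl.
    by rewrite addr_ge0 ?powR_ge0.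
  by exists C => _ [N _ <-]; rewrite bE.
have lp : 0 < lam `^ p by exact: powR_gt0.
have /cvgr0Pnorm_lt/(_ _ lp)[N _ hN] := cvg_series_cvg_0 cb.
have lt_lam (x : R) : 0 <= x -> x `^ p < lam `^ p -> x < lam.
  move=> x0; apply: contraTlt => lx; rewrite -leNgt.
  by apply: ge0_ler_powR; rewrite ?nnegrE ?(ltW p0) ?(ltW lam0).
exists N => n; rewrite mem_cat negb_or => /andP[h1 h2].
case: n h1 h2 => i h1 h2.
  have Ni : (N <= i)%N.
    by rewrite leqNgt; apply: contra h1 => iN; rewrite map_f// mem_iota.
  apply: lt_lam => //; apply: le_lt_trans (hN i Ni).
  by rewrite ger0_norm /b ?addr_ge0 ?powR_ge0// lerDl powR_ge0.
have Ni : (N <= i)%N.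
  by rewrite leqNgt; apply: contra h2 => iN; rewrite map_f// mem_iota.
apply: lt_lam => //; apply: le_lt_trans (hN i Ni).
by rewrite ger0_norm /b ?addr_ge0 ?powR_ge0// lerDr powR_ge0.
Qed.

Lemma summable_bound : exists2 M : R, 0 < M & forall x, 0 < x -> x * phi x <= M.
Proof.
have [N hN] := summable_threshold ltr01.
pose A := 1 + \sum_(n <- zrange N) a n.
have sum0 : 0 <= \sum_(n <- zrange N) a n by rewrite sumr_ge0.
have aA n : a n <= A.
  have [nN|/hN/ltW h] := boolP (n \in zrange N); last first.
    by apply: le_trans h _; rewrite lerDl.
  apply: ler_wpDl => //; rewrite (big_rem _ nN) /= lerDl sumr_ge0//.
exists (2 * A); first by rewrite mulr_gt0// ltr_pwDl.
move=> x x0; have [n /andP[nx xn]] := dyadic_floor x0.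
have h1 : phi x <= phi (2 ^ n) by apply: phi_ni => //; exact: dyadic_gt0.
have := aA n; rewrite /dyadic_val.
have := phi_ge0 x0; have := phi_ge0 (dyadic_gt0 R n).
nra.
Qed.

(** At scale 2^-l the approximation has rank of order the sum of sqrt(a n 2^l) over the
    n with a n >= 2^-l. Weighting with 2^(-l p) and summing over l first gives a
    geometric series with sum of order a n ^ p for each n, because p > 1/2. *)
Lemma summable_schatten : Q_schatten p phiC.
Proof.
have [M M0 xM] := summable_bound; have [C hC] := a_sum.
have qM := qker_dominated phi_ge0 phi_ni xM.
pose T := intop (qker phi).
have bT : bounded_operator T by exact: intop_bounded M0 qM.
have t0 l : 0 < (2^-1 : R) ^+ l by rewrite exprn_gt0.
have /choice[N hN] : forall l, exists N, forall n, n \notin zrange N ->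
    a n < 2^-1 ^+ l by move=> l; exact: summable_threshold.
pose s l := [seq n <- zrange (N l) | 2^-1 ^+ l <= a n].
have /choice[m hm] : forall l, exists m : nat,
    m%:R <= \sum_(n <- s l) 6 * Num.sqrt (a n / 2^-1 ^+ l) /\
    (singular_number (m + m) T <= (8 * 2^-1 ^+ l)%:E)%E.
  move=> l; have [s1 s2] := threshold_seq (hN l).
  have [m [S [g [psi [mle bS TS gp SE]]]]] :=
    finite_rank_approximation phi_ge0 phi_ni M0 xM (t0 l) s1 s2.
  exists m; split => //; apply: (singular_number_le (S := S)) => //.
  exists (fun j x => (g j x)%:C); split; first by move=> j; case: (gp j).
  move=> f f2; exists (fun j => cRintegral (@Rplus R) (fun y => (psi j y)%:C * f y)).
  by apply/L2eqE; apply: nearW => x; exact: SE.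
pose sg k := fine (singular_number k T).
have sgE k : singular_number k T = (sg k)%:E.
  by rewrite fineK// singular_number_fin.
have [lT _] := bT.
have sg0 k : 0 <= sg k by rewrite -lee_fin -sgE singular_number_ge0.
have sgni k l : (k <= l)%N -> sg l <= sg k.
  by move=> kl; rewrite -lee_fin -!sgE singular_number_ni.
pose q := p - 2^-1; have q0 : 0 < q by rewrite subr_gt0; move: p_gt; lra.
pose rho : R := 2^-1 `^ q.
have rho01 : 0 < rho < 1.
  rewrite powR_gt0//= /rho /powR invr_eq0 pnatr_eq0 /= expR_lt1.
  by rewrite pmulr_rlt0// ln_lt0// invr_gt0 ltr0n /= invf_lt1// ltr1n.
have rhoE l : rho ^+ l = (2^-1 ^+ l) `^ q by rewrite /rho -powRX.
(* The part of scale t = 2^-l in the rank, weighted by t^p, is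
   a^(1/2) t^(p - 1/2): a geometric sequence in l, as p > 1/2. *)
have term l n : 0 < a n ->
    Num.sqrt (a n / 2^-1 ^+ l) * (2^-1 ^+ l) `^ p = a n `^ 2^-1 * rho ^+ l.
  move=> an; rewrite -powR12_sqrt; last by rewrite divr_ge0// ltW.
  rewrite powRM// ?invr_ge0 ?(ltW (t0 l))// -mulrA; congr (_ * _).
  rewrite rhoE /q -[(2^-1 ^+ l)^-1]powR_inv1 ?(ltW (t0 l))// -powRrM -powRD.
    by congr (_ `^ _); ring.
  by rewrite (gt_eqF (t0 l)) implybT.
have swap L : \sum_(l < L) (\sum_(n <- s l) Num.sqrt (a n / 2^-1 ^+ l)) * (2^-1 ^+ l) `^ p
     <= C / (1 - rho).
  pose NN := (\sum_(l < L) N l)%N.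
  apply: (@le_trans _ _ (\sum_(l < L) \sum_(n <- zrange NN)
     if (rho ^+ l <= a n `^ q) && (a n != 0) then a n `^ 2^-1 * rho ^+ l else 0)).
    apply: ler_sum => l _; rewrite mulr_suml /s big_filter.
    have NlNN : (N l <= NN)%N by rewrite /NN (bigD1 l)//= leq_addr.
    apply: (le_trans (@zrange_subset_sum _ (fun n => Num.sqrt (a n / 2^-1 ^+ l) * (2^-1 ^+ l) `^ p)
      (fun n => 2^-1 ^+ l <= a n) _ _ NlNN _)).
      by move=> n; rewrite mulr_ge0 ?sqrtr_ge0 ?powR_ge0.
    rewrite big_mkcond; apply: ler_sum => n _; case: ifPn => h; last first.
      by case: ifP => // _; rewrite mulr_ge0 ?powR_ge0// exprn_ge0// powR_ge0.
    have an : 0 < a n by exact: lt_le_trans h.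
    rewrite term// (gt_eqF an) andbT rhoE ge0_ler_powR ?nnegrE ?(ltW q0)//.
  rewrite exchange_big /=.
  apply: (@le_trans _ _ (\sum_(n <- zrange NN) a n `^ p / (1 - rho))); last first.
    rewrite -mulr_suml ler_pM2r ?invr_gt0 ?subr_gt0//.
    by case/andP: rho01.
  apply: ler_sum => n _; have [an|an] := eqVneq (a n) 0.
    rewrite big1; last by move=> l _; rewrite andbF.
    by rewrite divr_ge0 ?powR_ge0// subr_ge0; case/andP: rho01 => _ /ltW.
  have an0 : 0 < a n by rewrite lt_neqAle eq_sym an a_ge0.
  under eq_bigr do rewrite andbT.
  rewrite -big_mkcond /= -mulr_sumr.
  apply: (@le_trans _ _ (a n `^ 2^-1 * (a n `^ q / (1 - rho)))).
    by rewrite ler_wpM2l ?powR_ge0// geometric_cut ?powR_ge0.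
  rewrite mulrA -powRD; last by rewrite an implybT.
  by rewrite /q addrCA subrr addr0.
exists T; split; last exact: extends_intop.
split=> //.
pose D := 12 * (16 `^ p) * (C / (1 - rho)).
have fin K := @layer_sum_le R sg (fun l => (m l + m l)%N) 8 p D _ p0 sg0 sgni _ _ K.
apply: (@le_lt_trans _ _ (((m 0 + m 0)%N%:R * sg 0%N `^ p + D + 1)%:E)); last exact: ltry.
apply: lime_le.
  by apply: is_cvg_nneseries => k _ _; exact: poweR_ge0.
apply: nearW => K; under eq_bigr do rewrite sgE poweR_EFin.
rewrite sumEFin lee_fin big_mkord; apply: fin.
- by [].
- by move=> l; rewrite -lee_fin -sgE; case: (hm l).
- move=> L; rewrite /D.
  apply: (@le_trans _ _ (12 * 16 `^ p * \sum_(l < L.+1)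
     (\sum_(n <- s l) Num.sqrt (a n / 2^-1 ^+ l)) * (2^-1 ^+ l) `^ p)); last first.
    by apply: ler_wpM2l; [rewrite mulr_ge0 ?powR_ge0|exact: swap].
  rewrite big_ord_recl /= mulrDr; apply: ler_wpDl.
    rewrite !mulr_ge0 ?powR_ge0// sumr_ge0// => n _; exact: sqrtr_ge0.
  rewrite mulr_sumr; apply: ler_sum => l _; rewrite /bump /= add1n.
  have [hml _] := hm l.+1.
  rewrite (_ : 8 * 2^-1 ^+ l = 16 * 2^-1 ^+ l.+1); last by rewrite exprS; field.
  rewrite powRM// ?exprn_ge0// mulrA [leRHS]mulrA ler_wpM2r ?powR_ge0//.
  rewrite [leRHS]mulrAC ler_wpM2r ?powR_ge0// natrD -mulr2n -mulr_natl.
  move: hml; rewrite -mulr_sumr; lra.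
Qed.

End DyadicSchatten.

(** * Test functions of mean zero *)

Section LowerBound.
Variable R : realType.
Local Notation mu := (@lebesgue_measure R).
Local Notation Rp := (@Rplus R).
Implicit Types (T S : (R -> R[i]) -> R -> R[i]).
Variable phi : R -> R.
Hypothesis phi_ge0 : forall x, 0 < x -> 0 <= phi x.
Hypothesis phi_ni : forall x y, 0 < x -> x <= y -> phi y <= phi x.
Local Notation phiC := (fun x => (phi x)%:C).

Lemma L2eq_sum n (c : 'I_n -> R[i]) (F G : 'I_n -> R -> R[i]) :
  (forall j, L2eq (F j) (G j)) ->
  L2eq (fun x => \sum_(j < n) c j * F j x) (fun x => \sum_(j < n) c j * G j x).
Proof.
elim: n c F G => [|n IH] c F G FG.
  rewrite (_ : (fun x => _) = (fun x => \sum_(j < 0) c j * G j x)); first exact: L2eq_refl.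
  by apply/funext => x; rewrite !big_ord0.
rewrite (_ : (fun x => \sum_(j < n.+1) c j * F j x) =
  (fun x => c ord0 * F ord0 x + \sum_(j < n) c (lift ord0 j) * F (lift ord0 j) x)); last first.
  by apply/funext => x; rewrite big_ord_recl.
rewrite (_ : (fun x => \sum_(j < n.+1) c j * G j x) =
  (fun x => c ord0 * G ord0 x + \sum_(j < n) c (lift ord0 j) * G (lift ord0 j) x)); last first.
  by apply/funext => x; rewrite big_ord_recl.
by apply: L2eq_lin => //; exact: IH.
Qed.

(** Linear dependence of k + 1 coefficient vectors in a space of dimension k. *)
Lemma rank_le_kernel S k (F : 'I_k.+1 -> R -> R[i]) : linear_operator S ->
  rank_le k S -> (forall j, L2 (F j)) ->
  exists2 v : 'I_k.+1 -> R[i], (exists j, v j != 0) &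
    L2eq (S (fun x => \sum_(j < k.+1) v j * F j x)) (fun=> 0).
Proof.
move=> lS [g [g2 gS]] F2.
have /choice[C hC] : forall j, exists c : 'I_k -> R[i],
    L2eq (S (F j)) (fun x => \sum_(i < k) c i * g i x) by move=> j; exact: gS.
pose M : 'M[R[i]]_(k.+1, k) := \matrix_(j, i) C j i.
have kM : kermx M != 0.
  rewrite kermx_eq0 /row_free neq_ltn; apply/orP; left.
  by rewrite ltnS rank_leq_col.
have [v vM v0] := rowV0Pn kM.
have {}vM : v *m M = 0 by exact/sub_kermxP.
exists (fun j => v 0 j).
  by have /rV0Pn[j vj] := v0; exists j.
apply: L2eq_trans (linear_operator_sum _ lS F2) _.
apply: L2eq_trans (L2eq_sum _ hC) _.
rewrite (_ : (fun x => _) = (fun=> 0)); first exact: L2eq_refl.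
apply/funext => x; under eq_bigr do rewrite mulr_sumr.
rewrite exchange_big /= big1// => i _.
under eq_bigr do rewrite mulrA.
rewrite -mulr_suml.
have := congr1 (fun A : 'rV_k => A 0 i) vM; rewrite !mxE.
under eq_bigr do rewrite mxE.
by move=> ->; rewrite mul0r.
Qed.

Definition lset (n : int) : set R := `[2 ^ n / 2, 2 ^ n]%classic.
Definition rset (n : int) : set R := `[2 * 2 ^ n, 2 * 2 ^ n + 2 ^ n / 2]%classic.
Definition hull (n : int) : set R := `[2 ^ n / 2, 2 * 2 ^ n + 2 ^ n / 2]%classic.

(** Difference of the indicators of two intervals of equal length. Its mean is zero, so
    its image vanishes above its support and is constant below it, and the images of
    test functions at different scales interact only through constants; see
    [qtest_above] and [qtest_below]. *)
Definition test (n : int) (y : R) : R[i] := -1 * step (rset n) y + step (lset n) y.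

(** The decrease of the kernel across one dyadic interval is what mean-zero test
    functions detect; the dyadic values are recovered from it in [schatten_summable]. *)
Definition dyadic_drop (n : int) : R := 2 ^ n * (phi (2 ^ n) - phi (2 * 2 ^ n)).

Lemma dyadic_drop_ge0 n : 0 <= dyadic_drop n.
Proof.
have d0 := dyadic_gt0 R n.
by rewrite mulr_ge0 ?(ltW d0)// subr_ge0 phi_ni//; lra.
Qed.

Lemma test_L2 n : L2 (test n).
Proof.
have d0 := dyadic_gt0 R n.
by apply: L2D; [apply: L2Z|]; apply: L2_step; lra.
Qed.

Lemma test_bcs n : bounded_compact_support (test n).
Proof.
have d0 := dyadic_gt0 R n.
split; first by case/L2P : (test_L2 n).
  exists 2 => x _; rewrite /test /step !indicE.
  have e (b1 b2 : bool) : -1 * (b1%:R : R)%:C + (b2%:R : R)%:C = (b2%:R - b1%:R : R)%:C.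
    by rewrite mulN1r addrC rmorphB.
  rewrite e normc_real; do 2 case: (_ \in _); rewrite ?subrr ?subr0 ?sub0r ?normrN ?normr0 ?normr1//;
    lra.
exists (2 ^ n / 2), (2 * 2 ^ n + 2 ^ n / 2); split; first by lra.
move=> x x0; rewrite /test /step !indicE.
have [xr _|_] := boolP (x \in rset n).
  by move: xr; rewrite inE /rset /= in_itv /= => /andP[]; lra.
have [xl _|_] := boolP (x \in lset n).
  by move: xl; rewrite inE /lset /= in_itv /= => /andP[]; lra.
by rewrite mulr0 addr0 eqxx.
Qed.

Definition qtest (n : int) (x : R) : R :=
  \int[mu]_(y in lset n) qker phi x y - \int[mu]_(y in rset n) qker phi x y.

Variable M : R.
Hypothesis M0 : 0 < M.
Hypothesis xM : forall x, 0 < x -> x * phi x <= M.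

Lemma intop_test n x : 0 < x -> intop (qker phi) (test n) x = (qtest n x)%:C.
Proof.
move=> x0; have d0 := dyadic_gt0 R n.
have qM := qker_dominated phi_ge0 phi_ni xM.
rewrite (intop_lin _ qM _ _ x0).
- rewrite !intop_step; try (apply: itv_sub_Rplus; lra).
  by rewrite mulN1r addrC -rmorphB.
- by apply: L2_step; lra.
- by apply: L2_step; lra.
Qed.

Lemma Rintegral_itv_cst (a b c : R) : a < b -> \int[mu]_(y in `[a, b]) c = c * (b - a).
Proof. by move=> ab; rewrite Rintegral_cst//= measure_itv. Qed.

Lemma qtest_above n x : 2 * 2 ^ n + 2 ^ n / 2 <= x -> qtest n x = 0.
Proof.
move=> nx; have d0 := dyadic_gt0 R n.
have h (b c : R) : b < c -> c <= x -> \int[mu]_(y in `[b, c]) qker phi x y = phi x * (c - b).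
  move=> bc cx; rewrite -Rintegral_itv_cst//; apply: eq_Rintegral => y.
  rewrite inE /= in_itv /= => /andP[_ yc]; rewrite /qker max_l//.
  exact: le_trans yc cx.
rewrite /qtest !h; try lra.
Qed.

Lemma qtest_below n x : x <= 2 ^ n / 2 ->
  qtest n x = \int[mu]_(y in lset n) phi y - \int[mu]_(y in rset n) phi y.
Proof.
move=> xn; have d0 := dyadic_gt0 R n.
congr (_ - _); apply: eq_Rintegral => y; rewrite inE /lset /rset /= in_itv /= => /andP[ny _];
  by rewrite /qker max_r//; lra.
Qed.

Lemma phi_itv_integrable (b c : R) : 0 < b -> b < c ->
  mu.-integrable `[b, c] (fun y => (phi y)%:E).
Proof.
move=> b0 bc; apply: (itv_integrable (c := phi b)) => //.
  exact: measurable_phi.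
move=> y /andP[bly _]; rewrite ger0_norm ?phi_ge0 ?phi_ni//.
exact: lt_le_trans bly.
Qed.

Lemma qtest_lset n x : lset n x ->
  2 ^ n / 2 * phi (2 ^ n) - \int[mu]_(y in rset n) phi y <= qtest n x.
Proof.
rewrite /lset /= in_itv /= => /andP[nx xn]; have d0 := dyadic_gt0 R n.
have x0 : 0 < x by lra.
apply: lerB.
  have e : 2 ^ n - 2 ^ n / 2 = 2 ^ n / 2 :> R by lra.
  rewrite mulrC -[X in _ * X]e; apply: Rintegral_itv_ge; try lra.
    by apply: qker_integrable => //; lra.
  move=> y /andP[ny yn]; apply: phi_ni; first exact: max_gt0.
  by rewrite ge_max xn.
rewrite le_eqVlt; apply/orP; left; apply/eqP; apply: eq_Rintegral => y.
by rewrite inE /lset /rset /= in_itv /= => /andP[ny _]; rewrite /qker max_r//; lra.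
Qed.

(** Here phi(max(x,y)) >= phi(x) + phi(y) - phi(left end) by monotonicity. *)
Lemma qtest_rset n x : rset n x ->
  qtest n x <= 2 ^ n / 2 * phi (2 * 2 ^ n) - \int[mu]_(y in rset n) phi y.
Proof.
rewrite /rset /= in_itv /= => /andP[nx xn]; have d0 := dyadic_gt0 R n.
have x0 : 0 < x by lra.
have e : 2 * 2 ^ n + 2 ^ n / 2 - 2 * 2 ^ n = 2 ^ n / 2 :> R by lra.
have hl : \int[mu]_(y in lset n) qker phi x y = phi x * (2 ^ n / 2).
  rewrite [RHS](_ : _ = phi x * (2 ^ n - 2 ^ n / 2)); last by congr (_ * _); lra.
  rewrite -Rintegral_itv_cst; last by lra.
  apply: eq_Rintegral => y; rewrite inE /lset /rset /= in_itv /= => /andP[_ yn].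
  by rewrite /qker max_l//; lra.
have b0 : 0 < 2 * 2 ^ n :> R by lra.
have bc : 2 * 2 ^ n < 2 * 2 ^ n + 2 ^ n / 2 :> R by lra.
have ic : mu.-integrable (rset n) (fun y => (phi x - phi (2 * 2 ^ n))%:E).
  by apply: (itv_integrable (c := `|phi x - phi (2 * 2 ^ n)|)) => //; exact: measurable_cst.
have ip : mu.-integrable (rset n) (fun y => (phi y)%:E) by exact: phi_itv_integrable.
have mr : measurable (rset n) by exact: measurable_itv.
have hr : (phi x - phi (2 * 2 ^ n)) * (2 ^ n / 2) + \int[mu]_(y in rset n) phi y <=
    \int[mu]_(y in rset n) qker phi x y.
  rewrite -[X in _ * X]e -Rintegral_itv_cst// -RintegralD//.
  apply: le_Rintegral => //.
  - exact: integrable_add.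
  - exact: qker_integrable.
  - move=> y; rewrite /rset /= in_itv /= => /andP[ny yn].
    have y0 : 0 < y by lra.
    rewrite qkerE// le_min; apply/andP; split.
      have : phi y <= phi (2 * 2 ^ n) by exact: phi_ni.
      by lra.
    have : phi x <= phi (2 * 2 ^ n) by exact: phi_ni.
    by lra.
rewrite /qtest hl; lra.
Qed.

(** The values of u on the two sets differ by at least r (al - be), so on one of them
    |u| is at least half of that, whatever the constant K. *)
Lemma separation_energy (n : int) (u q : R -> R) (r K al be : R) :
  measurable_fun Rp u -> be <= al ->
  (forall x, lset n x -> al <= q x) -> (forall x, rset n x -> q x <= be) ->
  (forall x, lset n x \/ rset n x -> u x = r * q x + K) ->
  ((2 ^ n / 2 * (r * (al - be) / 2) ^+ 2)%:E <=
    \int[mu]_(x in hull n) ((u x) ^+ 2)%:E)%E.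
Proof.
wlog r0 : u r K / 0 <= r => [th|].
  have [r0|r0] := leP 0 r; first exact: th.
  move=> mu_ ab ql qr uE.
  have := th (fun x => - u x) (- r) (- K) _ _ ab ql qr.
  rewrite oppr_ge0 mulNr mulNr sqrrN; under eq_integral do rewrite sqrrN.
  apply; first exact: ltW.
    exact: measurable_funN.
  by move=> x /uE ->; rewrite mulNr opprD.
move=> mu_ ab ql qr uE; have d0 := dyadic_gt0 R n.
set d := r * (al - be) / 2.
have dd0 : 0 <= d by rewrite /d !mulr_ge0// subr_ge0.
have h0 : 0 < 2 ^ n / 2 :> R by lra.
have mh : measurable_fun (hull n) (fun x => ((u x) ^+ 2)%:E).
  exact: (measurable_funS (@measurable_Rplus R) (itv_sub_Rplus h0) (measurable_sqrE mu_)).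
have mhull : measurable (hull n) by exact: measurable_itv.
have key (b c : R) : b < c -> c - b = 2 ^ n / 2 -> `[b, c]%classic `<=` hull n ->
    (forall x, b <= x <= c -> d ^+ 2 <= u x ^+ 2) ->
    ((2 ^ n / 2 * d ^+ 2)%:E <= \int[mu]_(x in hull n) ((u x) ^+ 2)%:E)%E.
  move=> bc cb sub ud.
  apply: (@le_trans _ _ (\int[mu]_(x in `[b, c]) ((u x) ^+ 2)%:E)%E).
    rewrite -[X in (X%:E <= _)%E]mulrC -cb EFinM -(measure_itv bc) -integral_cst//.
    apply: ge0_le_integral => //.
    - by move=> x _; rewrite lee_fin sqr_ge0.
    exact: (measurable_funS mhull sub mh).
  by apply: ge0_subset_integral => //; move=> x _; rewrite lee_fin sqr_ge0.
(* The sign of r q + K at the midpoint (al + be) / 2 of the gap tells on which of the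
   two sets u stays away from 0. *)
have [s0|s0] := leP 0 (r * (al + be) / 2 + K).
  apply: (key (2 ^ n / 2) (2 ^ n)); try lra.
    by move=> x; rewrite /hull /= !in_itv /= => /andP[]; lra.
  move=> x xl; have xl' : lset n x by rewrite /lset /= in_itv.
  rewrite uE; last by left.
  have h := ler_wpM2l r0 (ql x xl').
  have du : d <= r * q x + K by rewrite /d; lra.
  by rewrite lerXn2r ?nnegrE// (le_trans dd0).
apply: (key (2 * 2 ^ n) (2 * 2 ^ n + 2 ^ n / 2)); try lra.
  by move=> x; rewrite /hull /= !in_itv /= => /andP[]; lra.
move=> x xr; have xr' : rset n x by rewrite /rset /= in_itv.
rewrite uE; last by right.
have h := ler_wpM2l r0 (qr x xr').
have du : d <= - (r * q x + K) by rewrite /d; lra.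
by rewrite -[leRHS]sqrrN lerXn2r ?nnegrE// (le_trans dd0).
Qed.

End LowerBound.

(** * Lower bounds for singular numbers *)

Section SingularLower.
Variable R : realType.
Local Notation mu := (@lebesgue_measure R).
Local Notation Rp := (@Rplus R).
Implicit Types (T S : (R -> R[i]) -> R -> R[i]).

Lemma dyadic_gap (n m : int) : n + 3 <= m -> 8 * 2 ^ n <= (2 : R) ^ m.
Proof.
move=> nm; have [k kE] : exists k : nat, m = n + 3 + k%:Z.
  exists (absz (m - (n + 3))%R); rewrite gez0_abs; first by rewrite addrC subrK.
  by rewrite subr_ge0.
rewrite kE !expfzDr ?pnatr_eq0// -exprnP -mulrA mulrC ler_pM2l ?dyadic_gt0//.
rewrite (_ : (2 : R) ^ 1 * (2 ^ 1 * 2 ^ 1) = 8); last by rewrite expr1z; ring.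
by rewrite ler_peMr// exprn_ege1// ler1n.
Qed.

Lemma hull_disjoint (n m : int) : n + 3 <= m -> @hull R n `&` @hull R m = set0.
Proof.
move=> /dyadic_gap nm; have d0 := dyadic_gt0 R n.
apply/seteqP; split=> // x []; rewrite /hull /= !in_itv /=.
by move=> /andP[_ h1] /andP[h2 _]; lra.
Qed.

Lemma hull_sub (n : int) : @hull R n `<=` Rp.
Proof. by apply: itv_sub_Rplus; have := dyadic_gt0 R n; lra. Qed.

Lemma lset_hull (n : int) x : lset n x -> @hull R n x.
Proof.
rewrite /lset /hull /= !in_itv /=; have := dyadic_gt0 R n.
by move=> d0 /andP[]; lra.
Qed.

Lemma rset_hull (n : int) x : rset n x -> @hull R n x.
Proof.
rewrite /rset /hull /= !in_itv /=; have := dyadic_gt0 R n.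
by move=> d0 /andP[]; lra.
Qed.

Lemma test_out (n : int) y : ~ @hull R n y -> test n y = 0.
Proof.
move=> ny; rewrite /test /step !indicE.
rewrite (memNset (contra_not (@rset_hull n y) ny)).
by rewrite (memNset (contra_not (@lset_hull n y) ny)) mulr0 addr0.
Qed.

Lemma energy_test (n : int) : (energy (@test R n) <= (2 * 2 ^ n)%:E)%E.
Proof.
have d0 := dyadic_gt0 R n.
have ml : cmeasurable (step (@lset R n)) by apply: cmeasurable_step; exact: measurable_itv.
have mr : cmeasurable (step (@rset R n)) by apply: cmeasurable_step; exact: measurable_itv.
apply: le_trans (energyD (cmeasurableZ _ mr) ml) _.
rewrite energyZ//.
rewrite sqr_normc /= oppr0 expr0n addr0 sqrrN expr1n mul1e.
have el : energy (step (@lset R n)) = (2 ^ n / 2)%:E.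
  by rewrite energy_step; [congr _%:E; lra|lra|lra].
have er : energy (step (@rset R n)) = (2 ^ n / 2)%:E.
  by rewrite energy_step; [congr _%:E; lra|lra|lra].
rewrite el er.
by rewrite -!EFinM -EFinD lee_fin; lra.
Qed.

Section Family.
Variables (k : nat) (js : 'I_k -> int).
Hypothesis sep : forall i j, i != j -> js i + 3 <= js j \/ js j + 3 <= js i.

Lemma hulls_trivIset (D : set 'I_k) : trivIset D (fun j => @hull R (js j)).
Proof.
apply/trivIsetP => i j _ _ /sep[] h; first exact: hull_disjoint.
by rewrite setIC hull_disjoint.
Qed.

Lemma energy_tests (v : 'I_k -> R[i]) :
  (energy (fun x => (\sum_j v j * test (js j) x)%R) <=
   (\sum_j Normc.normc (v j) ^+ 2 * (2 * 2 ^ (js j)))%:E)%E.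
Proof.
have mt j : cmeasurable (@test R (js j)) by case/L2P : (test_L2 R (js j)).
apply: (@le_trans _ _ (\int[mu]_(x in Rp)
   (\sum_j ((Normc.normc (v j) ^+ 2)%:E * (Normc.normc (test (js j) x) ^+ 2)%:E))%E)%E).
  apply: ge0_le_integral => //.
  - exact: measurable_Rplus.
  - by move=> x _; rewrite lee_fin sqr_ge0.
  - by apply: measurable_sqr_normc; apply: cmeasurable_sum => j; exact: cmeasurableZ.
  - apply: emeasurable_sum => j; apply: measurable_funeM.
    exact: measurable_sqr_normc.
  - move=> x _; rewrite (eq_bigr (fun j =>
      (Normc.normc (v j) ^+ 2 * Normc.normc (test (js j) x) ^+ 2)%:E))// sumEFin lee_fin.
    have t0 j : 0 <= Normc.normc (v j) ^+ 2 * Normc.normc (test (js j) x) ^+ 2.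
      by rewrite mulr_ge0// sqr_ge0.
    have [[j hj]|no] := pselect (exists j, @hull R (js j) x); last first.
      rewrite big1; last first.
        by move=> j _; rewrite test_out ?mulr0// => hj; apply: no; exists j.
      by rewrite Normc.normc0 expr0n sumr_ge0.
    rewrite (bigD1 j)//= big1; last first.
      move=> i ij; rewrite test_out ?mulr0// => hi.
      have /trivIsetP/(_ i j I I ij) ji0 := @hulls_trivIset [set: 'I_k].
      by have : (@hull R (js i) `&` @hull R (js j)) x by []; rewrite ji0.
    rewrite addr0 Normc.normcM exprMn (bigD1 j)//= lerDl sumr_ge0//.
rewrite ge0_integral_sum//; last 3 first.
- exact: measurable_Rplus.
- by move=> j; apply: measurable_funeM; exact: measurable_sqr_normc.
- by move=> j x _; rewrite -EFinM lee_fin mulr_ge0// sqr_ge0.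
rewrite -sumEFin; apply: lee_sum => j _.
rewrite ge0_integralZl_EFin ?sqr_ge0//; last 3 first.
- exact: measurable_Rplus.
- by move=> x _; rewrite lee_fin sqr_ge0.
- exact: measurable_sqr_normc.
rewrite [leRHS]EFinM -/(energy (test (js j))).
by apply: lee_wpmul2l; [rewrite lee_fin sqr_ge0|exact: energy_test].
Qed.

End Family.

Variable phi : R -> R.
Hypothesis phi_ge0 : forall x, 0 < x -> 0 <= phi x.
Hypothesis phi_ni : forall x y, 0 < x -> x <= y -> phi y <= phi x.
Local Notation phiC := (fun x => (phi x)%:C).
Variable M : R.
Hypothesis M0 : 0 < M.
Hypothesis xM : forall x, 0 < x -> x * phi x <= M.

Lemma measurable_qtest n : measurable_fun Rp (qtest phi n).
Proof.
have [mr _] : cmeasurable (intop (qker phi) (test n)).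
  by apply: cmeasurable_intop; [exact: measurable_qker|case/L2P : (test_L2 R n)].
apply: eq_measurable_fun mr => x; rewrite inE => /RplusE x0.
by rewrite (intop_test phi_ge0 phi_ni xM n x0).
Qed.

(** On one hull the image of a combination of test functions is a multiple of
    one [qtest] plus a constant, and the two bounds for that [qtest] differ by half the drop. *)
Lemma local_energy_lower k (js : 'I_k -> int) (r : 'I_k -> R) (j : 'I_k) :
  (forall i j, i != j -> js i + 3 <= js j \/ js j + 3 <= js i) ->
  ((2 ^ js j / 2 * (r j * (dyadic_drop phi (js j) / 2) / 2) ^+ 2)%:E <=
   \int[mu]_(x in @hull R (js j)) ((\sum_i r i * qtest phi (js i) x) ^+ 2)%:E)%E.
Proof.
move=> sep.
(* A test function lying below this hull does not contribute, one lying above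
   contributes a constant. *)
pose cst i := if js i + 3 <= js j then 0 else
  \int[mu]_(y in lset (js i)) phi y - \int[mu]_(y in rset (js i)) phi y.
pose K := \sum_(i | i != j) r i * cst i.
pose I0 := \int[mu]_(y in rset (js j)) phi y.
pose al := 2 ^ js j / 2 * phi (2 ^ js j) - I0.
pose be := 2 ^ js j / 2 * phi (2 * 2 ^ js j) - I0.
have d0 := dyadic_gt0 R (js j).
have ab : al - be = dyadic_drop phi (js j) / 2 by rewrite /al /be /dyadic_drop; ring.
rewrite -ab; apply: (@separation_energy _ _ _ (qtest phi (js j)) _ K).
- apply: measurable_sum => i; apply: measurable_funM; first exact: measurable_cst.
  exact: measurable_qtest.
- by rewrite -subr_ge0 ab divr_ge0// dyadic_drop_ge0.
- by move=> x; exact: qtest_lset.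
- by move=> x; exact: qtest_rset.
- move=> x hx; have {hx} : @hull R (js j) x.
    by case: hx => [/lset_hull|/rset_hull].
  rewrite /hull /= in_itv /= => /andP[xl xr].
  rewrite (bigD1 j)//=; congr (_ + _); apply: eq_bigr => i ij; congr (_ * _).
  rewrite /cst; case: ifPn => [/dyadic_gap h|h].
    by rewrite (qtest_above phi)//; have := dyadic_gt0 R (js i); lra.
  have [h'|/dyadic_gap h'] := sep i j ij; first by rewrite h' in h.
  by rewrite (qtest_below phi)//; lra.
Qed.

(** An operator of rank k kills a nontrivial combination f of k + 1 test functions.
    On the j-th hull the image of f under T has energy at least
    |v_j|^2 2^n (drop / 8)^2 2, whereas f itself has energy at most the sum of the
    |v_j|^2 2^n 2. The lower bounds hold separately for the real and the imaginary part
    because the functions [qtest] are real. *)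
Lemma singular_number_ge T k (js : 'I_k.+1 -> int) (kap : R) :
  bounded_operator T -> extends_Q phiC T -> 0 <= kap ->
  (forall i j, i != j -> js i + 3 <= js j \/ js j + 3 <= js i) ->
  (forall i, kap <= dyadic_drop phi (js i) / 8) ->
  (kap%:E <= singular_number k T)%E.
Proof.
move=> [lT _] TQ kap0 sep kd; apply: le_ereal_inf_tmp => _ [S [[lS _] rS] <-].
have t2 j : L2 (@test R (js j)) by exact: test_L2.
have [v [j0 vj0] Sv] := rank_le_kernel lS rS t2.
pose f x := \sum_j v j * test (js j) x.
pose V x := \sum_j v j * intop (qker phi) (test (js j)) x.
have f2 : L2 f by apply: L2_sum => j; exact: L2Z.
pose e := \sum_j Normc.normc (v j) ^+ 2 * (2 * 2 ^ (js j)).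
have term0 j : 0 <= Normc.normc (v j) ^+ 2 * (2 * 2 ^ (js j)).
  by rewrite mulr_ge0 ?sqr_ge0// mulr_ge0// ltW// dyadic_gt0.
have e0 : 0 < e.
  rewrite /e (bigD1 j0)//=; apply: ltr_pwDl; last by rewrite sumr_ge0.
  rewrite mulr_gt0//; last by rewrite mulr_gt0// dyadic_gt0.
  rewrite lt_neqAle sqr_ge0 andbT eq_sym sqrf_eq0.
  by apply: contra vj0 => /eqP/Normc.eq0_normc ->.
have lB := linear_operatorB lT lS.
apply: (opnorm_ge lB kap0 f2 e0); first exact: energy_tests.
have mV : cmeasurable V.
  apply: cmeasurable_sum => j; apply: cmeasurableZ; apply: cmeasurable_intop.
    exact: measurable_qker.
  by case/L2P : (t2 j).
have TV : L2eq (fun x => T f x - S f x) V.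
  apply: L2eq_trans (L2eqB (linear_operator_sum v lT t2) Sv) _.
  rewrite (_ : (fun x => _ - 0) = (fun x => \sum_j v j * T (test (js j)) x)); last first.
    by apply/funext => x; rewrite subr0.
  by apply: L2eq_sum => j; exact: TQ (test_bcs R (js j)).
have mTS : cmeasurable (fun x => T f x - S f x).
  by have [L _ _] := lB; case/L2P : (L _ f2).
rewrite (L2eq_energy mTS mV TV).
have mh j : measurable (@hull R (js j)) by exact: measurable_itv.
have loc := sum_local_le (index_enum_uniq _) mh (fun j => @hull_sub (js j))
  (hulls_trivIset sep (D := _)) (measurable_sqr_normc mV).
apply: le_trans (loc _); last by move=> x _; rewrite lee_fin sqr_ge0.
rewrite /e mulr_sumr -sumEFin; apply: lee_sum => j _.
have mRe : measurable_fun (@hull R (js j)) (fun x => (complex.Re (V x) ^+ 2)%:E).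
  apply: (measurable_funS (@measurable_Rplus R) (@hull_sub (js j))).
  by apply: measurable_sqrE; case: mV.
have mIm : measurable_fun (@hull R (js j)) (fun x => (complex.Im (V x) ^+ 2)%:E).
  apply: (measurable_funS (@measurable_Rplus R) (@hull_sub (js j))).
  by apply: measurable_sqrE; case: mV.
have -> : (\int[mu]_(x in @hull R (js j)) (Normc.normc (V x) ^+ 2)%:E =
   \int[mu]_(x in @hull R (js j)) (complex.Re (V x) ^+ 2)%:E +
   \int[mu]_(x in @hull R (js j)) (complex.Im (V x) ^+ 2)%:E)%E.
  rewrite -ge0_integralD; first last.
  - exact: mIm.
  - by move=> x _; rewrite lee_fin sqr_ge0.
  - exact: mRe.
  - by move=> x _; rewrite lee_fin sqr_ge0.
  - exact: mh.
  by apply: eq_integral => x _; rewrite sqr_normc EFinD.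
have ReV : (\int[mu]_(x in @hull R (js j)) (complex.Re (V x) ^+ 2)%:E =
   \int[mu]_(x in @hull R (js j)) ((\sum_i complex.Re (v i) * qtest phi (js i) x) ^+ 2)%:E)%E.
  apply: eq_integral => x; rewrite inE => /hull_sub/RplusE x0.
  rewrite /V raddf_sum; congr (_ ^+ 2)%:E; apply: eq_bigr => i _.
  rewrite (intop_test phi_ge0 phi_ni xM _ x0); case: (v i) => p q /=; ring.
have ImV : (\int[mu]_(x in @hull R (js j)) (complex.Im (V x) ^+ 2)%:E =
   \int[mu]_(x in @hull R (js j)) ((\sum_i complex.Im (v i) * qtest phi (js i) x) ^+ 2)%:E)%E.
  apply: eq_integral => x; rewrite inE => /hull_sub/RplusE x0.
  rewrite /V raddf_sum; congr (_ ^+ 2)%:E; apply: eq_bigr => i _.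
  rewrite (intop_test phi_ge0 phi_ni xM _ x0); case: (v i) => p q /=; ring.
rewrite ReV ImV.
apply: le_trans (leeD (local_energy_lower (fun i => complex.Re (v i)) j sep)
  (local_energy_lower (fun i => complex.Im (v i)) j sep)).
rewrite -EFinD lee_fin sqr_normc.
have d0 := dyadic_gt0 R (js j).
set D := 2 ^ js j in d0 *; have := kd j; set h := dyadic_drop phi (js j) => kh.
have kh2 : kap ^+ 2 <= (h / 8) ^+ 2 by rewrite lerXn2r ?nnegrE// (le_trans kap0).
set a := complex.Re (v j); set b := complex.Im (v j).
have -> : D / 2 * (a * (h / 2) / 2) ^+ 2 + D / 2 * (b * (h / 2) / 2) ^+ 2 =
   (h / 8) ^+ 2 * ((a ^+ 2 + b ^+ 2) * (2 * D)) by field.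
by rewrite ler_wpM2r// mulr_ge0 ?addr_ge0 ?sqr_ge0// mulr_ge0// ltW.
Qed.

End SingularLower.

(** * Schatten class operators have summable dyadic values *)

Section SchattenDyadic.
Variable R : realType.
Implicit Types (T S : (R -> R[i]) -> R -> R[i]).

Lemma zrange_uniq N : uniq (zrange N).
Proof.
rewrite cat_uniq !map_inj_uniq ?iota_uniq//=; last 2 first.
- by move=> i j [].
- by move=> i j [].
by rewrite andbT; apply/hasP => -[_ /mapP[i _ ->]] /mapP[].
Qed.

Lemma zrange_shift (F : int -> R) N :
  \sum_(n <- zrange N) F (n + 1) + F (- N%:Z) = \sum_(n <- zrange N) F n + F N%:Z.
Proof.
elim: N => [|N IH]; first by rewrite !big_nil oppr0.
rewrite !zrange_sumS !NegzE.
have -> : N%:Z + 1 = N.+1%:Z by rewrite -addn1 PoszD.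
have -> : - N.+1%:Z + 1 = - N%:Z by rewrite -addn1 PoszD opprD addrNK.
lra.
Qed.

Variable phi : R -> R.
Hypothesis phi_ge0 : forall x, 0 < x -> 0 <= phi x.
Hypothesis phi_ni : forall x y, 0 < x -> x <= y -> phi y <= phi x.
Local Notation phiC := (fun x => (phi x)%:C).
Local Notation a := (dyadic_val phi).
Variable p : R.
Hypothesis p0 : 0 < p.

Lemma dyadic_drop_sum_le T M (s : seq int) : bounded_operator T -> extends_Q phiC T ->
  (forall x, 0 < x -> x * phi x <= M) -> uniq s ->
  (forall n m, n \in s -> m \in s -> n != m -> n + 3 <= m \/ m + 3 <= n) ->
  \sum_(n <- s) (dyadic_drop phi n / 8) `^ p <=
  \sum_(k < size s) (fine (singular_number k T)) `^ p.
Proof.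
move=> bT TQ xM us sep.
(* In decreasing order the first k + 1 drops are at least the k-th one. *)
pose r := fun n m => dyadic_drop phi m <= dyadic_drop phi n.
have rtot : total r by move=> n m; exact: le_total.
have rtr : transitive r by move=> n m q h1 h2; exact: le_trans h1.
rewrite -(perm_big _ (permEl (perm_sort r s))) /= -(size_sort r).
set s' := sort r s; have us' : uniq s' by rewrite sort_uniq.
rewrite (big_nth 0) big_mkord; apply: ler_sum => k _.
have k0 : 0 <= dyadic_drop phi (nth 0 s' k) / 8 by rewrite divr_ge0// (dyadic_drop_ge0 phi_ni).
have h : ((dyadic_drop phi (nth 0 s' k) / 8)%:E <= singular_number k T)%E.
  have ik (i : 'I_k.+1) : (i < size s')%N.
    by apply: leq_ltn_trans (ltn_ord k); rewrite -ltnS.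
  apply: (singular_number_ge phi_ge0 phi_ni xM (js := fun i : 'I_k.+1 => nth 0 s' i)) => //.
    move=> i j ij; have ms (l : 'I_k.+1) : nth 0 s' l \in s.
      by rewrite -(mem_sort r) -/s' mem_nth.
    by apply: (sep _ _ (ms i) (ms j)); rewrite nth_uniq.
  move=> i; rewrite ler_pM2r//.
  apply: (sorted_leq_nth rtr) => //; rewrite ?inE ?ik//.
  - by move=> n; exact: lexx.
  - exact: sort_sorted.
  - by rewrite -ltnS.
have fk : singular_number k T \is a fin_num by exact: singular_number_fin.
rewrite -(fineK fk) lee_fin in h.
by apply: ge0_ler_powR; rewrite ?nnegrE ?(ltW p0)// (le_trans k0).
Qed.

Lemma schatten_dyadic_drop T M : schatten p T -> extends_Q phiC T ->
  (forall x, 0 < x -> x * phi x <= M) ->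
  exists D, forall N, \sum_(n <- zrange N) dyadic_drop phi n `^ p <= D.
Proof.
move=> [bT sT] TQ xM; have [lT _] := bT.
pose sg k := fine (singular_number k T).
have sgE k : singular_number k T = (sg k)%:E by rewrite fineK// singular_number_fin.
set S := (\sum_(0 <= n <oo) _)%E in sT.
have S0 : (0 <= S)%E by apply: nneseries_ge0 => n _ _; exact: poweR_ge0.
have SE : S = (fine S)%:E by rewrite fineK// ge0_fin_numE.
have sumS K : \sum_(k < K) sg k `^ p <= fine S.
  rewrite -lee_fin -SE -sumEFin.
  apply: le_trans (nneseries_lim_ge (u_ := fun n => ((singular_number n T) `^ p)%E)
    (P := xpredT) (m := 0%N) K _); last by move=> n _ _; exact: poweR_ge0.
  by rewrite big_mkord; apply: lee_sum => k _; rewrite sgE poweR_EFin.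
exists (8 `^ p * (3 * fine S)) => N.
pose F n := (dyadic_drop phi n / 8) `^ p.
have F0 n : 0 <= F n by exact: powR_ge0.
have drE n : dyadic_drop phi n `^ p = 8 `^ p * F n.
  rewrite -powRM// ?divr_ge0 ?(dyadic_drop_ge0 phi_ni)//.
  by congr (_ `^ p); rewrite mulrC divfK.
under eq_bigr do rewrite drE.
rewrite -mulr_sumr ler_wpM2l ?powR_ge0//.
(* Distinct indices in one residue class modulo 3 are at least 3 apart, hence
   have disjoint hulls. *)
have part (r : int) : \sum_(n <- zrange N | (n %% 3)%Z == r) F n <= fine S.
  rewrite -big_filter; apply: le_trans (sumS _).
  apply: (dyadic_drop_sum_le bT TQ xM); first by rewrite filter_uniq// zrange_uniq.
  move=> n m; rewrite !mem_filter => /andP[/eqP nr _] /andP[/eqP mr _] nm.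
  lia.
have split3 n : F n = (if (n %% 3)%Z == 0 then F n else 0) +
   ((if (n %% 3)%Z == 1 then F n else 0) + (if (n %% 3)%Z == 2 then F n else 0)).
  have : (n %% 3)%Z = 0 \/ (n %% 3)%Z = 1 \/ (n %% 3)%Z = 2 by lia.
  by case=> [|[]] -> /=; rewrite ?addr0 ?add0r.
rewrite (eq_bigr _ (fun n _ => split3 n)) !big_split -!big_mkcond /=.
have := part 0; have := part 1; have := part 2; lra.
Qed.

(** The dyadic values are recovered from the drops because
    a n = drop n + a (n+1) / 2: a discrete Hardy inequality, with the factor 1/2
    weakened to 3/4 to make room for the drop. The sums range over symmetric
    intervals, where the shift by one only costs a boundary term, bounded because x phi(x) is. *)
Lemma schatten_summable : Q_schatten p phiC -> dyadic_summable phi p.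
Proof.
move=> [T [sT TQ]]; have [bT _] := sT.
have [M1 M10 xM1] := bounded_xphi phi_ge0 phi_ni bT TQ.
pose M := M1 + 1; have M0 : 0 < M by rewrite ltr_wpDl.
have xM x : 0 < x -> x * phi x <= M by move=> /xM1 h; rewrite /M; lra.
have [D hD] := schatten_dyadic_drop sT TQ xM.
pose q : R := (3 / 4) `^ p.
have q0 : 0 <= q by exact: powR_ge0.
have q1 : 0 < 1 - q.
  rewrite subr_gt0 /q /powR mulf_eq0 invr_eq0 !pnatr_eq0 /= expR_lt1.
  by rewrite pmulr_rlt0// ln_lt0//; apply/andP; split; lra.
have a0 n : 0 <= a n by exact: dyadic_val_ge0.
have aM n : a n `^ p <= M `^ p.
  by apply: ge0_ler_powR; rewrite ?nnegrE ?(ltW p0) ?(ltW M0)//; exact/xM/dyadic_gt0.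
have rec n : a n `^ p <= 3 `^ p * dyadic_drop phi n `^ p + q * a (n + 1) `^ p.
  have d0 := dyadic_drop_ge0 phi_ni n.
  have aE : a n = dyadic_drop phi n + a (n + 1) / 2.
    by rewrite /dyadic_val /dyadic_drop expfzDr// expr1z [_ * 2]mulrC; field.
  have a1 := a0 (n + 1).
  have q34 : 0 <= 3 / 4 :> R by lra.
  rewrite /q -(powRM _ _ d0)// -(powRM _ q34 a1).
  have mono (x y : R) : 0 <= x -> x <= y -> x `^ p <= y `^ p.
    by move=> x0 xy; apply: ge0_ler_powR => //; rewrite ?nnegrE ?(ltW p0)// (le_trans x0).
  (* Either the drop is at most half of the other summand, or it exceeds that half. *)
  have [h|h] := leP (dyadic_drop phi n) (a (n + 1) / 4).
    by apply: ler_wpDl; [exact: powR_ge0|apply: mono => //; lra].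
  by apply: ler_wpDr; [exact: powR_ge0|apply: mono => //; lra].
exists ((3 `^ p * D + q * M `^ p) / (1 - q)) => N.
rewrite ler_pdivlMr//; set S := \sum_(n <- zrange N) _.
have : S <= 3 `^ p * D + q * \sum_(n <- zrange N) a (n + 1) `^ p.
  apply: le_trans (ler_sum _ (fun n _ => rec n)) _.
  by rewrite big_split /= -!mulr_sumr lerD2r ler_wpM2l ?powR_ge0.
have := @zrange_shift (fun n => a n `^ p) N; rewrite -/S.
have := aM N%:Z; have : 0 <= a (- N%:Z) `^ p by exact: powR_ge0.
move=> h1 h2 h3 h4.
have : q * \sum_(n <- zrange N) a (n + 1) `^ p <= q * (S + M `^ p).
  by rewrite ler_wpM2l//; lra.
lra.
Qed.

End SchattenDyadic.

(** * The two norm conditions in dyadic form *)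

Section DyadicNorms.
Variable R : realType.
Local Notation mu := (@lebesgue_measure R).
Local Notation Rp := (@Rplus R).

Lemma mem_zrange (n : int) N : (absz n < N)%N -> n \in zrange N.
Proof.
rewrite mem_cat; case: n => i /= iN; apply/orP; [left|right];
  by rewrite map_f// mem_iota/= add0n ?(ltnW iN).
Qed.

(** Every finite set of integers is contained in a symmetric interval. *)
Lemma esum_zrange (t : int -> \bar R) : (forall n, 0 <= t n)%E ->
  (\esum_(n in [set: int]) t n < +oo)%E <->
  exists C : R, forall N, (\sum_(n <- zrange N) t n <= C%:E)%E.
Proof.
move=> t0; split=> [ty|[C tC]].
  have e0 : (0 <= \esum_(n in [set: int]) t n)%E by exact: esum_ge0.
  exists (fine (\esum_(n in [set: int]) t n)) => N; rewrite fineK ?ge0_fin_numE//.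
  apply: esum_ge; exists [set` zrange N]; first by split => //; exact: finite_seq.
  by rewrite -fsbig_seq// zrange_uniq.
apply: (@le_lt_trans _ _ C%:E); last exact: ltry.
apply: ge_ereal_sup => _ [A [fA _] <-].
have /finite_seqP[s AE] := fA.
pose N := (\sum_(n <- s) (absz n).+1)%N.
apply: le_trans (tC N); rewrite [leRHS]fsbig_seq ?zrange_uniq//.
apply: (lee_fsum_nneg_subset fA (finite_seq _)) => //.
move=> n; rewrite !inE AE /= => ns; apply: mem_zrange.
by rewrite /N (big_rem _ ns) /= addSn ltnS leq_addr.
Qed.

Lemma integral_pinch (A : set R) (g : R -> R) (c C m : R) : measurable A ->
  measurable_fun A g -> 0 <= c -> (forall x, A x -> c <= g x <= C) ->
  mu A = m%:E ->
  ((c * m)%:E <= \int[mu]_(x in A) (g x)%:E <= (C * m)%:E)%E.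
Proof.
move=> mA mg c0 gcC Am; have mg' : measurable_fun A (fun x => (g x)%:E).
  exact/measurable_EFinP.
have mc (k : R) : measurable_fun A (fun=> k%:E) by exact: measurable_cst.
rewrite [in (c * m)%:E]EFinM [in (C * m)%:E]EFinM -Am -!integral_cst//.
apply/andP; split; apply: ge0_le_integral => //.
- by move=> x /gcC/andP[h _]; rewrite lee_fin.
- by move=> x /gcC/andP[h _]; rewrite lee_fin (le_trans c0).
- by move=> x /gcC/andP[_ h]; rewrite lee_fin.
Qed.

Section IntegralSplit.
Variable g : R -> \bar R.
Hypothesis mg : measurable_fun Rp g.
Hypothesis g0 : forall x, 0 < x -> (0 <= g x)%E.

Lemma ico_sub_Rplus (b c : R) : 0 < b -> `[b, c[%classic `<=` Rp.
Proof.
move=> b0 x /=; rewrite in_itv /= => /andP[bx _].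
by apply/RplusE; exact: lt_le_trans bx.
Qed.

Lemma integral_ico_split (b c d : R) : 0 < b -> b <= c -> c <= d ->
  (\int[mu]_(x in `[b, d[) g x =
   \int[mu]_(x in `[b, c[) g x + \int[mu]_(x in `[c, d[) g x)%E.
Proof.
move=> b0 bc cd.
have U : `[b, d[%classic = `[b, c[%classic `|` `[c, d[%classic.
  by apply: itv_bndbnd_setU; rewrite bnd_simp.
have sub := @ico_sub_Rplus b d b0.
have mU : measurable_fun `[b, d[ g by exact: (measurable_funS (@measurable_Rplus R) sub mg).
have gU x : `[b, d[%classic x -> (0 <= g x)%E by move=> /sub/RplusE/g0.
rewrite U in mU gU *; rewrite ge0_integral_setU//=.
apply/disj_setPRL => x /=; rewrite !in_itv /= => /andP[cx _] /andP[_ xc].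
by move: (lt_le_trans xc cx); rewrite ltxx.
Qed.

Lemma integral_dyadic_split N :
  (\sum_(n <- zrange N) \int[mu]_(x in `[((2 : R) ^ n)%R, (2 * 2 ^ n)%R[) g x =
   \int[mu]_(x in `[((2 : R) ^ (- N%:Z))%R, ((2 : R) ^ N%:Z)%R[) g x)%E.
Proof.
have d0 := dyadic_gt0 R.
have dS (n : int) : 2 * 2 ^ n = (2 : R) ^ (n + 1).
  by rewrite expfzDr ?pnatr_eq0// expr1z mulrC.
elim: N => [|N IH].
  by rewrite big_nil oppr0 expr0z set_itvco0 integral_set0.
have S (F : int -> \bar R) : (\sum_(n <- zrange N.+1) F n =
    \sum_(n <- zrange N) F n + (F (Posz N) + F (Negz N)))%E.
  rewrite /zrange -addn1 iotaD add0n !map_cat !big_cat /= !big_cons !big_nil.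
  by rewrite !adde0 addeACA.
have eN : N.+1%:Z = N%:Z + 1 by rewrite -addn1 PoszD.
rewrite S IH NegzE !dS eN opprD addrNK.
have h0 : (2 : R) ^ (- N%:Z - 1) <= 2 ^ (- N%:Z) by rewrite ler_eXz2l ?ltr1n//; lia.
have h1 : (2 : R) ^ (- N%:Z) <= 2 ^ N%:Z by rewrite ler_eXz2l ?ltr1n//; lia.
have h2 : (2 : R) ^ N%:Z <= 2 ^ (N%:Z + 1) by rewrite ler_eXz2l ?ltr1n//; lia.
rewrite [RHS](integral_ico_split (c := 2 ^ (- N%:Z)))//; last exact: (le_trans h1 h2).
rewrite [in RHS](integral_ico_split (d := 2 ^ (N%:Z + 1)) (c := 2 ^ N%:Z) _ h1 h2)//.
by rewrite [RHS]addeC -[RHS]addeA.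
Qed.

Lemma integral_dyadic_finite :
  (\int[mu]_(x in Rp) g x < +oo)%E <->
  exists C : R, forall N,
    (\sum_(n <- zrange N) \int[mu]_(x in `[((2 : R) ^ n)%R, (2 * 2 ^ n)%R[) g x <= C%:E)%E.
Proof.
have d0 := dyadic_gt0 R.
pose F N := `[(2 : R) ^ (- N%:Z), (2 : R) ^ N%:Z[%classic.
have FR N : F N `<=` Rp by exact: ico_sub_Rplus.
have mF N : measurable (F N) by exact: measurable_itv.
split=> [gy|[C gC]].
  have i0 : (0 <= \int[mu]_(x in Rp) g x)%E.
    by apply: integral_ge0 => x /RplusE/g0.
  exists (fine (\int[mu]_(x in Rp) g x)) => N; rewrite fineK ?ge0_fin_numE//.
  rewrite integral_dyadic_split; apply: ge0_subset_integral => //.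
  - exact: measurable_Rplus.
  - by move=> x /RplusE/g0.
  - exact: FR.
apply: (@le_lt_trans _ _ C%:E); last exact: ltry.
have -> : Rp = \bigcup_N F N.
  apply/seteqP; split=> [x /RplusE x0|x [N _ /FR]//].
  have [n /andP[nx xn]] := dyadic_floor x0.
  exists (absz n).+1 => //; rewrite /F /= in_itv /=; apply/andP; split.
    by apply: le_trans nx; rewrite ler_eXz2l ?ltr1n//; lia.
  apply: lt_le_trans xn _; rewrite -[X in X * _]expr1z -expfzDr ?pnatr_eq0//.
  by rewrite ler_eXz2l ?ltr1n//; lia.
apply: integral_bigcup_le => //.
- apply/nondecreasing_seqP => N; apply/subsetPset => x.
  rewrite /F /= !in_itv /= => /andP[h1 h2]; apply/andP; split.
    by apply: le_trans h1; rewrite ler_eXz2l ?ltr1n//; lia.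
  by apply: lt_le_trans h2 _; rewrite ler_eXz2l ?ltr1n//; lia.
- by move=> N; exact: (measurable_funS (@measurable_Rplus R) (FR N) mg).
- by move=> N x /FR/RplusE/g0.
- by move=> N; rewrite -integral_dyadic_split.
Qed.

End IntegralSplit.

End DyadicNorms.

Section Conditions.
Variable R : realType.
Local Notation mu := (@lebesgue_measure R).
Local Notation Rp := (@Rplus R).
Variable phi : R -> R.
Hypothesis phi_ge0 : forall x, 0 < x -> 0 <= phi x.
Hypothesis phi_ni : forall x y, 0 < x -> x <= y -> phi y <= phi x.
Local Notation phiC := (fun x => (phi x)%:C).
Local Notation a := (dyadic_val phi).
Variable p : R.
Hypothesis p0 : 0 < p.

(** The shift by one is harmless in a sum over all integers: on symmetric intervals it is
    absorbed by enlarging the interval by one. *)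
Lemma pinched_summable (t : int -> \bar R) (c C : R) : 0 < c ->
  (forall n, ((c * a (n + 1) `^ p)%:E <= t n <= (C * a n `^ p)%:E)%E) ->
  (exists D : R, forall N, (\sum_(n <- zrange N) t n <= D%:E)%E) <->
  dyadic_summable phi p.
Proof.
move=> c0 tcC; split=> -[D hD].
  exists (D / c) => N; rewrite ler_pdivlMr// mulrC.
  have h : c * \sum_(n <- zrange N.+1) a (n + 1) `^ p <= D.
    rewrite -lee_fin; apply: le_trans (hD N.+1); rewrite mulr_sumr -sumEFin.
    by apply: lee_sum => n _; case/andP: (tcC n).
  apply: le_trans h; rewrite ler_pM2l//.
  have := zrange_shift (fun n => a n `^ p) N.+1; rewrite [in RHS]zrange_sumS NegzE.
  have : 0 <= a N.+1%:Z `^ p by exact: powR_ge0.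
  have : 0 <= a N%:Z `^ p by exact: powR_ge0.
  lra.
exists (`|C| * D) => N.
apply: (@le_trans _ _ (\sum_(n <- zrange N) (`|C| * a n `^ p)%:E)%E).
  apply: lee_sum => n _; case/andP: (tcC n) => _ /le_trans; apply.
  by rewrite lee_fin ler_wpM2r ?powR_ge0// ler_norm.
by rewrite sumEFin lee_fin -mulr_sumr ler_wpM2l.
Qed.

Let dyadicS (n : int) : (2 : R) ^ (n + 1) = 2 * 2 ^ n.
Proof. by rewrite expfzDr ?pnatr_eq0// expr1z mulrC. Qed.

(** On [2^n, 2^(n+1)] the function phi lies between phi(2^(n+1)) and phi(2^n), so the
    n-th term lies between (a (n+1) / 2)^p and (a n)^p. *)
Lemma Xspace_summable : Xspace p phiC <-> dyadic_summable phi p.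
Proof.
have mphi := measurable_phi phi_ni.
pose t (n : int) := (((2 : R) `^ (n%:~R * p / 2))%:E *
       (\int[mu]_(x in `[(2 : R) ^ n, (2 : R) ^ (n + 1)])
          (Normc.normc (phi x)%:C ^+ 2)%:E) `^ (p / 2))%E.
have t0 n : (0 <= t n)%E by rewrite mule_ge0 ?poweR_ge0// lee_fin powR_ge0.
suff tp n : ((2^-1 `^ p * a (n + 1) `^ p)%:E <= t n <= (1 * a n `^ p)%:E)%E.
  rewrite -(pinched_summable _ tp) ?powR_gt0//; split.
    by move=> [_ h]; apply/(esum_zrange t0).
  move=> h; split; first exact: cmeasurable_real.
  exact/(esum_zrange t0).
have d0 := dyadic_gt0 R n.
have mI : measurable (`[(2 : R) ^ n, (2 : R) ^ (n + 1)]%classic) by exact: measurable_itv.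
have IR : `[(2 : R) ^ n, (2 : R) ^ (n + 1)]%classic `<=` Rp by exact: itv_sub_Rplus.
have p20 : 0 <= p / 2 by rewrite divr_ge0// ltW.
have f1 : 0 <= phi (2 * 2 ^ n) by apply: phi_ge0; lra.
have f0 : 0 <= phi (2 ^ n) by exact: phi_ge0.
pose E := (\int[mu]_(x in `[(2 : R) ^ n, (2 : R) ^ (n + 1)])
  (Normc.normc (phi x)%:C ^+ 2)%:E)%E.
have /andP[E1 E2] : ((phi (2 * 2 ^ n) ^+ 2 * 2 ^ n)%:E <= E <= (phi (2 ^ n) ^+ 2 * 2 ^ n)%:E)%E.
apply: integral_pinch => //.
- apply: (measurable_funS (@measurable_Rplus R) IR).
  under eq_fun do rewrite normc_real.
  by apply: measurable_funX; apply: measurableT_comp.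
- exact: sqr_ge0.
- move=> x; rewrite normc_real /= in_itv /= dyadicS => /andP[h1 h2].
  have x0 : 0 < x by exact: lt_le_trans h1.
  have fx := phi_ge0 x0.
  by rewrite ger0_norm// !lerXn2r ?nnegrE// phi_ni.
- by rewrite dyadicS lebesgue_measure_itv /= lte_fin ifT; [rewrite -EFinB; congr _%:E; lra|lra].
have val (y : R) : 0 <= y ->
    (((2 : R) `^ (n%:~R * p / 2))%:E * (y ^+ 2 * 2 ^ n)%:E `^ (p / 2))%E =
    ((2 ^ n * y) `^ p)%:E.
  move=> y0; rewrite poweR_EFin -EFinM; congr _%:E.
  have -> : (2 : R) `^ (n%:~R * p / 2) = (2 ^ n) `^ (p / 2).
    by rewrite -(powR_intmul n)// -powRrM mulrA.
  rewrite -powRM ?mulr_ge0 ?sqr_ge0 ?(ltW d0)//.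
  rewrite (_ : 2 ^ n * (y ^+ 2 * 2 ^ n) = (2 ^ n * y) ^+ 2); last by ring.
  rewrite -powR_mulrn ?mulr_ge0 ?(ltW d0)// -powRrM; congr (_ `^ _); by field.
have mono (u v : \bar R) : (0 <= u)%E -> (u <= v)%E ->
   (((2 : R) `^ (n%:~R * p / 2))%:E * u `^ (p / 2) <=
    ((2 : R) `^ (n%:~R * p / 2))%:E * v `^ (p / 2))%E.
  move=> u0 uv; apply: lee_wpmul2l; first by rewrite lee_fin powR_ge0.
  by apply: gt0_ler_poweR => //; rewrite in_itv /= leey andbT ?(le_trans u0)//.
apply/andP; split.
  apply: le_trans (mono _ _ _ E1); last by rewrite lee_fin mulr_ge0 ?sqr_ge0// ltW.
  rewrite val// lee_fin -powRM ?invr_ge0//; last exact: dyadic_val_ge0.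
  rewrite /dyadic_val dyadicS le_eqVlt; apply/orP; left; apply/eqP.
  by congr (_ `^ _); by field.
have E0 : (0 <= E)%E by apply: integral_ge0 => x _; rewrite lee_fin sqr_ge0.
by apply: le_trans (mono _ _ E0 E2) _; rewrite val// mul1r.
Qed.

(** On [2^n, 2^(n+1)[ the function x phi(x) lies between a (n+1) / 2 and 2 a n, and
    dx / x is comparable to dx / 2^n. *)
Lemma Lp_dxx_summable : Lp_dxx p (fun x => (x * phi x)%:C) <-> dyadic_summable phi p.
Proof.
have mphi := measurable_phi phi_ni.
pose g x := Normc.normc (x * phi x)%:C `^ p / x.
have mxphi : measurable_fun Rp (fun x => x * phi x) by exact: measurable_funM.
have mg : measurable_fun Rp (fun x => (g x)%:E).
  apply/measurable_EFinP; apply: measurable_funM.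
    under eq_fun do rewrite normc_real.
    have m1 : measurable_fun Rp (fun x => `|x * phi x|) by exact: measurableT_comp.
    exact: (measurableT_comp (measurable_powR _) m1).
  apply: (eq_measurable_fun (fun x : R => x `^ (-1))); last first.
    exact: measurable_funTS (measurable_powR _).
  by move=> x; rewrite inE => /RplusE x0; rewrite powR_inv1// ltW.
have g0 x : 0 < x -> (0 <= (g x)%:E)%E.
  by move=> x0; rewrite lee_fin divr_ge0 ?powR_ge0// ltW.
suff tp n : ((2^-1 `^ p / 2 * a (n + 1) `^ p)%:E <=
    \int[mu]_(x in `[((2 : R) ^ n)%R, (2 * 2 ^ n)%R[) (g x)%:E <=
    (2 `^ p * a n `^ p)%:E)%E.
  rewrite -(pinched_summable _ tp) ?divr_gt0 ?powR_gt0//; split.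
    by move=> [_ h]; apply/(integral_dyadic_finite mg g0).
  move=> h; split; first exact: cmeasurable_real.
  exact/(integral_dyadic_finite mg g0).
have d0 := dyadic_gt0 R n.
have AR := @ico_sub_Rplus R _ (2 * 2 ^ n) d0.
have mA : measurable (`[(2 : R) ^ n, 2 * 2 ^ n[%classic) by exact: measurable_itv.
have a0 m : 0 <= a m by exact: dyadic_val_ge0.
have mono (x y : R) : 0 <= x -> x <= y -> x `^ p <= y `^ p.
  by move=> x0 xy; apply: ge0_ler_powR => //; rewrite ?nnegrE ?(ltW p0)// (le_trans x0).
have f1 : 0 <= phi (2 * 2 ^ n) by apply: phi_ge0; lra.
have f0 : 0 <= phi (2 ^ n) by exact: phi_ge0.
pose c := 2^-1 `^ p * a (n + 1) `^ p / (2 * 2 ^ n).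
pose C := 2 `^ p * a n `^ p / 2 ^ n.
have := @integral_pinch R _ g c C (2 ^ n) mA _ _ _ _.
rewrite (_ : c * 2 ^ n = 2^-1 `^ p / 2 * a (n + 1) `^ p); last first.
  by rewrite /c; field; rewrite gt_eqF.
rewrite (_ : C * 2 ^ n = 2 `^ p * a n `^ p); last first.
  by rewrite /C; field; rewrite gt_eqF.
apply.
- by apply/measurable_EFinP; exact: (measurable_funS (@measurable_Rplus R) AR mg).
- by rewrite divr_ge0 ?mulr_ge0 ?powR_ge0// ltW.
- move=> x; rewrite /= in_itv /= => /andP[h1 h2].
  have x0 : 0 < x by exact: lt_le_trans h1.
  have fx := phi_ge0 x0.
  have fl : phi (2 * 2 ^ n) <= phi x by rewrite phi_ni// ltW.
  have fr : phi x <= phi (2 ^ n) by rewrite phi_ni.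
  rewrite /g normc_real ger0_norm ?mulr_ge0// ?(ltW x0)//.
  rewrite /c /C -!powRM// ?invr_ge0//; apply/andP; split.
    apply: ler_pM; rewrite ?powR_ge0 ?invr_ge0 ?mulr_ge0 ?(ltW d0)//.
      apply: mono; first by rewrite mulr_ge0 ?invr_ge0.
      by rewrite /dyadic_val dyadicS -!mulrA mulKf ?pnatr_eq0// ler_pM// ltW.
    by rewrite lef_pV2 ?posrE//; lra.
  apply: ler_pM; rewrite ?powR_ge0 ?invr_ge0 ?(ltW x0)//; last first.
    by rewrite lef_pV2 ?posrE.
  apply: mono; first by rewrite mulr_ge0 ?(ltW x0).
  by rewrite /dyadic_val mulrA ler_pM ?(ltW x0)// ltW.
- by rewrite lebesgue_measure_itv /= lte_fin ifT; [rewrite -EFinB; congr _%:E; lra|lra].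
Qed.

End Conditions.

(** * Boundedness, compactness and Schatten class membership *)

Theorem theorem4p6 (R : realType) (phi : R -> R)
    (phi_ge0 : forall x, 0 < x -> 0 <= phi x)
    (phi_nonincr : forall x y, 0 < x -> x <= y -> phi y <= phi x) :
  [/\ Q_bounded (fun x => (phi x)%:C) <->
        (exists M : R, forall x, 0 < x -> `|x * phi x| <= M),
      Q_compact (fun x => (phi x)%:C) <->
        (x * phi x @[x --> 0^'+] --> 0 /\ x * phi x @[x --> +oo] --> 0) &
      forall p : R, 1 / 2 < p ->
        (Q_schatten p (fun x => (phi x)%:C) <->
           Xspace p (fun x => (phi x)%:C)) /\
        (Xspace p (fun x => (phi x)%:C) <->
           Lp_dxx p (fun x => (x * phi x)%:C))].
Proof.
split.
- split=> [[T [bT TQ]]|[M hM]].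
    have [C _ hC] := bounded_xphi phi_ge0 phi_nonincr bT TQ.
    by exists C => x x0; rewrite ger0_norm ?hC// mulr_ge0 ?phi_ge0 ?ltW.
  apply: (Q_bounded_xphi phi_ge0 phi_nonincr (M := M)) => x x0.
  by apply: le_trans (hM x x0); exact: ler_norm.
- split=> [[T [cT TQ]]|[h0 hoo]].
    exact: (compact_limits phi_ge0 phi_nonincr cT TQ).
  exact: limits_compact.
- move=> p p12; have p0 : 0 < p by apply: lt_trans p12; rewrite divr_gt0.
  have X := Xspace_summable phi_ge0 phi_nonincr p0.
  have L := Lp_dxx_summable phi_ge0 phi_nonincr p0.
  split; last by rewrite X L.
  rewrite X; split; first exact: schatten_summable.
  exact: summable_schatten.
Qed.
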